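(* Let $\beta\in(\bar{\beta}_d,\beta_c)$, $L>0$, $B>0$. There exists $\varepsilon=\varepsilon(\beta,\xi)>0$ such that for all $\beta'\in[(1-\varepsilon)\beta,\beta]$ the following holds for all sufficiently large $N$. There exists a subset $E(\bm{G})\subset S_{\beta'}(\bm{G})$, depending only on $\beta',L,\xi,\bm{G}$, with exponentially small Gibbs mass relative to $\mu_{\beta,\bm{G}}$: $$\mathbb{E}\,\mu_{\beta,\bm{G}}(E(\bm{G}))\le e^{-c_0N},\qquad c_0=c_0(\beta,L,\xi)>0,$$ such that if $\mathcal{A}:\mathbb{R}^M\to\mathbb{R}^N$ is an $L$-Lipschitz algorithm satisfying $\sup_{\bm{G}}\|\mathcal{A}(\bm{G})\|\le\sqrt{BN}$ and $\mathbb{P}(\mathcal{A}(\bm{G})\notin S_\beta(\bm{G}))\le\varepsilon_0$ for some $\varepsilon_0=\varepsilon_0(B,\beta,\xi)>0$ (a constant depending only on $B,\beta,\xi$), then $$\mathbb{P}\big(\mathcal{A}(\bm{G})\in E(\bm{G})\big)+4\,\mathbb{P}\big(\mathcal{A}(\bm{G})\notin S_{\beta'}(\bm{G})\big)\ge 1-e^{-c_1N},\qquad c_1=c_1(\beta,L,\xi)>0.$$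
   Context: Fix an integer $P\ge2$ and real scalars $(\gamma_k)_{k=2}^P$, not all zero, and let $\xi(x)=\sum_{k=2}^P\gamma_k^2x^k$ (the mixture). Let $\bm{G}=(g_{i_1,\dots,i_k})_{1\le i_1,\dots,i_k\le N,\;2\le k\le P}$ be i.i.d. $N(0,1)$, viewed as an element of $\mathbb{R}^M$ with $M=\sum_{k=2}^PN^k$. The Hamiltonian is $$H_N(\bm{\sigma})=H_N(\bm{\sigma};\bm{G})=\sum_{k=2}^P\frac{\gamma_k}{N^{(k-1)/2}}\sum_{1\le i_1,\dots,i_k\le N}g_{i_1,\dots,i_k}\sigma_{i_1}\cdots\sigma_{i_k},\qquad\bm{\sigma}\in\{-1,+1\}^N,$$ and the Gibbs measure is $\mu_{\beta,\bm{G}}(\bm{\sigma})=e^{\beta H_N(\bm{\sigma})}/Z_N(\beta)$ with $Z_N(\beta)=\sum_{\bm{\sigma}\in\{-1,+1\}^N}e^{\beta H_N(\bm{\sigma})}$. The critical inverse temperature $\beta_c$ is the largest $\beta$ for which $\lim_{N\to\infty}\frac1N\mathbb{E}\log Z_N(\beta)=\beta^2\xi(1)/2+\log 2$. With $\varphi$ and $\Phi$ the density and cumulative distribution function of the standard normal distribution, $$\bar\beta_d=\inf_{q\in(0,1)}\frac{2\sqrt{\xi'(1)}\,\varphi\big(\Phi^{-1}\big(\frac{1+q}{2}\big)\big)}{\xi(1)-\xi(q)}.$$ For $\beta\geq 0$, $S_\beta(\bm{G})=\{\bm{\sigma}\in\{-1,+1\}^N:H_N(\bm{\sigma};\bm{G})\ge\beta\xi(1)N\}$.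 A map $\mathcal{A}:\mathbb{R}^M\to\mathbb{R}^N$ is called an $L$-Lipschitz algorithm if $\|\mathcal{A}(\bm{G})-\mathcal{A}(\bm{G}')\|\le L\|\bm{G}-\bm{G}'\|$ for all $\bm{G},\bm{G}'\in\mathbb{R}^M$, where $\|\cdot\|$ is the Euclidean norm. ''Sufficiently large $N$'' does not depend on the algorithm $\mathcal{A}$. *)

(* Defs.v *)
From HB Require Import structures.
From mathcomp Require Import all_boot all_order all_algebra.
From mathcomp Require Import all_classical all_reals all_analysis.

Set Implicit Arguments.
Unset Strict Implicit.
Unset Printing Implicit Defensive.

Import Order.TTheory GRing.Theory Num.Def Num.Theory.
Import numFieldNormedType.Exports.

Local Open Scope classical_set_scope.
Local Open Scope ring_scope.

Section euclidean.
Context {R : realType}.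

Definition l2norm n (x : n.-tuple R) : R :=
  Num.sqrt (\sum_(i < n) tnth x i ^+ 2).

Definition l2dist n (x y : n.-tuple R) : R :=
  Num.sqrt (\sum_(i < n) (tnth x i - tnth y i) ^+ 2).

Definition l2lipschitz m n (L : R) (f : m.-tuple R -> n.-tuple R) :=
  forall x y, l2dist (f x) (f y) <= L * l2dist x y.

End euclidean.

(* The standard Gaussian measure on R^n, for the product sigma-algebra on
   n-tuples: the law of x :: v with x ~ N(0,1) independent of v ~ N(0, I_{n-1}).
   gaussian_box characterizes it as the law of n i.i.d. N(0,1) variables. *)
Section gaussian.
Context {R : realType}.

Definition pair_cons n (p : measurableTypeR R * n.-tuple (measurableTypeR R)) :
  n.+1.-tuple (measurableTypeR R) := [tuple of p.1 :: p.2].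

Lemma measurable_pair_cons n : measurable_fun setT (@pair_cons n).
Proof. by apply: measurable_cons. Qed.

HB.instance Definition _ n :=
  isMeasurableFun.Build _ _ _ _ (@pair_cons n) (@measurable_pair_cons n).

Fixpoint gaussian n : probability (n.-tuple (measurableTypeR R)) R :=
  if n is n'.+1 then
    distribution (normal_prob (0 : R) 1 \x gaussian n')%E (@pair_cons n')
  else \d_([tuple] : 0.-tuple (measurableTypeR R)).

Lemma gaussian_box n (A : 'I_n -> set (measurableTypeR R)) :
  (forall i, measurable (A i)) ->
  gaussian n [set x | forall i, A i (tnth x i)] =
  (\prod_(i < n) normal_prob (0 : R) 1 (A i))%E.
Proof.
elim: n A => [|n IHn] A mA.
  by rewrite big_ord0 /= diracE mem_set//= => -[].
have mB (B : 'I_n -> set (measurableTypeR R)) : (forall i, measurable (B i)) ->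
    measurable [set x : n.-tuple (measurableTypeR R) | forall i, B i (tnth x i)].
  move=> mB; rewrite (_ : mkset _ = \bigcap_(i in [set: 'I_n])
      ((@tnth n (measurableTypeR R))^~ i @^-1` B i)).
    apply: fin_bigcap_measurable => [|i _]; first exact: finite_finset.
    by rewrite -[X in measurable X]setTI; exact: measurable_tnth.
  by apply/seteqP; split=> [x /= h i _|x /= h i];
    [exact: h|exact: (h i Logic.I)].
rewrite /= /distribution /pushforward /=.
rewrite (_ : _ @^-1` _ = A ord0 `*`
    [set x | forall i, A (lift ord0 i) (tnth x i)]).
  rewrite product_measure1E//; last first.
    by apply: (mB (fun i => A (lift ord0 i))) => i; exact: mA.
  rewrite big_ord_recl; congr (_ * _)%E.
  by apply: (IHn (fun i => A (lift ord0 i))) => i; exact: mA.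
apply/seteqP; split=> -[a v] /=.
  move=> h; split=> [|i]; first exact: (h ord0).
  by have := h (lift ord0 i); rewrite /pair_cons tnthS.
move=> [Aa Av] i; case: (unliftP ord0 i) => [j|] ->; last exact: Aa.
by rewrite /pair_cons tnthS.
Qed.

End gaussian.

Section mixed_pspin.
Context {R : realType}.
Variables (P : nat) (gamma : nat -> R).

Definition xi : {poly R} := \sum_(2 <= k < P.+1) gamma k ^+ 2 *: 'X^k.

Section size_N.
Variable N : nat.

(* k : 'I_P.-1 stands for the degree k.+2, so that degrees range over 2..P. *)
Definition coupling : finType := {k : 'I_P.-1 & k.+2.-tuple 'I_N}.

Definition disorder_dim : nat := #|coupling|.

Lemma disorder_dimE : disorder_dim = (\sum_(2 <= k < P.+1) N ^ k)%N.
Proof.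
rewrite /disorder_dim card_tagged sumnE big_map big_enum /=.
under eq_bigr do rewrite card_tuple card_ord.
rewrite -(big_mkord xpredT (fun k => N ^ k.+2)%N).
case: P => [|p]; first by rewrite !big_geq.
by rewrite !big_add1.
Qed.

Definition disorder : Type := disorder_dim.-tuple (measurableTypeR R).

Definition coef (G : disorder) (k : 'I_P.-1) (i : k.+2.-tuple 'I_N) : R :=
  tnth G (enum_rank (Tagged (fun k : 'I_P.-1 => k.+2.-tuple 'I_N) i)).

(* true stands for the spin -1 *)
Definition config : finType := {ffun 'I_N -> bool}.

Definition spin (s : config) (i : 'I_N) : R := (-1) ^+ s i.

Definition spins (s : config) : N.-tuple R := [tuple spin s i | i < N].

Definition hamiltonian (G : disorder) (s : config) : R :=
  \sum_(k < P.-1) gamma k.+2 / N%:R `^ (k.+1%:R / 2) *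
    \sum_(i : k.+2.-tuple 'I_N) coef G i * \prod_(j < k.+2) spin s (tnth i j).

Definition partition_function (b : R) (G : disorder) : R :=
  \sum_s expR (b * hamiltonian G s).

Definition gibbs (b : R) (G : disorder) (E : {set config}) : R :=
  \sum_(s in E) expR (b * hamiltonian G s) / partition_function b G.

(* This is S_b(G), as a set of configurations. *)
Definition superlevel (b : R) (G : disorder) : {set config} :=
  [set s | b * xi.[1] * N%:R <= hamiltonian G s]%SET.

Definition outputs_in (A : disorder -> N.-tuple R)
    (E : disorder -> {set config}) : set disorder :=
  [set G | exists2 s, s \in E G & A G = spins s].

Definition free_energy (b : R) : \bar R :=
  ((N%:R^-1)%:E * 'E_(gaussian disorder_dim)[fun G => ln (partition_function b G)])%E.

End size_N.

Definition annealed (b : R) : Prop :=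
  free_energy N b @[N --> \oo] --> (b ^+ 2 * xi.[1] / 2 + ln 2)%:E.

(* The largest b in this set, by beta_c_max; sup makes beta_c total. *)
Definition beta_c : R := sup [set b | annealed b].

Lemma beta_c_max b : annealed b ->
  (forall b', annealed b' -> b' <= b) -> beta_c = b.
Proof.
move=> hb ub; apply/eqP; rewrite eq_le; apply/andP; split.
  by apply: ge_sup => [|b' /ub//]; exists b.
by apply: ub_le_sup => //; exists b => b' /ub.
Qed.

Definition Phi (x : R) : R := fine (normal_prob (0 : R) 1 `]-oo, x]).

Definition Phi_inv : R -> R := 'pinv_(fun=> 0) setT Phi.

Definition beta_d : R :=
  inf [set 2 * Num.sqrt xi^`().[1] * normal_pdf 0 1 (Phi_inv ((1 + q) / 2))
           / (xi.[1] - xi.[q]) | q in `]0, 1[ ].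

End mixed_pspin.

(* Main.v *)
(* Call a configuration s of the superlevel set atypical if, for some rung rho
   of a geometric ladder 1 = rho_0 > ... > rho_K close to 0, the correlated
   disorder rho G + sqrt(1 - rho^2) G' has, with probability at least 1/2 in G',
   a point of its own superlevel set at overlap about q with s (at least
   about q, on the last rung).

   If A is Lipschitz, the overlap of A(G) and A(rho G + sqrt(1 - rho^2) G')
   concentrates around a number chi(rho).  It is close to 1 at rho_0 and drops by
   small steps along the ladder, so on some rung it is about q, or it is still
   above q on the last rung.  There, the second output witnesses that the first
   one is atypical, unless one of the two outputs fails.

   Atypical configurations are rare under the Gibbs measure: below beta_c the
   Gibbs average of {s in E(G)} is, up to a small exponential factor, at most
   the probability of {s in E(G + beta v_s)}, where H(.; G) is the scalar product
   of G with v_s and v_s . v_t = N xi(overlap s t).  There, a witness must reach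
   energy about (beta' xi(1) - beta xi(q)) N among the points at overlap about q
   with s, whereas the Sudakov-Fernique comparison with the linear field
   sqrt(xi'(1)) <g, t> bounds that maximum by about
   2 sqrt(xi'(1)) phi(Phi^-1((1 + q) / 2)) N.  As beta > beta_d, some q makes the
   latter smaller, and Gaussian concentration concludes.

   Concentration comes from the Prekopa-Leindler inequality in the form
   (f x g y <= exp(|x - y|^2 / 4)) -> E f * E g <= 1. *)

Require Import Defs.
From HB Require Import structures.
From mathcomp Require Import all_boot all_order all_algebra.
From mathcomp Require Import all_classical all_reals all_analysis.
From mathcomp Require Import measurable_realfun ring lra.

Set Implicit Arguments.
Unset Strict Implicit.
Unset Printing Implicit Defensive.

Import Order.TTheory GRing.Theory Num.Def Num.Theory.
Import numFieldNormedType.Exports.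

Local Open Scope classical_set_scope.
Local Open Scope ring_scope.

(** * Gaussian measure on tuples *)

(** The atypical set may see only [beta'] and [L], must serve every algorithm at once, and its rates
    must not see [beta']. So it is a union over all rungs, since the rung that is crossed depends on
    the algorithm, and only the number of rungs enters the planted estimate.

    The correlations are squares rho = u^2 because chi(u^2) is then the mean squared length, per
    site, of the output averaged by the noise operator at u. One rung costs an averaged conditional
    variance, which the Lipschitz bound makes small. On the last rung the overlap is not bounded
    above; the planted field, multiplied by rho, is then too weak to help.

    The level 1/2 in the definition of a witness costs a factor 2 in Markov's inequality, so a
    failure is counted 1 + 2 = 3 times, within the allowed 4. Lowering the energy level from beta to
    beta' costs (beta - beta') xi(q) in the planted energy, which eps absorbs.

    Sudakov-Fernique is proved for log-sum-exp by exchanging small independent increments of the two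
    fields, with no derivative of the interpolated expectation. The concentration constants are not
    sharp; only the exponential rate in N matters. *)

Section standard_normal.
Context {R : realType}.
Local Notation MR := (measurableTypeR R).
Local Notation leb := (@lebesgue_measure R).
Local Notation N01 := (normal_prob (0 : R) 1).
Local Notation phi := (normal_pdf (0 : R) 1).

Lemma normal_pdf01E (x : R) :
  phi x = (Num.sqrt (2 * pi))^-1 * expR (- (x ^+ 2 / 2)).
Proof.
rewrite normal_pdfE ?oner_eq0// /normal_peak /normal_fun expr1n subr0.
by rewrite -mulrnAr mul1r mulr_natl mulNr.
Qed.

Lemma normal_pdf01_gt0 (x : R) : 0 < phi x.
Proof.
by rewrite normal_pdf01E mulr_gt0 ?expR_gt0// invr_gt0 sqrtr_gt0 mulr_gt0 ?pi_gt0.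
Qed.

(** By uniqueness of Lebesgue measure: [a] times its image under the affine map gives every
    half-open interval its length. *)
Lemma ge0_integral_affine (a b : R) (f : MR -> \bar R) : 0 < a ->
  measurable_fun [set: MR] f -> (forall x, 0 <= f x)%E ->
  (\int[leb]_x f x = a%:E * \int[leb]_x f (a * x + b)%R)%E.
Proof.
move=> a0 mf f0.
pose h : measurableTypeR R -> measurableTypeR R := fun x => a * x + b.
have mh : measurable_fun setT h.
  by apply: measurable_funD => //; exact: measurable_funM.
pose k : {nonneg R} := NngNum (ltW a0).
pose m : {measure set (measurableTypeR R) -> \bar R} := mscale k
  (measure_function_pushforward__canonical__measure_function_Measure leb mh).
have E A : measurable A -> leb A = m A.
  apply: lebesgue_measure_unique => _ [[u v]] _ <-.
  have -> : (m [set` `]u, v]%R] = a%:E * leb [set` `](u - b) / a, (v - b) / a]%R])%E.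
    rewrite /m /= /mscale /= /pushforward /=; congr (_ * leb _)%E.
    apply/seteqP; split=> x /=; rewrite !in_itv/= /h => /andP[].
      move=> ux xv; rewrite ltr_pdivrMr// ler_pdivlMr//.
      by rewrite ltrBlDr lerBrDr ![x * a]mulrC ux.
    rewrite ltr_pdivrMr// ler_pdivlMr// ltrBlDr lerBrDr ![x * a]mulrC.
    by move=> -> ->.
  rewrite !lebesgue_measure_itv/= !lte_fin ltr_pM2r ?invr_gt0// ltrD2r.
  case: ifP => _; last by rewrite mule0.
  by rewrite -!EFinD -EFinM; congr EFin; field; rewrite gt_eqF.
transitivity (\int[m]_x f x)%E.
  by apply: eq_measure_integral => A mA _; exact: E.
rewrite ge0_integral_mscale//; congr (_ * _)%E.
by rewrite ge0_integral_pushforward.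
Qed.

Lemma integral_N01 (f : MR -> \bar R) :
  measurable_fun [set: MR] f -> (forall x, 0 <= f x)%E ->
  (\int[N01]_x f x = \int[leb]_x (f x * (phi x)%:E))%E.
Proof.
move=> mf f0.
have dom := @normal_prob_dominates R 0 1.
rewrite -(Radon_Nikodym_SigmaFinite.change_of_variables dom f0)//.
have mRN : leb.-integrable setT (Radon_Nikodym_SigmaFinite.f N01 leb).
  exact: Radon_Nikodym_SigmaFinite.f_integrable.
apply: ae_eq_integral => //.
- by apply: emeasurable_funM => //; exact: (measurable_int leb).
- apply: emeasurable_funM => //; apply/measurable_EFinP.
  exact: measurable_normal_pdf.
- apply: ae_eqe_mul2l; apply: integral_ae_eq => //.
    by apply/measurable_EFinP; exact: measurable_normal_pdf.
  by move=> A _ mA; rewrite -Radon_Nikodym_SigmaFinite.f_integral.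
Qed.

(* Invariance under the reflection of matrix ((r, s), (s, -r)). *)
Lemma N01_reflection (h : MR * MR -> \bar R) (r s : R) :
  measurable_fun [set: MR * MR] h -> (forall z, 0 <= h z)%E ->
  0 < s -> r ^+ 2 + s ^+ 2 = 1 ->
  (\int[N01]_x \int[N01]_y h (r * x + s * y, s * x - r * y)%R =
   \int[N01]_x \int[N01]_y h (x, y))%E.
Proof.
move=> mh h0 s0 rs.
have mphi : measurable_fun [set: MR] (fun x => (phi x)%:E).
  by apply/measurable_EFinP; exact: measurable_normal_pdf.
have phi0 x : (0 <= (phi x)%:E)%E by rewrite lee_fin normal_pdf_ge0.
have mlin (a b : R) : measurable_fun [set: MR * MR] (fun z : MR * MR => a * z.1 + b * z.2).
  by apply: measurable_funD; apply: measurable_funM.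
have mlinp (a b a' b' : R) : measurable_fun [set: MR * MR]
    (fun z : MR * MR => (a * z.1 + b * z.2, a' * z.1 + b' * z.2)).
  by apply/measurable_fun_pairP; split; exact: mlin.
pose g1 (z : MR * MR) := (h (r * z.1 + s * z.2, s * z.1 - r * z.2)%R)%E.
have mg1 : measurable_fun [set: MR * MR] g1.
  apply: (measurableT_comp mh).
  rewrite [X in measurable_fun _ X](_ : _ =
    (fun z : MR * MR => (r * z.1 + s * z.2, s * z.1 + (- r) * z.2))); first exact: mlinp.
  by apply/funext => z; rewrite mulNr.
have dbl (g : MR * MR -> \bar R) : measurable_fun [set: MR * MR] g ->
    (forall z, 0 <= g z)%E ->
    (\int[N01]_x \int[N01]_y g (x, y) =
     \int[leb]_x \int[leb]_y (g (x, y) * ((phi x * phi y)%:E)))%E.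
  move=> mg g0.
  have mgx x : measurable_fun [set: MR] (fun y => g (x, y)).
    exact: measurableT_comp.
  rewrite integral_N01; last 2 first.
  - exact: (@measurable_fun_fubini_tonelli_F _ _ _ _ _ N01 g mg g0).
  - by move=> x; exact: integral_ge0.
  apply: eq_integral => x _; rewrite integral_N01//.
  rewrite -ge0_integralZr//; last 2 first.
  - by apply: emeasurable_funM.
  - by move=> y _; rewrite mule_ge0.
  by apply: eq_integral => y _; rewrite -muleA -EFinM [phi y * _]mulrC.
rewrite [LHS](dbl g1 mg1 (fun z => h0 _)) [RHS](dbl h mh h0).
(* The integrand in mixed coordinates: the old first coordinate [z.1] and the new first coordinate
   [z.2]. Each side of the identity is one affine substitution in a single variable away from it,
   and Tonelli swaps the two orders of integration. *)
pose g2 (z : MR * MR) := (h (z.2, ((z.1 - r * z.2) / s)%R) *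
  ((phi z.1 * phi ((z.2 - r * z.1) / s) / s)%:E))%E.
have mpc (a b : R) : measurable_fun [set: MR * MR]
    (fun z : MR * MR => phi (a * z.1 + b * z.2)).
  by apply: measurableT_comp => //; exact: measurable_normal_pdf.
have mg2 : measurable_fun [set: MR * MR] g2.
  apply: emeasurable_funM.
    apply: (measurableT_comp mh).
    rewrite [X in measurable_fun _ X](_ : _ =
      (fun z : MR * MR => (0 * z.1 + 1 * z.2, s^-1 * z.1 + (- r / s) * z.2))).
      exact: mlinp.
    by apply/funext => z; congr pair; rewrite ?mul0r ?add0r ?mul1r//; ring.
  apply/measurable_EFinP; apply: measurable_funM => //; apply: measurable_funM.
    rewrite [X in measurable_fun _ X](_ : _ =
      (fun z : MR * MR => phi (1 * z.1 + 0 * z.2))); first exact: mpc.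
    by apply/funext => z; rewrite mul0r addr0 mul1r.
  rewrite [X in measurable_fun _ X](_ : _ =
    (fun z : MR * MR => phi ((- r / s) * z.1 + s^-1 * z.2))); first exact: mpc.
  by apply/funext => z; congr phi; ring.
have g20 z : (0 <= g2 z)%E.
  by rewrite mule_ge0// lee_fin mulr_ge0 ?invr_ge0 1?ltW// mulr_gt0 ?normal_pdf01_gt0.
have mg2x x : measurable_fun [set: MR] (fun y => g2 (x, y)).
  exact: measurableT_comp.
have mg2y y : measurable_fun [set: MR] (fun x => g2 (x, y)).
  exact: measurableT_comp.
have maff (a b : R) : measurable_fun [set: MR] (fun y : MR => a * y + b).
  by apply: measurable_funD => //; exact: measurable_funM.
have sN0 : s != 0 by rewrite gt_eqF.
have id1 (u v : R) : (u - r * (r * u + s * v)) / s = s * u - r * v.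
  apply: (mulIf sN0); rewrite divfK//.
  have -> : u - r * (r * u + s * v) = u * (1 - r ^+ 2) - r * s * v by ring.
  by rewrite -rs; ring.
have id2 (u v : R) : (r * u + s * v - r * u) / s = v by field.
have id3 (u v : R) : s * (phi u * phi v / s) = phi u * phi v by field.
have id5 (u v : R) : phi (r * u + s * v) * phi (s * u - r * v) = phi u * phi v.
  rewrite !normal_pdf01E ![_^-1 * expR _ * _]mulrACA -!expRD; congr (_ * expR _).
  rewrite -!opprD -!mulrDl; congr (- (_ / 2)).
  have -> : (r * u + s * v) ^+ 2 + (s * u - r * v) ^+ 2 =
    (r ^+ 2 + s ^+ 2) * (u ^+ 2 + v ^+ 2) by ring.
  by rewrite rs mul1r.
transitivity (\int[leb]_x \int[leb]_y g2 (x, y))%E.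
  apply: eq_integral => x _.
  rewrite [RHS](@ge0_integral_affine s (r * x))//.
  rewrite -ge0_integralZl//; last 2 first.
  - exact: (measurableT_comp (mg2x x) (maff s (r * x))).
  - by rewrite lee_fin ltW.
  apply: eq_integral => y _; rewrite /g2/= muleCA -EFinM.
  by rewrite [in RHS](addrC (s * y)) id1 id2 id3.
transitivity (\int[leb]_y \int[leb]_x g2 (x, y))%E.
  exact: (@fubini_tonelli _ _ _ _ _ leb leb g2 mg2 g20).
apply: eq_integral => u _ /=.
rewrite (@ge0_integral_affine s (r * u))//.
rewrite -ge0_integralZl//; last 2 first.
- exact: (measurableT_comp (mg2y u) (maff s (r * u))).
- by rewrite lee_fin ltW.
apply: eq_integral => v _; rewrite /g2/= muleCA -EFinM.
have -> : (s * v + r * u - r * u) / s = v by field; rewrite gt_eqF.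
by rewrite addrC id1 id3 id5.
Qed.

End standard_normal.

Lemma measurable_bool_set d (T : measurableType d) (b : T -> bool) :
  measurable_fun [set: T] b -> measurable [set x | b x].
Proof.
move=> mb; have := mb measurableT [set true]; rewrite setTI.
have -> : b @^-1` [set true] = [set x | b x] by apply/seteqP; split.
exact.
Qed.

Section iterated_integrals.
Local Open Scope ereal_scope.
Context d1 d2 (T1 : measurableType d1) (T2 : measurableType d2) (R : realType).
Variables (P1 : probability T1 R) (P2 : probability T2 R).
Variable f : T1 * T2 -> \bar R.
Hypothesis mf : measurable_fun [set: T1 * T2] f.
Hypothesis f0 : forall z, 0 <= f z.

Lemma measurable_integral_snd :
  measurable_fun [set: T1] (fun x => \int[P2]_y f (x, y)).
Proof. exact: (@measurable_fun_fubini_tonelli_F _ _ _ _ _ P2 f mf f0). Qed.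

Lemma exchange_integral :
  \int[P1]_x \int[P2]_y f (x, y) = \int[P2]_y \int[P1]_x f (x, y).
Proof. exact: (@fubini_tonelli _ _ _ _ _ P1 P2 f mf f0). Qed.

End iterated_integrals.

Section gaussian_vectors.
Context {R : realType}.
Local Notation MR := (measurableTypeR R).
Local Notation N01 := (normal_prob (0 : R) 1).
Local Notation phi := (normal_pdf (0 : R) 1).
Local Notation gauss n := (@gaussian R n).

Definition lcomb n (a b : R) (x y : n.-tuple MR) : n.-tuple MR :=
  [tuple a * tnth x i + b * tnth y i | i < n].

Definition dot n (x y : n.-tuple MR) : R := \sum_(i < n) tnth x i * tnth y i.

Definition sqdist n (x y : n.-tuple MR) : R :=
  \sum_(i < n) (tnth x i - tnth y i) ^+ 2.

Definition tcons n (a : MR) (x : n.-tuple MR) : n.+1.-tuple MR :=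
  [tuple of a :: x].

Lemma tnth_lcomb n a b (x y : n.-tuple MR) i :
  tnth (lcomb a b x y) i = a * tnth x i + b * tnth y i.
Proof. by rewrite tnth_mktuple. Qed.

Lemma lcomb_tcons n a b u v (x y : n.-tuple MR) :
  lcomb a b (tcons u x) (tcons v y) = tcons (a * u + b * v) (lcomb a b x y).
Proof.
apply: eq_from_tnth => i; rewrite tnth_lcomb.
by case: (unliftP ord0 i) => [j|] ->; rewrite ?tnth0// !tnthS tnth_lcomb.
Qed.

Lemma dot_tcons n u v (x y : n.-tuple MR) :
  dot (tcons u x) (tcons v y) = u * v + dot x y.
Proof.
rewrite /dot big_ord_recl !tnth0; congr (_ + _).
by apply: eq_bigr => i _; rewrite !tnthS.
Qed.

Lemma sqdist_tcons n u v (x y : n.-tuple MR) :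
  sqdist (tcons u x) (tcons v y) = (u - v) ^+ 2 + sqdist x y.
Proof.
rewrite /sqdist big_ord_recl !tnth0; congr (_ + _).
by apply: eq_bigr => i _; rewrite !tnthS.
Qed.

Lemma tcons_eta n (x : n.+1.-tuple MR) : exists a y, x = tcons a y.
Proof. by case/tupleP: x => a y; exists a, y; exact: val_inj. Qed.

Lemma measurable_tcons d (T : measurableType d) n (f : T -> MR)
    (g : T -> n.-tuple MR) :
  measurable_fun [set: T] f -> measurable_fun [set: T] g ->
  measurable_fun [set: T] (fun x => tcons (f x) (g x)).
Proof. exact: measurable_cons. Qed.

Lemma measurable_lcomb d (T : measurableType d) n (a b : R)
    (f g : T -> n.-tuple MR) :
  measurable_fun [set: T] f -> measurable_fun [set: T] g ->
  measurable_fun [set: T] (fun x => lcomb a b (f x) (g x)).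
Proof.
move=> mf mg; apply/measurable_fun_tnthP => i.
rewrite (_ : _ \o _ = fun x => a * tnth (f x) i + b * tnth (g x) i); last first.
  by apply/funext => x /=; rewrite tnth_lcomb.
have mt (h : T -> n.-tuple MR) : measurable_fun [set: T] h ->
    measurable_fun [set: T] (fun x => tnth (h x) i : MR).
  by move=> /measurable_fun_tnthP/(_ i).
by apply: measurable_funD; apply: measurable_funM => //; exact: mt.
Qed.

Lemma integral_gaussianS n (f : n.+1.-tuple MR -> \bar R) :
  measurable_fun [set: n.+1.-tuple MR] f -> (forall x, 0 <= f x)%E ->
  (\int[gauss n.+1]_x f x = \int[N01]_a \int[gauss n]_x f (tcons a x))%E.
Proof.
move=> mf f0; rewrite /= ge0_integral_distribution//.
pose k (p : MR * n.-tuple MR) := f (pair_cons p).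
transitivity (\int[(N01 \x gauss n)%E]_p k p)%E; first by [].
rewrite fubini_tonelli1//.
- by apply: (measurableT_comp mf); exact: measurable_pair_cons.
- by move=> p; exact: f0.
Qed.

Lemma integral_gaussianSS n (h : n.+1.-tuple MR * n.+1.-tuple MR -> \bar R) :
  measurable_fun [set: n.+1.-tuple MR * n.+1.-tuple MR] h ->
  (forall x, 0 <= h x)%E ->
  (\int[gauss n.+1]_x \int[gauss n.+1]_y h (x, y) =
   \int[N01]_a \int[N01]_b \int[gauss n]_x \int[gauss n]_y
     h (tcons a x, tcons b y))%E.
Proof.
move=> mh h0.
rewrite integral_gaussianS; last 2 first.
- exact: measurable_integral_snd.
- by move=> x; exact: integral_ge0.
apply: eq_integral => a _.
pose k (p : n.-tuple MR * MR) := (\int[gauss n]_y h (tcons a p.1, tcons p.2 y))%E.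
have mk : measurable_fun [set: n.-tuple MR * MR] k.
  apply: (@measurable_integral_snd _ _ _ _ _ (gauss n)
    (fun q : (n.-tuple MR * MR) * n.-tuple MR =>
       h (tcons a q.1.1, tcons q.1.2 q.2))) => //.
  apply: (measurableT_comp mh); apply/measurable_fun_pairP; split => /=.
    apply: measurable_tcons => //.
    exact: (measurableT_comp measurable_fst measurable_fst).
  apply: measurable_tcons => //.
  exact: (measurableT_comp measurable_snd measurable_fst).
have k0 p : (0 <= k p)%E by apply: integral_ge0.
transitivity (\int[gauss n]_x \int[N01]_b k (x, b))%E; last first.
  exact: exchange_integral.
apply: eq_integral => x _.
by rewrite integral_gaussianS//; exact: measurableT_comp.
Qed.

(** The reflection acts on each pair of coordinates of equal index separately, hence induction on
    [n] with the planar case on the first pair. Being an involution, it serves both for the law of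
    [lcomb r s x y] and for exchanging that vector with [x]. *)
Lemma gaussian_reflection n (h : n.-tuple MR * n.-tuple MR -> \bar R) (r s : R) :
  measurable_fun [set: n.-tuple MR * n.-tuple MR] h -> (forall z, 0 <= h z)%E ->
  0 < s -> r ^+ 2 + s ^+ 2 = 1 ->
  (\int[gauss n]_x \int[gauss n]_y h (lcomb r s x y, lcomb s (- r) x y) =
   \int[gauss n]_x \int[gauss n]_y h (x, y))%E.
Proof.
move=> mh h0 s0 rs; elim: n h mh h0 => [|n IH] h mh h0.
  apply: eq_integral => x _; apply: eq_integral => y _.
  by congr (h (_, _)); apply: eq_from_tnth => -[].
have mlc : measurable_fun [set: n.+1.-tuple MR * n.+1.-tuple MR]
    (fun z => (lcomb r s z.1 z.2, lcomb s (- r) z.1 z.2)).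
  by apply/measurable_fun_pairP; split; apply: measurable_lcomb.
rewrite (@integral_gaussianSS _
  (fun z => h (lcomb r s z.1 z.2, lcomb s (- r) z.1 z.2)))//; last first.
  exact: (measurableT_comp mh mlc).
rewrite [RHS](@integral_gaussianSS _ h mh h0).
pose q (u : MR) (v : MR) (p : n.-tuple MR * n.-tuple MR) :=
  h (tcons u p.1, tcons v p.2).
have mq u v : measurable_fun [set: n.-tuple MR * n.-tuple MR] (q u v).
  apply: (measurableT_comp mh); apply/measurable_fun_pairP; split => /=;
    exact: measurable_tcons.
pose k (p : MR * MR) := (\int[gauss n]_x \int[gauss n]_y q p.1 p.2 (x, y))%E.
have mk : measurable_fun [set: MR * MR] k.
  pose k1 (z : (MR * MR) * n.-tuple MR) :=
    (\int[gauss n]_y q z.1.1 z.1.2 (z.2, y))%E.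
  apply: (@measurable_integral_snd _ _ _ _ _ (gauss n) k1); last first.
    by move=> z; apply: integral_ge0 => y _; exact: h0.
  pose k2 (z : ((MR * MR) * n.-tuple MR) * n.-tuple MR) :=
    q z.1.1.1 z.1.1.2 (z.1.2, z.2).
  apply: (@measurable_integral_snd _ _ _ _ _ (gauss n) k2); last first.
    by move=> z; exact: h0.
  apply: (measurableT_comp mh); apply/measurable_fun_pairP; split => /=;
    apply: measurable_tcons => //.
  - by do 2 apply: (measurableT_comp measurable_fst).
  - by apply: (measurableT_comp measurable_snd).
  - apply: (measurableT_comp measurable_snd).
    exact: (measurableT_comp measurable_fst).
have k0 p : (0 <= k p)%E by do 2 apply: integral_ge0 => ? _; exact: h0.
transitivity (\int[N01]_a \int[N01]_b k (r * a + s * b, s * a - r * b)%R)%E;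
  last exact: (N01_reflection mk k0 s0 rs).
apply: eq_integral => a _; apply: eq_integral => b _.
transitivity (\int[gauss n]_x \int[gauss n]_y
    q (r * a + s * b)%R (s * a - r * b)%R (lcomb r s x y, lcomb s (- r) x y))%E;
  last exact: (IH _ (mq _ _) (fun z => h0 _)).
apply: eq_integral => x _; apply: eq_integral => y _.
by rewrite /q /= !lcomb_tcons mulNr.
Qed.

Lemma N01_translation (h : MR -> \bar R) (v : R) :
  measurable_fun [set: MR] h -> (forall z, 0 <= h z)%E ->
  (\int[N01]_x h (x + v)%R =
   \int[N01]_x (h x * (expR (v * x - v ^+ 2 / 2))%:E))%E.
Proof.
move=> mh h0.
have ms : measurable_fun [set: MR] (fun x : MR => x + v).
  by apply: measurable_funD.
have mphi : measurable_fun [set: MR] (fun x => (phi x)%:E).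
  by apply/measurable_EFinP; exact: measurable_normal_pdf.
have me : measurable_fun [set: MR] (fun x : MR => (expR (v * x - v ^+ 2 / 2))%:E).
  apply/measurable_EFinP; apply: measurableT_comp => //.
  by apply: measurable_funB => //; exact: measurable_funM.
rewrite integral_N01//; last exact: measurableT_comp.
rewrite integral_N01//; last 2 first.
- exact: emeasurable_funM.
- by move=> x; rewrite mule_ge0// lee_fin expR_ge0.
rewrite [RHS](@ge0_integral_affine _ 1 v)//; last 2 first.
- by apply: emeasurable_funM => //; exact: emeasurable_funM.
- by move=> x; rewrite !mule_ge0// lee_fin ?expR_ge0// normal_pdf_ge0.
rewrite mul1e; apply: eq_integral => x _.
rewrite mul1r -muleA -EFinM; congr (_ * _%:E)%E.
rewrite !normal_pdf01E mulrCA -expRD; congr (_ * expR _).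
by field.
Qed.

(** Cameron-Martin formula, obtained coordinate by coordinate. It turns an exponential tilt of the
    disorder into a shift, which is how the planted model arises. *)
Lemma gaussian_translation n (v : n.-tuple MR) (h : n.-tuple MR -> \bar R) :
  measurable_fun [set: n.-tuple MR] h -> (forall z, 0 <= h z)%E ->
  (\int[gauss n]_x h (lcomb 1 1 x v) =
   \int[gauss n]_x (h x * (expR (dot v x - dot v v / 2))%:E))%E.
Proof.
elim: n v h => [|n IH] v h mh h0.
  apply: eq_integral => x _.
  rewrite /dot !big_ord0 mul0r subr0 expR0 mule1.
  by congr (h _); apply: eq_from_tnth => -[].
have [a [w ->]] := tcons_eta v.
have mh' u : measurable_fun [set: n.-tuple MR] (fun x => h (tcons u x)).
  by apply: (measurableT_comp mh); exact: measurable_tcons.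
have mdot m (u : m.-tuple MR) : measurable_fun [set: m.-tuple MR]
    (fun x => (expR (dot u x - dot u u / 2))%:E).
  apply/measurable_EFinP; apply: measurableT_comp => //.
  apply: measurable_funB => //; rewrite /dot; apply: measurable_sum => i.
  by apply: measurable_funM => //; exact: measurable_tnth.
rewrite integral_gaussianS//; last first.
  apply: (measurableT_comp mh); exact: measurable_lcomb.
rewrite [RHS]integral_gaussianS; last 2 first.
- by apply: emeasurable_funM => //; exact: mdot.
- by move=> x; rewrite mule_ge0// lee_fin expR_ge0.
pose k (u : MR) := (\int[gauss n]_x (h (tcons u x) *
  (expR (dot w x - dot w w / 2))%:E))%E.
have mk : measurable_fun [set: MR] k.
  apply: (@measurable_integral_snd _ _ _ _ _ (gauss n) (fun z : MR * n.-tuple MR =>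
    h (tcons z.1 z.2) * (expR (dot w z.2 - dot w w / 2))%:E)%E) => //.
  - apply: emeasurable_funM.
      by apply: (measurableT_comp mh); exact: measurable_tcons.
    exact: (measurableT_comp (mdot n w)).
  - by move=> z; rewrite mule_ge0// lee_fin expR_ge0.
have k0 u : (0 <= k u)%E.
  by apply: integral_ge0 => x _; rewrite mule_ge0// lee_fin expR_ge0.
transitivity (\int[N01]_u k (u + a)%R)%E.
  apply: eq_integral => u _; rewrite /k -IH//.
  by apply: eq_integral => x _; rewrite lcomb_tcons !mul1r.
rewrite [LHS](N01_translation a mk k0); apply: eq_integral => u _.
rewrite /k -ge0_integralZr//; last 2 first.
- by apply: emeasurable_funM => //; exact: mdot.
- by move=> x _; rewrite mule_ge0// lee_fin expR_ge0.
apply: eq_integral => x _; rewrite -muleA -EFinM -expRD; congr (_ * (expR _)%:E)%E.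
by rewrite !dot_tcons; field.
Qed.

End gaussian_vectors.

(** * The Prekopa-Leindler inequality for the Gaussian measure *)

Section prekopa_leindler.
Context {R : realType}.
Local Notation MR := (measurableTypeR R).
Local Notation leb := (@lebesgue_measure R).
Local Notation N01 := (normal_prob (0 : R) 1).
Local Notation phi := (normal_pdf (0 : R) 1).
Local Notation gauss n := (@gaussian R n).

Let subgraph (k : MR -> R) : set (MR * MR) :=
  [set z | (0 < z.2) && (z.2 < 1) && (z.2 < k z.1)].

Let level (k : MR -> R) (u : MR) : \bar R :=
  (\int[leb]_x (\1_(subgraph k) (x, u))%:E)%E.

Let measurable_subgraph (k : MR -> R) : measurable_fun [set: MR] k ->
  measurable (subgraph k).
Proof.
move=> mk.
have m2 : measurable_fun [set: MR * MR] (fun z : MR * MR => z.2 : R).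
  exact: measurable_snd.
have mb : measurable_fun [set: MR * MR]
    (fun z : MR * MR => (0 < z.2) && (z.2 < 1) && (z.2 < k z.1)).
  apply: measurable_and; first apply: measurable_and.
  - exact: measurable_fun_ltr.
  - exact: measurable_fun_ltr.
  - apply: measurable_fun_ltr => //.
    exact: (measurableT_comp mk measurable_fst).
exact: measurable_bool_set mb.
Qed.

Let measurable_level (k : MR -> R) : measurable_fun [set: MR] k ->
  measurable_fun [set: MR] (level k).
Proof.
move=> mk.
apply: (@measurable_fun_fubini_tonelli_G _ _ _ _ _ leb
  (fun z => (\1_(subgraph k) z)%:E)) => //.
by apply/measurable_EFinP; apply: measurable_indic; exact: measurable_subgraph.
Qed.

Let level_ge0 k u : (0 <= level k u)%E.
Proof. by apply: integral_ge0 => x _; rewrite lee_fin. Qed.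

Let levelE (k : MR -> R) u : measurable_fun [set: MR] k -> 0 < u < 1 ->
  level k u = leb [set x | u < k x].
Proof.
move=> mk u01.
have mA : measurable [set x | u < k x].
  by apply: measurable_bool_set; exact: measurable_fun_ltr.
rewrite -[X in _ = leb X]setIT -integral_indic//; apply: eq_integral => x _.
rewrite !indicE; congr ((nat_of_bool _)%:R%:E).
by apply/idP/idP; rewrite !inE /subgraph /= u01.
Qed.

Let level_eq0 (k : MR -> R) u : ~~ (0 < u < 1) -> level k u = 0%E.
Proof.
move=> u01; apply: integral0_eq => x _.
rewrite indicE memNset// /subgraph /=.
by move/andP => [h]; move: u01; rewrite h.
Qed.

Let integral_level (k : MR -> R) : measurable_fun [set: MR] k ->
  (forall x, 0 <= k x) ->
  (\int[leb]_u level k u = \int[leb]_x (Num.min (k x) 1)%:E)%E.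
Proof.
move=> mk k0; transitivity (\int[leb]_x \int[leb]_u (\1_(subgraph k) (x, u))%:E)%E.
  symmetry; apply: (@fubini_tonelli _ _ _ _ _ leb leb
    (fun z => (\1_(subgraph k) z)%:E)) => //.
  by apply/measurable_EFinP; apply: measurable_indic; exact: measurable_subgraph.
apply: eq_integral => x _.
transitivity (\int[leb]_u (\1_[set` `]0, (Num.min (k x) 1)%R[%R] u)%:E)%E.
  apply: eq_integral => u _; rewrite !indicE; congr ((nat_of_bool _)%:R%:E).
  apply/idP/idP; rewrite !inE /subgraph /= in_itv /= lt_min.
    by move=> /andP[/andP[-> ->] ->].
  by move=> /and3P[-> -> ->].
have E : leb [set` `]0, (Num.min (k x) 1)%R[%R] = (Num.min (k x) 1)%:E.
  rewrite lebesgue_measure_itv/= lte_fin.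
  have [m0|m0] := ltP 0 (Num.min (k x) 1); first by rewrite oppr0 adde0.
  by congr EFin; apply/eqP; rewrite eq_le m0 le_min k0 ler01.
by rewrite integral_indic// setIT; exact: E.
Qed.

Let le_hull (A : set MR) : measurable A -> has_sup A -> has_inf A ->
  (leb A <= (sup A - inf A)%:E)%E.
Proof.
move=> mA sA iA.
have AS : A `<=` [set` `[inf A, sup A]%R].
  move=> x Ax; rewrite /= in_itv/=; apply/andP; split.
    by apply: ge_inf => //; case: iA.
  by apply: ub_le_sup => //; case: sA.
apply: (@le_trans _ _ (leb [set` `[inf A, sup A]%R])).
  by apply: le_measure => //; rewrite inE.
rewrite lebesgue_measure_itv/= lte_fin; case: ifPn => // .
rewrite -leNgt lee_fin subr_ge0 => _.
by case: sA => [[x Ax] _]; have /= := AS _ Ax; rewrite in_itv/= => /andP[/le_trans]; apply.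
Qed.

(* The superlevel sets of a centred Gaussian are symmetric intervals, so the
   one-dimensional Brunn-Minkowski inequality reduces to adding up diameters. *)
Let PL_levels (F G : MR -> R) (C : R) :
  measurable_fun [set: MR] F -> measurable_fun [set: MR] G ->
  (forall x, 0 <= F x) -> (forall x, 0 <= G x) ->
  (forall x, F x <= 1) -> (forall x, G x <= 1) ->
  (forall u, u < 1 -> exists x, u < F x) ->
  (forall u, u < 1 -> exists x, u < G x) -> 0 < C ->
  (forall x y, F x * G y <= (C * expR (- (((x + y) / 2) ^+ 2 / 2))) ^+ 2) ->
  (\int[leb]_x (F x)%:E + \int[leb]_x (G x)%:E <=
   2%:E * \int[leb]_x (C * expR (- (x ^+ 2 / 2)))%:E)%E.
Proof.
move=> mF mG F0 G0 F1 G1 sF sG C0 FG.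
pose H (x : MR) : R := C * expR (- (x ^+ 2 / 2)).
have H0 x : 0 <= H x by rewrite mulr_ge0 ?expR_ge0// ltW.
have mH : measurable_fun [set: MR] H.
  apply: measurable_funM => //; apply: measurableT_comp => //.
  by apply: measurableT_comp => //; apply: measurable_funM.
have minE (k : MR -> R) : (forall x, k x <= 1) -> forall x, Num.min (k x) 1 = k x.
  by move=> k1 x; apply/min_idPl.
have -> : (\int[leb]_x (F x)%:E = \int[leb]_u level F u)%E.
  by rewrite integral_level//; apply: eq_integral => x _; rewrite minE.
have -> : (\int[leb]_x (G x)%:E = \int[leb]_u level G u)%E.
  by rewrite integral_level//; apply: eq_integral => x _; rewrite minE.
rewrite -ge0_integralD//; [|exact: measurable_level|exact: measurable_level].
apply: (@le_trans _ _ (2%:E * \int[leb]_u level H u)%E); last first.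
  apply: lee_wpmul2l => //; rewrite integral_level//.
  apply: ge0_le_integral => //.
  - by move=> x _; rewrite lee_fin le_min H0 ler01.
  - by apply/measurable_EFinP; exact: measurable_minr.
  - by apply/measurable_EFinP.
  - by move=> x _; rewrite lee_fin ge_min lexx.
rewrite -ge0_integralZl//; last exact: measurable_level.
apply: ge0_le_integral => //.
- by move=> x _; rewrite adde_ge0.
- by apply: emeasurable_funD; exact: measurable_level.
- by apply: measurable_funeM; exact: measurable_level.
move=> u _.
have [u01|u01] := boolP (0 < u < 1); last by rewrite !level_eq0// mule0 adde0.
rewrite !levelE//.
have [u0 u1] := andP u01.
have [x0 Fx0] := sF _ u1; have [y0 Gy0] := sG _ u1.
have Hu x y : u < F x -> u < G y -> u < H ((x + y) / 2).
  move=> ux uy; rewrite -(@ltr_pXn2r _ 2)// ?nnegrE ?(ltW u0)//.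
  apply: (@lt_le_trans _ _ (F x * G y)); last exact: FG.
  by rewrite expr2 ltr_pM// ltW.
have CuE z : (u < H z) = (z ^+ 2 < 2 * ln (C / u)).
  rewrite /H -ltr_pdivrMl// -(@ltr_ln _ (C^-1 * u)) ?posrE ?expR_gt0//; last first.
    by rewrite mulr_gt0// invr_gt0.
  rewrite expRK -[C^-1 * u]invrK invfM invrK lnV ?posrE ?divr_gt0//.
  by rewrite ltrN2 ltr_pdivrMr// [_ * 2]mulrC.
set r := Num.sqrt (2 * ln (C / u)).
have r2 : 0 < 2 * ln (C / u).
  by apply: (le_lt_trans (sqr_ge0 ((x0 + y0) / 2))); rewrite -CuE Hu.
have r0 : 0 < r by rewrite sqrtr_gt0.
have CuE' z : (u < H z) = (`|z| < r).
  by rewrite CuE -sqrtr_sqr ltr_sqrt.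
have -> : [set x | u < H x] = [set` `]- r, r[%R].
  by apply/seteqP; split => x /=; rewrite CuE' in_itv/= ltr_norml.
have bnd x y : u < F x -> u < G y -> - (2 * r) <= x + y <= 2 * r.
  move=> ux uy; have := Hu x y ux uy.
  by rewrite CuE' normrM [`|_^-1|]ger0_norm// ltr_pdivrMr// => /ltW; rewrite ler_norml mulrC.
have mset (k : MR -> R) : measurable_fun [set: MR] k -> measurable [set x | u < k x].
  by move=> mk; apply: measurable_bool_set; exact: measurable_fun_ltr.
set A := [set x | u < F x]; set B := [set x | u < G x].
have sA : has_sup A.
  split; first by exists x0.
  exists (2 * r - y0) => x Ax; have /andP[_] := bnd x y0 Ax Gy0.
  by rewrite lerBrDr.
have iA : has_inf A.
  split; first by exists x0.
  exists (- (2 * r) - y0) => x Ax; have /andP[+ _] := bnd x y0 Ax Gy0.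
  by rewrite lerBlDr.
have sB : has_sup B.
  split; first by exists y0.
  exists (2 * r - x0) => y By; have /andP[_] := bnd x0 y Fx0 By.
  by rewrite lerBrDl.
have iB : has_inf B.
  split; first by exists y0.
  exists (- (2 * r) - x0) => y By; have /andP[+ _] := bnd x0 y Fx0 By.
  by rewrite lerBlDl.
have sAB : sup A + sup B <= 2 * r.
  rewrite -lerBrDl; apply: ge_sup; first by case: sB.
  move=> y By; rewrite lerBrDl -lerBrDr; apply: ge_sup; first by case: sA.
  by move=> x Ax; rewrite lerBrDr; have /andP[_] := bnd x y Ax By.
have iAB : - (2 * r) <= inf A + inf B.
  rewrite -lerBlDl; apply: lb_le_inf; first by case: iB.
  move=> y By; rewrite lerBlDl -lerBlDr; apply: lb_le_inf; first by case: iA.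
  by move=> x Ax; rewrite lerBlDr; have /andP[] := bnd x y Ax By.
apply: (@le_trans _ _ ((sup A - inf A)%:E + (sup B - inf B)%:E)%E).
  by apply: leeD; apply: le_hull => //; exact: mset.
rewrite lebesgue_measure_itv/= lte_fin gtrN// -!EFinD -EFinM lee_fin.
lra.
Qed.

Lemma N01_prekopa_leindler (f g : MR -> \bar R) :
  measurable_fun [set: MR] f -> measurable_fun [set: MR] g ->
  (forall x, 0 <= f x)%E -> (forall x, 0 <= g x)%E ->
  (forall x y, f x * g y <= (expR ((x - y) ^+ 2 / 4))%:E)%E ->
  (\int[N01]_x f x * \int[N01]_x g x <= 1)%E.
Proof.
move=> mf mg f0 g0 fg.
have [fz|/existsNP[x0 /eqP fx0]] := pselect (forall x, f x = 0%E).
  by rewrite integral0_eq ?mul0e.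
have [gz|/existsNP[y0 /eqP gy0]] := pselect (forall x, g x = 0%E).
  by rewrite [X in (_ * X)%E]integral0_eq ?mule0.
have fx0_gt0 : (0 < f x0)%E by rewrite lt0e fx0 f0.
have gy0_gt0 : (0 < g y0)%E by rewrite lt0e gy0 g0.
have ffin x : f x \is a fin_num.
  rewrite ge0_fin_numE// ltNge leye_eq; apply/eqP => fE.
  by have := fg x y0; rewrite fE gt0_mulye.
have gfin x : g x \is a fin_num.
  rewrite ge0_fin_numE// ltNge leye_eq; apply/eqP => gE.
  by have := fg x0 x; rewrite gE gt0_muley.
pose F (x : MR) : R := fine (f x) * phi x.
pose G (x : MR) : R := fine (g x) * phi x.
have mF : measurable_fun [set: MR] F.
  apply: measurable_funM; last exact: measurable_normal_pdf.
  exact: measurableT_comp.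
have mG : measurable_fun [set: MR] G.
  apply: measurable_funM; last exact: measurable_normal_pdf.
  exact: measurableT_comp.
have F0 x : 0 <= F x by rewrite mulr_ge0 ?fine_ge0 ?normal_pdf_ge0.
have G0 x : 0 <= G x by rewrite mulr_ge0 ?fine_ge0 ?normal_pdf_ge0.
have Fx0 : 0 < F x0.
  by rewrite mulr_gt0 ?normal_pdf01_gt0// fine_gt0// fx0_gt0 -ge0_fin_numE ?ffin.
have Gy0 : 0 < G y0.
  by rewrite mulr_gt0 ?normal_pdf01_gt0// fine_gt0// gy0_gt0 -ge0_fin_numE ?gfin.
(* The exponent 1/4 is exact: x^2/2 + y^2/2 - (x - y)^2/4 = ((x + y)/2)^2. *)
have FG x y : F x * G y <= phi ((x + y) / 2) ^+ 2.
  have : fine (f x) * fine (g y) <= expR ((x - y) ^+ 2 / 4).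
    by rewrite -lee_fin EFinM !fineK.
  move=> h; rewrite /F /G mulrACA.
  apply: (le_trans (ler_wpM2r _ h)); first by rewrite mulr_ge0 ?normal_pdf_ge0.
  rewrite !normal_pdf01E [leRHS]exprMn; set p := (Num.sqrt _)^-1; set e := expR _.
  set e1 := expR _; set e2 := expR _.
  have -> : e * (p * e1 * (p * e2)) = p ^+ 2 * (e * (e1 * e2)) by ring.
  rewrite ler_wpM2l ?sqr_ge0// -!expRD -expRM_natl.
  by rewrite ler_expR le_eqVlt; apply/orP; left; apply/eqP; field.
have ubF : has_sup (range F).
  split; first by exists (F x0), x0.
  exists (phi 0 ^+ 2 / G y0) => _ [x _ <-]; rewrite ler_pdivlMr//.
  apply: (le_trans (FG x y0)); rewrite lerXn2r ?nnegrE ?normal_pdf_ge0//.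
  rewrite !normal_pdf01E ler_wpM2l ?invr_ge0// ler_expR.
  by rewrite expr0n mul0r oppr0 oppr_le0 mulr_ge0 ?sqr_ge0.
have ubG : has_sup (range G).
  split; first by exists (G y0), y0.
  exists (phi 0 ^+ 2 / F x0) => _ [y _ <-]; rewrite ler_pdivlMr// mulrC.
  apply: (le_trans (FG x0 y)); rewrite lerXn2r ?nnegrE ?normal_pdf_ge0//.
  rewrite !normal_pdf01E ler_wpM2l ?invr_ge0// ler_expR.
  by rewrite expr0n mul0r oppr0 oppr_le0 mulr_ge0 ?sqr_ge0.
(* Dividing by the suprema makes both functions have supremum 1, so that at every level below 1 both
   superlevel sets are nonempty, as adding up diameters requires. The geometric mean [c] rescales
   the Gaussian majorant accordingly. *)
set a := sup (range F); set b := sup (range G).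
have Fa x : F x <= a by apply: ub_le_sup; [case: ubF|exists x].
have Gb x : G x <= b by apply: ub_le_sup; [case: ubG|exists x].
have a0 : 0 < a by exact: lt_le_trans (Fa x0).
have b0 : 0 < b by exact: lt_le_trans (Gb y0).
set c := Num.sqrt (a * b).
have c0 : 0 < c by rewrite sqrtr_gt0 mulr_gt0.
have c2 : c ^+ 2 = a * b by rewrite sqr_sqrtr// ltW// mulr_gt0.
have phiE x : (Num.sqrt (2 * pi))^-1 / c * expR (- (x ^+ 2 / 2)) = phi x / c.
  by rewrite normal_pdf01E mulrAC.
have := @PL_levels (fun x => F x / a) (fun x => G x / b)
  ((Num.sqrt (2 * pi))^-1 / c).
have -> : (\int[leb]_x ((Num.sqrt (2 * pi))^-1 / c * expR (- (x ^+ 2 / 2)))%:E =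
    (c^-1)%:E)%E.
  under eq_integral do rewrite phiE mulrC EFinM.
  rewrite ge0_integralZl//; last 3 first.
  - by apply/measurable_EFinP; exact: measurable_normal_pdf.
  - by move=> x _; rewrite lee_fin normal_pdf_ge0.
  - by rewrite lee_fin invr_ge0 ltW.
  by rewrite integral_normal_pdf mule1.
have intN (k : MR -> \bar R) (K : MR -> R) (e : R) : 0 < e ->
    measurable_fun [set: MR] k -> (forall x, 0 <= k x)%E ->
    (forall x, k x \is a fin_num) -> measurable_fun [set: MR] K ->
    (forall x, 0 <= K x) -> (forall x, K x = fine (k x) * phi x) ->
    (\int[leb]_x (K x / e)%:E = e^-1%:E * \int[N01]_x k x)%E.
  move=> e0 mk k0 kfin mK K0 KE; rewrite integral_N01// -ge0_integralZl//.
  - by apply: eq_integral => x _; rewrite KE mulrC EFinM EFinM fineK.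
  - apply: emeasurable_funM => //; apply/measurable_EFinP.
    exact: measurable_normal_pdf.
  - by move=> x _; rewrite mule_ge0// lee_fin normal_pdf_ge0.
  - by rewrite lee_fin invr_ge0 ltW.
rewrite (intN f F a)// (intN g G b)//.
have [Mf Mg] : (0 <= \int[N01]_x f x)%E /\ (0 <= \int[N01]_x g x)%E.
  by split; exact: integral_ge0.
move=> PL; have {PL} : (a^-1%:E * \int[N01]_x f x + b^-1%:E * \int[N01]_x g x
    <= 2%:E * c^-1%:E)%E.
  apply: PL.
  - exact: measurable_funM.
  - exact: measurable_funM.
  - by move=> x; rewrite divr_ge0// ltW.
  - by move=> x; rewrite divr_ge0// ltW.
  - by move=> x; rewrite ler_pdivrMr// mul1r.
  - by move=> x; rewrite ler_pdivrMr// mul1r.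
  - move=> u u1; have : 0 < (1 - u) * a by rewrite mulr_gt0// subr_gt0.
    move=> /(sup_adherent)/(_ ubF)[_ [x _ <-]]; rewrite -/a => h.
    by exists x; rewrite ltr_pdivlMr//; lra.
  - move=> u u1; have : 0 < (1 - u) * b by rewrite mulr_gt0// subr_gt0.
    move=> /(sup_adherent)/(_ ubG)[_ [x _ <-]]; rewrite -/b => h.
    by exists x; rewrite ltr_pdivlMr//; lra.
  - by rewrite divr_gt0// invr_gt0 sqrtr_gt0 mulr_gt0// pi_gt0.
  - move=> x y; rewrite phiE exprMn exprVn c2 mulrACA -invfM.
    by rewrite ler_wpM2r// invr_ge0 mulr_ge0// ltW.
move: Mf Mg; case: (\int[N01]_x f x)%E => [p| |]//; last first.
  move=> _ Ig0; rewrite -EFinM gt0_muley ?lte_fin ?invr_gt0//.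
  have : (0 <= b^-1%:E * \int[N01]_x g x)%E.
    by rewrite mule_ge0// lee_fin invr_ge0 ltW.
  by case: (b^-1%:E * _)%E => // [?|]; rewrite ?addye// leye_eq.
case: (\int[N01]_x g x)%E => [q| |]//; last first.
  move=> _ _; rewrite -!EFinM gt0_muley ?lte_fin ?invr_gt0// addey//.
rewrite -!EFinM -EFinD !lee_fin => p0 q0 h.
(* Arithmetic-geometric mean inequality: a normalised sum of at most 2 / c has a product of at most
   c^-2. *)
have h1 : (a^-1 * p) * (b^-1 * q) <= c^-1 ^+ 2.
  have A0 : 0 <= a^-1 * p by rewrite mulr_ge0// invr_ge0 ltW.
  have B0 : 0 <= b^-1 * q by rewrite mulr_ge0// invr_ge0 ltW.
  have : (a^-1 * p + b^-1 * q) ^+ 2 <= (2 * c^-1) ^+ 2.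
    by rewrite lerXn2r ?nnegrE ?addr_ge0// mulr_ge0// invr_ge0 ltW.
  have := sqr_ge0 (a^-1 * p - b^-1 * q); nra.
move: h1; rewrite exprVn c2 mulrACA -invfM -ler_pdivlMl ?invr_gt0 ?mulr_gt0//.
by rewrite invrK divff// gt_eqF// mulr_gt0.
Qed.

(** Tensorisation: for fixed first coordinates [u] and [v], the induction hypothesis for the two
    sections, the second one multiplied by exp(-(u - v)^2/4), says exactly that the partial
    integrals satisfy the one-dimensional hypothesis. *)
Lemma gaussian_prekopa_leindler n (f g : n.-tuple MR -> \bar R) :
  measurable_fun [set: n.-tuple MR] f -> measurable_fun [set: n.-tuple MR] g ->
  (forall x, 0 <= f x)%E -> (forall x, 0 <= g x)%E ->
  (forall x y, f x * g y <= (expR (sqdist x y / 4))%:E)%E ->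
  (\int[gauss n]_x f x * \int[gauss n]_x g x <= 1)%E.
Proof.
elim: n f g => [|n IH] f g mf mg f0 g0 fg.
  rewrite /= !integral_dirac// !diracT !mul1e.
  by apply: (le_trans (fg _ _)); rewrite /sqdist big_ord0 mul0r expR0.
have mc (k : n.+1.-tuple MR -> \bar R) u : measurable_fun [set: n.+1.-tuple MR] k ->
    measurable_fun [set: n.-tuple MR] (fun x => k (tcons u x)).
  by move=> mk; apply: (measurableT_comp mk); exact: measurable_tcons.
have mi (k : n.+1.-tuple MR -> \bar R) : measurable_fun [set: n.+1.-tuple MR] k ->
    (forall x, 0 <= k x)%E ->
    measurable_fun [set: MR] (fun u => \int[gauss n]_x k (tcons u x))%E.
  move=> mk k0; apply: (@measurable_integral_snd _ _ _ _ _ (gauss n)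
    (fun z : MR * n.-tuple MR => k (tcons z.1 z.2))) => //.
  by apply: (measurableT_comp mk); exact: measurable_tcons.
rewrite !integral_gaussianS//; apply: N01_prekopa_leindler.
- exact: mi.
- exact: mi.
- by move=> u; exact: integral_ge0.
- by move=> u; exact: integral_ge0.
move=> u v.
set e := (u - v) ^+ 2 / 4.
have eE : (expR e)%:E = ((expR (- e))^-1)%:E by rewrite expRN invrK.
rewrite eE -[leRHS]mule1 -lee_pdivrMl ?invr_gt0 ?expR_gt0// invrK muleCA.
rewrite -ge0_integralZl//; last by exact: mc.
apply: (IH (fun x => f (tcons u x)) (fun x => (expR (- e))%:E * g (tcons v x))%E).
- exact: mc.
- by apply: measurable_funeM; exact: mc.
- by [].
- by move=> x; rewrite mule_ge0.
move=> x y; rewrite muleCA.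
apply: (@le_trans _ _ ((expR (- e))%:E * (expR (sqdist (tcons u x) (tcons v y) / 4))%:E)%E).
  by apply: lee_wpmul2l => //; rewrite lee_fin expR_ge0.
by rewrite -EFinM -expRD sqdist_tcons lee_fin ler_expR /e; lra.
Qed.

End prekopa_leindler.

(** * Concentration of Lipschitz functions *)

Section lipschitz.
Context {R : realType}.
Local Notation MR := (measurableTypeR R).

Definition lipfun n (L : R) (F : n.-tuple MR -> R) :=
  forall x y, `|F x - F y| <= L * l2dist x y.

Lemma l2distE n (x y : n.-tuple MR) : l2dist x y = Num.sqrt (sqdist x y).
Proof. by []. Qed.

Lemma sqdist_ge0 n (x y : n.-tuple MR) : 0 <= sqdist x y.
Proof. by apply: sumr_ge0 => i _; rewrite sqr_ge0. Qed.

Lemma l2dist_ge0 n (x y : n.-tuple MR) : 0 <= l2dist x y.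
Proof. exact: sqrtr_ge0. Qed.

Lemma sqdistC n (x y : n.-tuple MR) : sqdist x y = sqdist y x.
Proof. by apply: eq_bigr => i _; rewrite -sqrrN opprB. Qed.

Lemma l2distC n (x y : n.-tuple MR) : l2dist x y = l2dist y x.
Proof. by rewrite !l2distE sqdistC. Qed.

Lemma dist_rat_dense n (x : n.-tuple MR) (e : R) : 0 < e ->
  exists q : n.-tuple rat, l2dist x [tuple ratr (tnth q i) | i < n] < e.
Proof.
move=> e0; pose d := e / (n.+1%:R).
have d0 : 0 < d by rewrite divr_gt0// ltr0n.
have H i : exists q : rat, `|tnth x i - ratr q| < d.
  have : tnth x i - d < tnth x i + d by lra.
  move=> /rat_in_itvoo[q]; rewrite in_itv/= => /andP[h1 h2]; exists q.
  by rewrite ltr_distl; apply/andP; split; rewrite ?ltrBlDr//; lra.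
have [q Hq] := choice H.
exists [tuple q i | i < n]; rewrite l2distE.
apply: (@le_lt_trans _ _ (Num.sqrt (n%:R * d ^+ 2))).
  rewrite ler_sqrt; last by apply: mulr_ge0 => //; exact: sqr_ge0.
  rewrite mulr_natl -[X in _ *+ X]card_ord -sumr_const; apply: ler_sum => i _.
  rewrite !tnth_mktuple -real_normK ?num_real//.
  have := Hq i; have := normr_ge0 (tnth x i - ratr (q i)); nra.
rewrite -[ltRHS](gtr0_norm e0) -sqrtr_sqr ltr_sqrt ?exprn_gt0//.
rewrite /d exprMn exprVn mulrCA gtr_pMr ?exprn_gt0//.
rewrite ltr_pdivrMr ?exprn_gt0 ?ltr0n// mul1r -natrX ltr_nat.
by rewrite expnS expn1 (leq_trans (ltnSn n))// leq_pmulr.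
Qed.

Lemma measurable_l2dist n (y : n.-tuple MR) :
  measurable_fun [set: n.-tuple MR] (fun x => l2dist x y).
Proof.
apply: (measurableT_comp (continuous_measurable_fun (@sqrt_continuous R))).
apply: measurable_sum => i; apply: measurable_funX.
by apply: measurable_funB => //; exact: measurable_tnth.
Qed.

(** For the product sigma-algebra on tuples: [F] is the infimum over rational points q of the cones
    F q + L |x - q|, so an open lower level set is a countable union of measurable sets. The
    measurability of a Lipschitz algorithm comes from here. *)
Lemma lipfun_measurable n L (F : n.-tuple MR -> R) : 0 < L -> lipfun L F ->
  measurable_fun [set: n.-tuple MR] F.
Proof.
move=> L0 FL _; apply: (measurability _ (RGenInftyO.measurableE R)) => //.
move=> _ [_ [r ->] <-]; rewrite setTI.
pose Q (q : n.-tuple rat) : n.-tuple MR := [tuple ratr (tnth q i) | i < n].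
rewrite (_ : _ @^-1` _ = \bigcup_q [set x | F (Q q) + L * l2dist x (Q q) < r]); last first.
  apply/seteqP; split => x /=; rewrite in_itv/=.
    move=> Fr; have : 0 < (r - F x) / (2 * L) by rewrite divr_gt0 ?subr_gt0// mulr_gt0.
    move=> /(dist_rat_dense x)[q]; rewrite -/(Q q) => h; exists q => //=.
    have := FL (Q q) x; rewrite ler_norml => /andP[_].
    move: h; rewrite ltr_pdivlMr ?mulr_gt0// [l2dist (Q q) x]l2distC; nra.
  move=> [q _ /=]; have := FL x (Q q); rewrite ler_norml => /andP[_]; lra.
apply: countable_bigcupT_measurable; first exact: countableP.
move=> q; apply: measurable_bool_set; apply: measurable_fun_ltr => //.
apply: measurable_funD => //; apply: measurable_funM => //.
exact: measurable_l2dist.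
Qed.

End lipschitz.

Section positive_integral.
Context d (T : measurableType d) (R : realType) (P : probability T R).

Lemma prob_integral_gt0 (f : T -> \bar R) : measurable_fun [set: T] f ->
  (forall x, 0 < f x)%E -> (0 < \int[P]_x f x)%E.
Proof.
move=> mf f0; rewrite lt0e; apply/andP; split; last first.
  by apply: integral_ge0 => x _; exact/ltW.
apply/eqP => I0.
have : (\int[P]_x `|f x| = 0)%E.
  by rewrite -I0; apply: eq_integral => x _; rewrite gee0_abs// ltW.
move/(ae_eq_integral_abs P measurableT mf) => [N [mN N0 sN]].
have : [set: T] `<=` N.
  by move=> x _; apply: sN => /= /(_ Logic.I) fx; have := f0 x; rewrite fx ltxx.
move=> TN; have : P [set: T] = 0%E.
  by apply/eqP; rewrite eq_le measure_ge0 andbT -N0; apply: le_measure; rewrite ?inE.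
by rewrite probability_setT => /eqP; rewrite onee_eq0.
Qed.

Definition intg (f : T -> R) := P.-integrable [set: T] (EFin \o f).

Lemma intg_measurable (f : T -> R) : intg f -> measurable_fun [set: T] f.
Proof. by move=> /measurable_int/measurable_EFinP. Qed.

Lemma intg_dominated (f g : T -> R) : measurable_fun [set: T] f ->
  intg g -> (forall x, `|f x| <= g x) -> intg f.
Proof.
move=> mf ig fg; apply: (le_integrable measurableT _ _ ig).
  exact/measurable_EFinP.
by move=> x _ /=; rewrite lee_fin (le_trans (fg x))// ler_norm.
Qed.

Lemma intg_cst (M : R) : intg (fun=> M).
Proof. exact: finite_measure_integrable_cst. Qed.

Lemma intg_bounded (f : T -> R) (M : R) : measurable_fun [set: T] f ->
  (forall x, `|f x| <= M) -> intg f.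
Proof. by move=> mf fM; apply: (@intg_dominated _ (fun=> M)) => //; exact: intg_cst. Qed.

Lemma intgD (f g : T -> R) : intg f -> intg g -> intg (fun x => f x + g x).
Proof. by move=> fi gi; exact: (integrableD measurableT fi gi). Qed.

Lemma intgB (f g : T -> R) : intg f -> intg g -> intg (fun x => f x - g x).
Proof. by move=> fi gi; exact: (integrableB measurableT fi gi). Qed.

Lemma intgZ (k : R) (f : T -> R) : intg f -> intg (fun x => k * f x).
Proof. by move=> fi; exact: (integrableZl measurableT k fi). Qed.

Lemma intg_sum (I : Type) (s : seq I) (D : pred I) (f : I -> T -> R) :
  (forall i, D i -> intg (f i)) -> intg (fun x => \sum_(i <- s | D i) f i x).
Proof.
move=> fi; rewrite /intg (_ : _ \o _ =
  (fun x => \sum_(i <- s | D i) (f i x)%:E)%E); first exact: integrable_sum.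
by apply/funext => x; rewrite /= sumEFin.
Qed.

Lemma intg_ge0 (f : T -> R) : measurable_fun [set: T] f ->
  (forall x, 0 <= f x) -> (\int[P]_x (f x)%:E < +oo)%E -> intg f.
Proof.
move=> mf f0 fy; apply/integrableP; split; first exact/measurable_EFinP.
apply: le_lt_trans fy; apply: ge0_le_integral => //.
- by apply: measurableT_comp => //; exact/measurable_EFinP.
- exact/measurable_EFinP.
- by move=> x _ /=; rewrite lee_fin ger0_norm.
Qed.

Lemma EFin_Rintegral (f : T -> R) : intg f ->
  (\int[P]_x f x)%:E = (\int[P]_x (f x)%:E)%E.
Proof. by move=> fi; rewrite /Rintegral fineK//; exact: integrable_fin_num. Qed.

Lemma Rintegral_prob_cst (M : R) : \int[P]_x M = M.
Proof. by rewrite /Rintegral integral_cst//= probability_setT mule1. Qed.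

Lemma RintD (f g : T -> R) : intg f -> intg g ->
  \int[P]_x (f x + g x) = \int[P]_x f x + \int[P]_x g x.
Proof. exact: RintegralD. Qed.

Lemma RintB (f g : T -> R) : intg f -> intg g ->
  \int[P]_x (f x - g x) = \int[P]_x f x - \int[P]_x g x.
Proof. exact: RintegralB. Qed.

Lemma RintZ (k : R) (f : T -> R) : intg f ->
  \int[P]_x (k * f x) = k * \int[P]_x f x.
Proof. exact: RintegralZl. Qed.

Lemma Rint_le (f g : T -> R) : intg f -> intg g -> (forall x, f x <= g x) ->
  \int[P]_x f x <= \int[P]_x g x.
Proof. by move=> fi gi fg; apply: le_Rintegral. Qed.

Lemma Rint_dist (f g : T -> R) (C : R) : intg f -> intg g ->
  (forall x, `|f x - g x| <= C) ->
  `|\int[P]_x f x - \int[P]_x g x| <= C.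
Proof.
move=> fi gi fg; rewrite -(RintB fi gi) ler_norml; apply/andP; split.
  rewrite -[leLHS]Rintegral_prob_cst; apply: (Rint_le (intg_cst _) (intgB fi gi)).
  by move=> x; have := fg x; rewrite ler_norml => /andP[].
rewrite -[leRHS]Rintegral_prob_cst; apply: (Rint_le (intgB fi gi) (intg_cst _)).
by move=> x; have := fg x; rewrite ler_norml => /andP[].
Qed.

Lemma Rint_sum (I : Type) (s : seq I) (D : pred I) (f : I -> T -> R) :
  (forall i, intg (f i)) ->
  \int[P]_x (\sum_(i <- s | D i) f i x) = \sum_(i <- s | D i) \int[P]_x f i x.
Proof.
move=> fi; apply: EFin_inj; rewrite -sumEFin EFin_Rintegral; last exact: intg_sum.
under eq_integral do rewrite -sumEFin.
by rewrite integral_sum//; apply: eq_bigr => i _; rewrite EFin_Rintegral.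
Qed.

Lemma prob_markov (f : T -> R) (A : set T) : measurable A ->
  measurable_fun [set: T] f -> (forall x, 0 <= f x) ->
  (forall x, A x -> 1 <= f x) -> (P A <= \int[P]_x (f x)%:E)%E.
Proof.
move=> mA mf f0 fA.
rewrite -(setIT A) -integral_indic//; apply: ge0_le_integral => //.
- by apply/measurable_EFinP; exact: measurable_indic.
- exact/measurable_EFinP.
move=> x _; rewrite lee_fin indicE; have [Ax|nAx] := boolP (x \in A).
  by apply: fA; exact: set_mem.
exact: f0.
Qed.

End positive_integral.

Section concentration.
Context {R : realType}.
Local Notation MR := (measurableTypeR R).
Local Notation gauss n := (@gaussian R n).

Lemma expR_sqr_le (t : R) : t ^+ 2 <= 4 * (expR t + expR (- t)).
Proof.
have H (u : R) : 0 <= u -> u ^+ 2 <= 4 * expR u.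
  move=> u0; have h := expR_ge1Dx (u / 2).
  have -> : expR u = expR (u / 2) ^+ 2 by rewrite -expRM_natl; congr expR; field.
  have : (u / 2) ^+ 2 <= expR (u / 2) ^+ 2.
    by rewrite lerXn2r ?nnegrE ?expR_ge0 ?divr_ge0//; lra.
  by rewrite exprMn exprVn ler_pdivrMr//; lra.
have := expR_gt0 t; have := expR_gt0 (- t).
have [t0|t0] := leP 0 t; first by have := H t t0; lra.
by have := H (- t); rewrite oppr_ge0 (ltW t0) sqrrN => /(_ isT); lra.
Qed.

Lemma ler_norm_expR (t : R) : `|t| <= expR t + expR (- t).
Proof.
rewrite ler_norml; apply/andP; split.
  by have := expR_ge1Dx (- t); have := expR_gt0 t; lra.
by have := expR_ge1Dx t; have := expR_gt0 (- t); lra.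
Qed.

Variables (n : nat) (L : R) (F : n.-tuple MR -> R).
Hypothesis L0 : 0 < L.
Hypothesis FL : lipfun L F.

Let mF : measurable_fun [set: n.-tuple MR] F := lipfun_measurable L0 FL.

Let mE (l : R) : measurable_fun [set: n.-tuple MR] (fun x => expR (l * F x)).
Proof. by apply: measurableT_comp => //; exact: measurable_funM. Qed.

(** With d the distance of [x] and [y], |l| L d <= d^2/4 + l^2 L^2, so exp(l F - l^2 L^2) and exp(-l
    F) satisfy the hypothesis of Prekopa-Leindler. Integrability is a consequence: the other factor
    is positive and the product is finite. *)
Lemma lip_expR_pair (l : R) :
  (\int[gauss n]_x (expR (l * F x))%:E * \int[gauss n]_x (expR (- l * F x))%:E
   <= (expR (l ^+ 2 * L ^+ 2))%:E)%E.
Proof.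
have := @gaussian_prekopa_leindler R n
  (fun x => ((expR (- (l ^+ 2 * L ^+ 2)))%:E * (expR (l * F x))%:E)%E)
  (fun x => (expR (- l * F x))%:E).
rewrite ge0_integralZl//; last first.
  by apply/measurable_EFinP; exact: mE.
move=> PL; rewrite -[leRHS]mule1 -lee_pdivrMl ?expR_gt0// -expRN muleA.
apply: PL.
- by apply: measurable_funeM; apply/measurable_EFinP; exact: mE.
- by apply/measurable_EFinP; exact: mE.
- by move=> x; rewrite mule_ge0// lee_fin ?invr_ge0 expR_ge0.
- by move=> x; rewrite lee_fin expR_ge0.
move=> x y; rewrite -!EFinM lee_fin -!expRD ler_expR.
have : `|l * (F x - F y)| <= `|l| * (L * l2dist x y).
  by rewrite normrM ler_wpM2l.
rewrite l2distE => h.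
have s2 : sqdist x y = Num.sqrt (sqdist x y) ^+ 2 by rewrite sqr_sqrtr ?sqdist_ge0.
rewrite s2; set d := Num.sqrt _ in h *.
have := ler_norm (l * (F x - F y)).
have := sqr_ge0 (d / 2 - `|l| * L).
have -> : (d / 2 - `|l| * L) ^+ 2 = d ^+ 2 / 4 - `|l| * (L * d) + `|l| ^+ 2 * L ^+ 2.
  by field.
rewrite real_normK ?num_real//; lra.
Qed.

Lemma lip_expR_lty (l : R) : (\int[gauss n]_x (expR (l * F x))%:E < +oo)%E.
Proof.
rewrite ltNge leye_eq; apply/eqP => E; have := lip_expR_pair l; rewrite E.
rewrite gt0_mulye//; apply: prob_integral_gt0; last first.
  by move=> x; rewrite lte_fin expR_gt0.
by apply/measurable_EFinP; exact: mE.
Qed.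

Lemma lip_intg_expR (l : R) : intg (gauss n) (fun x => expR (l * F x)).
Proof.
apply: intg_ge0; [exact: mE|by move=> x; exact: expR_ge0|exact: lip_expR_lty].
Qed.

Lemma lip_intg : intg (gauss n) F.
Proof.
apply: (@intg_dominated _ _ _ _ _ (fun x => expR (1 * F x) + expR (- 1 * F x))) => //.
  by apply: intgD; exact: lip_intg_expR.
by move=> x; rewrite mulN1r mul1r ler_norm_expR.
Qed.

Let m := \int[gauss n]_x F x.

(** Jensen bounds the factor with [- l] from below by exp(-l m); dividing the bound on the pair by
    it leaves a sub-Gaussian bound, with l^2 L^2 in place of the sharp l^2 L^2 / 2. *)
Lemma lip_mgf (l : R) :
  \int[gauss n]_x expR (l * F x) <= expR (l * m + l ^+ 2 * L ^+ 2).
Proof.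
have J : expR (- l * m) <= \int[gauss n]_x expR (- l * F x).
  pose g x := expR (- l * m) * (1 + - l * (F x - m)).
  have ig1 : intg (gauss n) (fun x => - l * (F x - m)).
    by apply: intgZ; apply: intgB; [exact: lip_intg|exact: intg_cst].
  have ig2 : intg (gauss n) (fun x => 1 + - l * (F x - m)).
    by apply: intgD => //; exact: intg_cst.
  have -> : expR (- l * m) = \int[gauss n]_x g x.
    rewrite /g RintZ// RintD//; last exact: intg_cst.
    rewrite RintZ; last by apply: intgB; [exact: lip_intg|exact: intg_cst].
    rewrite RintB; [|exact: lip_intg|exact: intg_cst].
    by rewrite !Rintegral_prob_cst -/m subrr mulr0 addr0 mulr1.
  apply: Rint_le; [exact: intgZ|exact: lip_intg_expR|].
  move=> x; rewrite /g; apply: (@le_trans _ _ (expR (- l * m) * expR (- l * (F x - m)))).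
    by rewrite ler_wpM2l ?expR_ge0// expR_ge1Dx.
  by rewrite -expRD -mulrDr addrC subrK.
have := lip_expR_pair l.
rewrite -!EFin_Rintegral; [|exact: lip_intg_expR|exact: lip_intg_expR].
rewrite -EFinM lee_fin => h.
have e0 := expR_gt0 (- l * m).
rewrite expRD -ler_pdivrMl ?expR_gt0// -expRN -mulNr.
apply: le_trans h; rewrite mulrC ler_wpM2l//.
by apply: Rintegral_ge0 => x _; exact: expR_ge0.
Qed.

Lemma lip_tail (r : R) : 0 < r ->
  (gauss n [set x | (m + r <= F x)%R] <= (expR (- (r ^+ 2 / (4 * L ^+ 2))))%:E)%E.
Proof.
(* The minimiser of -l r + l^2 L^2. *)
move=> r0; pose l := r / (2 * L ^+ 2).
have L2 : 0 < L ^+ 2 by rewrite exprn_gt0.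
have l0 : 0 < l by rewrite divr_gt0// mulr_gt0.
pose c := expR (- l * (m + r)).
apply: (@le_trans _ _ (\int[gauss n]_x (c * expR (l * F x))%:E)%E).
  apply: prob_markov.
  - by apply: measurable_bool_set; exact: measurable_fun_ler.
  - by apply: measurable_funM.
  - by move=> x; rewrite mulr_ge0 ?expR_ge0.
  - move=> x /= h; rewrite -expRD -expR0 ler_expR mulNr addrC subr_ge0.
    by rewrite ler_pM2l.
have ic : intg (gauss n) (fun x => c * expR (l * F x)).
  by apply: intgZ; exact: lip_intg_expR.
rewrite -EFin_Rintegral// lee_fin RintZ; last exact: lip_intg_expR.
apply: (le_trans (ler_wpM2l (expR_ge0 _) (lip_mgf l))).
rewrite -expRD ler_expR le_eqVlt; apply/orP; left; apply/eqP.
by rewrite /l; field; rewrite gt_eqF.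
Qed.

(** A Poincare inequality up to the constant: [expR_sqr_le] at t = (F - m) / L, and the exponential
    moments at l = 1 / L and l = -1 / L are each at most e after centring. Only the order L^2
    matters. *)
Lemma lip_variance :
  intg (gauss n) (fun x => F x ^+ 2) /\
  \int[gauss n]_x (F x ^+ 2) - m ^+ 2 <= 8 * expR 1 * L ^+ 2.
Proof.
have ie l : intg (gauss n) (fun x => expR (l * (F x - m))).
  rewrite (_ : (fun x => _) = fun x => expR (- l * m) * expR (l * F x)).
    by apply: intgZ; exact: lip_intg_expR.
  by apply/funext => x; rewrite -expRD; congr expR; ring.
pose g x := 4 * L ^+ 2 * (expR (L^-1 * (F x - m)) + expR (- L^-1 * (F x - m))).
have LN0 : L != 0 by rewrite gt_eqF.
have ig : intg (gauss n) g by apply: intgZ; apply: intgD.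
have Lg x : (F x - m) ^+ 2 <= g x.
  have := expR_sqr_le (L^-1 * (F x - m)).
  rewrite exprMn exprVn ler_pdivrMl ?exprn_gt0// => /le_trans; apply.
  by rewrite /g mulNr mulrA [L ^+ 2 * 4]mulrC.
have mf : measurable_fun [set: n.-tuple MR] (fun x => F x - m).
  exact: measurable_funB.
have i2 : intg (gauss n) (fun x => (F x - m) ^+ 2).
  apply: (intg_dominated _ ig); first exact: measurable_funX.
  by move=> x; rewrite ger0_norm ?sqr_ge0.
have i1 := lip_intg.
have E : (fun x => F x ^+ 2) = (fun x => (F x - m) ^+ 2 + (2 * m * F x - m ^+ 2)).
  by apply/funext => x; ring.
have iF : intg (gauss n) (fun x => F x ^+ 2).
  by rewrite E; apply: intgD => //; apply: intgB; [exact: intgZ|exact: intg_cst].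
split => //; rewrite E RintD//; last by apply: intgB; [exact: intgZ|exact: intg_cst].
rewrite RintB; [|exact: intgZ|exact: intg_cst].
rewrite RintZ// Rintegral_prob_cst -/m.
have -> : forall a : R, a + (2 * m * m - m ^+ 2) - m ^+ 2 = a by move=> a; ring.
apply: (le_trans (Rint_le i2 ig Lg)).
rewrite /g RintZ; last exact: intgD.
rewrite RintD//.
have H l : l ^+ 2 = L ^- 2 -> \int[gauss n]_x expR (l * (F x - m)) <= expR 1.
  move=> l2; rewrite (_ : (fun x => _) = fun x => expR (- l * m) * expR (l * F x)); last first.
    by apply/funext => x; rewrite -expRD; congr expR; ring.
  rewrite RintZ; last exact: lip_intg_expR.
  apply: (le_trans (ler_wpM2l (expR_ge0 _) (lip_mgf l))).
  by rewrite -expRD l2 mulVf ?expf_neq0// mulNr addrA addNr add0r.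
have := H (L^-1); rewrite exprVn => /(_ erefl) h1.
have := H (- L^-1); rewrite sqrrN exprVn => /(_ erefl) h2.
have h4 : 0 <= 4 * L ^+ 2 by rewrite mulr_ge0// sqr_ge0.
apply: (le_trans (ler_wpM2l h4 (lerD h1 h2))).
by rewrite le_eqVlt; apply/orP; left; apply/eqP; ring.
Qed.

End concentration.

(** * Scalar products and iterated Gaussian integrals *)

Section euclidean_vectors.
Context {R : realType}.
Local Notation MR := (measurableTypeR R).
Implicit Types n : nat.

Lemma dotC n (x y : n.-tuple MR) : dot x y = dot y x.
Proof. by apply: eq_bigr => i _; rewrite mulrC. Qed.

Lemma dot_lcombr n (v x y : n.-tuple MR) a b :
  dot v (lcomb a b x y) = a * dot v x + b * dot v y.
Proof.
rewrite /dot !mulr_sumr -big_split; apply: eq_bigr => i _ /=.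
by rewrite tnth_lcomb; ring.
Qed.

Lemma dot_ge0 n (x : n.-tuple MR) : 0 <= dot x x.
Proof. by apply: sumr_ge0 => i _; rewrite -expr2 sqr_ge0. Qed.

Lemma sqdistE n (x y : n.-tuple MR) :
  sqdist x y = dot x x - 2 * dot x y + dot y y.
Proof.
rewrite /dot mulr_sumr -sumrB -big_split; apply: eq_bigr => i _ /=; ring.
Qed.

Lemma dot_sqr_le n (x y : n.-tuple MR) : dot x y ^+ 2 <= dot x x * dot y y.
Proof.
have H (a b : R) : 0 <= a ^+ 2 * dot x x + 2 * a * b * dot x y + b ^+ 2 * dot y y.
  rewrite (_ : _ + _ = dot (lcomb a b x y) (lcomb a b x y)) ?dot_ge0//.
  by rewrite dot_lcombr ![dot (lcomb _ _ _ _) _]dotC !dot_lcombr (dotC y x); ring.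
have y0 := dot_ge0 y; have x0 := dot_ge0 x.
have [yz|yN0] := eqVneq (dot y y) 0.
  have := H (dot x y) (- (dot x x + 1)); rewrite yz mulr0 addr0.
  rewrite mulr0; nra.
have yp : 0 < dot y y by rewrite lt_neqAle eq_sym yN0.
have := H (dot y y) (- dot x y).
have -> : dot y y ^+ 2 * dot x x + 2 * dot y y * - dot x y * dot x y +
  (- dot x y) ^+ 2 * dot y y = dot y y * (dot x x * dot y y - dot x y ^+ 2) by ring.
by rewrite pmulr_rge0// subr_ge0.
Qed.

Lemma normr_dot_le n (x y : n.-tuple MR) :
  `|dot x y| <= Num.sqrt (dot x x) * Num.sqrt (dot y y).
Proof.
by rewrite -sqrtrM ?dot_ge0// -sqrtr_sqr ler_sqrt ?mulr_ge0 ?dot_ge0// dot_sqr_le.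
Qed.

Lemma l2dist_lcombr n a b (x y z : n.-tuple MR) :
  l2dist (lcomb a b x y) (lcomb a b x z) = `|b| * l2dist y z.
Proof.
rewrite !l2distE -sqrtr_sqr -sqrtrM ?sqr_ge0//; congr Num.sqrt.
rewrite /sqdist mulr_sumr; apply: eq_bigr => i _; rewrite !tnth_lcomb; ring.
Qed.

Lemma l2dist_lcombl n a b (x y z : n.-tuple MR) :
  l2dist (lcomb a b x z) (lcomb a b y z) = `|a| * l2dist x y.
Proof.
rewrite !l2distE -sqrtr_sqr -sqrtrM ?sqr_ge0//; congr Num.sqrt.
rewrite /sqdist mulr_sumr; apply: eq_bigr => i _; rewrite !tnth_lcomb; ring.
Qed.

Lemma lcomb_reflectionK n r s (x y : n.-tuple MR) : r ^+ 2 + s ^+ 2 = 1 ->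
  lcomb r s (lcomb r s x y) (lcomb s (- r) x y) = x.
Proof.
move=> rs; apply: eq_from_tnth => i; rewrite !tnth_lcomb.
by rewrite -[RHS]mul1r -rs; ring.
Qed.

Lemma lipfun_dot n (v : n.-tuple MR) (L : R) : Num.sqrt (dot v v) <= L ->
  lipfun L (dot v).
Proof.
move=> vL x y; have -> : dot v x - dot v y = dot v (lcomb 1 (- 1) x y).
  by rewrite dot_lcombr; ring.
apply: (le_trans (normr_dot_le _ _)).
apply: (le_trans (ler_wpM2r (sqrtr_ge0 _) vL)).
rewrite l2distE le_eqVlt; apply/orP; left; apply/eqP.
congr (_ * Num.sqrt _); rewrite sqdistE.
by rewrite dot_lcombr ![dot (lcomb _ _ _ _) _]dotC !dot_lcombr (dotC y x); ring.
Qed.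

Lemma lipfun_le n (L L' : R) (F : n.-tuple MR -> R) : L <= L' -> lipfun L F ->
  lipfun L' F.
Proof.
by move=> LL FL x y; apply: (le_trans (FL x y)); rewrite ler_wpM2r ?l2dist_ge0.
Qed.

End euclidean_vectors.

Section lipschitz_pairs.
Context {R : realType}.
Local Notation MR := (measurableTypeR R).
Local Notation gauss n := (@gaussian R n).

Definition lipfun2 n m (L : R) (f : n.-tuple MR * m.-tuple MR -> R) :=
  [/\ measurable_fun [set: n.-tuple MR * m.-tuple MR] f,
      forall y, lipfun L (fun x => f (x, y)) & forall x, lipfun L (fun y => f (x, y))].

Lemma lipfun_Rint n m L (f : n.-tuple MR * m.-tuple MR -> R) : 0 < L ->
  lipfun2 L f -> lipfun L (fun x => \int[gauss m]_y f (x, y)).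
Proof.
move=> L0 [mf f1 f2] x x'.
apply: Rint_dist; [exact: (lip_intg L0 (f2 _))..|].
by move=> y; exact: f1.
Qed.

Lemma lipfun2_max0 n m L (f : n.-tuple MR * m.-tuple MR -> R) :
  lipfun2 L f -> lipfun2 L (fun z => Num.max (f z) 0).
Proof.
have H (a b : R) : `|Num.max a 0 - Num.max b 0| <= `|a - b|.
  have [a0|a0] := leP a 0; have [b0|b0] := leP b 0 => //.
  - by rewrite subrr normr0.
  - by rewrite sub0r normrN gtr0_norm// ler0_norm; lra.
  - by rewrite subr0 gtr0_norm// ger0_norm; lra.
move=> [mf f1 f2]; split.
- exact: measurable_maxr.
- by move=> y x x'; apply: (le_trans (H _ _)); exact: f1.
- by move=> y x x'; apply: (le_trans (H _ _)); exact: f2.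
Qed.

Lemma lipfun2N n m L (f : n.-tuple MR * m.-tuple MR -> R) :
  lipfun2 L f -> lipfun2 L (fun z => - f z).
Proof.
move=> [mf f1 f2]; split.
- exact: measurableT_comp.
- by move=> y x x'; rewrite -opprD normrN; exact: f1.
- by move=> y x x'; rewrite -opprD normrN; exact: f2.
Qed.

Lemma lipfun2_swap n m L (f : n.-tuple MR * m.-tuple MR -> R) :
  lipfun2 L f -> lipfun2 L (fun z => f (z.2, z.1)).
Proof.
move=> [mf f1 f2]; split => //.
exact: (measurableT_comp mf (@measurable_swap _ _ _ _)).
Qed.

Lemma lipfun2_ext n m L (f g : n.-tuple MR * m.-tuple MR -> R) :
  f =1 g -> lipfun2 L f -> lipfun2 L g.
Proof. by move=> /funext ->. Qed.

(** Tonelli and the reflection invariance are available for nonnegative extended functions;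
    splitting into positive and negative parts carries them over to real integrals. Both parts stay
    separately Lipschitz, hence integrable. *)
Lemma Rint_iter_split n m L (f : n.-tuple MR * m.-tuple MR -> R) : 0 < L ->
  lipfun2 L f ->
  \int[gauss n]_x \int[gauss m]_y f (x, y) =
  fine (\int[gauss n]_x \int[gauss m]_y (Num.max (f (x, y)) 0)%:E)%E -
  fine (\int[gauss n]_x \int[gauss m]_y (Num.max (- f (x, y)) 0)%:E)%E.
Proof.
move=> L0 fL; have fp := lipfun2_max0 fL; have fm := lipfun2_max0 (lipfun2N fL).
have E g : lipfun2 L g -> fine (\int[gauss n]_x \int[gauss m]_y (g (x, y))%:E)%E =
    \int[gauss n]_x \int[gauss m]_y g (x, y).
  move=> [mg g1 g2]; rewrite /Rintegral; congr fine; apply: eq_integral => x _.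
  by rewrite -EFin_Rintegral//; exact: (lip_intg L0 (g2 x)).
rewrite (E _ fp) (E _ fm).
rewrite -RintB; last 2 first.
- exact: (lip_intg L0 (lipfun_Rint L0 fp)).
- exact: (lip_intg L0 (lipfun_Rint L0 fm)).
apply: eq_Rintegral => x _.
rewrite -RintB; last 2 first.
- by case: fp => _ _ f2; exact: (lip_intg L0 (f2 x)).
- by case: fm => _ _ f2; exact: (lip_intg L0 (f2 x)).
apply: eq_Rintegral => y _.
by have [h|h] := leP (f (x, y)) 0; have [h'|h'] := leP (- f (x, y)) 0; lra.
Qed.

Let mE n m (g : n.-tuple MR * m.-tuple MR -> R) :
  measurable_fun setT g -> measurable_fun setT (fun z => (Num.max (g z) 0)%:E).
Proof. by move=> mg; apply/measurable_EFinP; exact: measurable_maxr. Qed.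

Let max0 (a : R) : (0 <= (Num.max a 0)%:E)%E.
Proof. by rewrite lee_fin le_max lexx orbT. Qed.

Lemma Rint_exchange n m L (f : n.-tuple MR * m.-tuple MR -> R) : 0 < L ->
  lipfun2 L f ->
  \int[gauss n]_x \int[gauss m]_y f (x, y) =
  \int[gauss m]_y \int[gauss n]_x f (x, y).
Proof.
move=> L0 fL; have [mf _ _] := fL; have [mf' _ _] := lipfun2N fL.
rewrite (Rint_iter_split L0 fL) (Rint_iter_split L0 (lipfun2_swap fL)) /=.
exact: (congr2 (fun u v => fine u - fine v)
  (exchange_integral (gauss n) (gauss m) (mE mf) (fun z => max0 _))
  (exchange_integral (gauss n) (gauss m) (mE mf') (fun z => max0 _))).
Qed.

Lemma Rint_reflection n L L' (f : n.-tuple MR * n.-tuple MR -> R) (r s : R) :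
  0 < L -> 0 < L' -> lipfun2 L f ->
  lipfun2 L' (fun z => f (lcomb r s z.1 z.2, lcomb s (- r) z.1 z.2)) ->
  0 < s -> r ^+ 2 + s ^+ 2 = 1 ->
  \int[gauss n]_x \int[gauss n]_y f (lcomb r s x y, lcomb s (- r) x y) =
  \int[gauss n]_x \int[gauss n]_y f (x, y).
Proof.
move=> L0 L0' fL fL' s0 rs; have [mf _ _] := fL; have [mf' _ _] := lipfun2N fL.
rewrite (Rint_iter_split L0 fL) (Rint_iter_split L0' fL') /=.
exact: (congr2 (fun u v => fine u - fine v)
  (gaussian_reflection (mE mf) (fun z => max0 _) s0 rs)
  (gaussian_reflection (mE mf') (fun z => max0 _) s0 rs)).
Qed.

Lemma lipfun2_lcomb n L (F : n.-tuple MR -> R) (a b : R) : 0 < L ->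
  lipfun L F -> lipfun2 ((`|a| + `|b|) * L) (fun z => F (lcomb a b z.1 z.2)).
Proof.
move=> L0 FL; split.
- apply: (measurableT_comp (lipfun_measurable L0 FL)).
  exact: measurable_lcomb.
- move=> y x x' /=; apply: (le_trans (FL _ _)); rewrite l2dist_lcombl.
  by rewrite mulrA (mulrC L) ler_wpM2r ?l2dist_ge0// ler_wpM2r ?lerDl// ltW.
- move=> y x x' /=; apply: (le_trans (FL _ _)); rewrite l2dist_lcombr.
  by rewrite mulrA (mulrC L) ler_wpM2r ?l2dist_ge0// ler_wpM2r ?lerDr// ltW.
Qed.

Lemma lipfun2_const n L (F : n.-tuple MR -> R) : 0 < L ->
  lipfun L F -> lipfun2 L (fun z : n.-tuple MR * n.-tuple MR => F z.1).
Proof.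
move=> L0 FL; split => /=.
- apply: (measurableT_comp (lipfun_measurable L0 FL)) => //.
- by move=> _ x x'; exact: FL.
- by move=> x y y' /=; rewrite subrr normr0 mulr_ge0 ?l2dist_ge0// ltW.
Qed.

Lemma Rint_lcomb n L (F : n.-tuple MR -> R) (r s : R) : 0 < L -> lipfun L F ->
  0 < s -> r ^+ 2 + s ^+ 2 = 1 ->
  \int[gauss n]_x \int[gauss n]_y F (lcomb r s x y) = \int[gauss n]_x F x.
Proof.
move=> L0 FL s0 rs.
have rs0 : 0 < (`|r| + `|s|) * L.
  by rewrite mulr_gt0// ltr_wpDl ?normr_gt0 ?gt_eqF.
rewrite (@Rint_reflection _ _ _ (fun z => F z.1) r s L0 rs0)//.
- by apply: eq_Rintegral => x _; rewrite /= Rintegral_prob_cst.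
- exact: lipfun2_const.
- exact: lipfun2_lcomb.
Qed.

(** The reflection with rows (r, s) and (s, -r) is an involution whose first row sends (x, y) to r x
    + s y, so it exchanges [x] with [lcomb r s x y] while preserving the law of the pair. *)
Lemma Rint_reversible n L1 L2 (f : n.-tuple MR * n.-tuple MR -> R) (r s : R) :
  0 < L1 -> 0 < L2 ->
  lipfun2 L1 (fun z => f (z.1, lcomb r s z.1 z.2)) ->
  lipfun2 L2 (fun z => f (lcomb r s z.1 z.2, z.1)) ->
  0 < s -> r ^+ 2 + s ^+ 2 = 1 ->
  \int[gauss n]_x \int[gauss n]_y f (x, lcomb r s x y) =
  \int[gauss n]_x \int[gauss n]_y f (lcomb r s x y, x).
Proof.
move=> L10 L20 f1 f2 s0 rs.
have H := @Rint_reflection _ L1 L2 (fun z => f (z.1, lcomb r s z.1 z.2)) r s L10 L20 f1.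
apply: (etrans (esym (H _ s0 rs))).
  by apply: lipfun2_ext f2 => z /=; rewrite lcomb_reflectionK.
apply: eq_Rintegral => x _; apply: eq_Rintegral => y _ /=.
by rewrite lcomb_reflectionK.
Qed.

(** The translation formula applied to the constant 1. *)
Lemma intg_expR_dot n (v : n.-tuple MR) :
  intg (gauss n) (fun x => expR (dot v x)) /\
  \int[gauss n]_x expR (dot v x) = expR (dot v v / 2).
Proof.
have mdot : measurable_fun [set: n.-tuple MR] (dot v).
  rewrite /dot; apply: measurable_sum => i.
  by apply: measurable_funM => //; exact: measurable_tnth.
have me : measurable_fun [set: n.-tuple MR] (fun x => expR (dot v x)).
  exact: measurableT_comp.
have E : (\int[gauss n]_x (expR (dot v x))%:E = (expR (dot v v / 2))%:E)%E.
  have := @gaussian_translation R n v (cst 1%E) (measurable_cst _) (fun _ => lee01).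
  rewrite integral_cst//= probability_setT mule1.
  under eq_integral do rewrite mul1e expRD EFinM muleC.
  rewrite ge0_integralZl//; last exact/measurable_EFinP.
  move=> h; rewrite -[LHS]mul1e.
  have <- : ((expR (dot v v / 2))%:E * (expR (- (dot v v / 2)))%:E = 1 :> \bar R)%E.
    by rewrite -EFinM -expRD subrr expR0.
  by rewrite -muleA -h mule1.
have ie : intg (gauss n) (fun x => expR (dot v x)).
  by apply: intg_ge0 => //; rewrite E ltry.
by split => //; rewrite /Rintegral E.
Qed.

(** Rotation invariance with both coefficients h = sqrt(1/2) makes the mean e satisfy e = 2 h e, and
    2 h differs from 1. *)
Lemma Rint_dot n (v : n.-tuple MR) : intg (gauss n) (dot v) /\
  \int[gauss n]_x dot v x = 0.
Proof.
pose L := Num.sqrt (dot v v) + 1.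
have L0 : 0 < L by rewrite ltr_wpDl.
have vL : lipfun L (dot v) by apply: lipfun_dot; rewrite lerDl.
have iv := lip_intg L0 vL; split => //.
have h0 : 0 < Num.sqrt (2^-1 : R) by rewrite sqrtr_gt0 invr_gt0.
have h2 : Num.sqrt (2^-1 : R) ^+ 2 = 2^-1 by rewrite sqr_sqrtr// invr_ge0.
have := Rint_lcomb L0 vL h0 (_ : Num.sqrt (2^-1 : R) ^+ 2 + _ = 1).
rewrite h2 => /(_ ltac:(by field)).
under eq_Rintegral => x _.
  under eq_Rintegral do rewrite dot_lcombr.
  rewrite RintD; [|exact: intg_cst|exact: intgZ].
  rewrite Rintegral_prob_cst RintZ//.
  over.
rewrite RintD; [|exact: intgZ|exact: intg_cst].
rewrite RintZ// Rintegral_prob_cst.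
set e := \int[gauss n]_x dot v x; set h := Num.sqrt _ in h0 h2 *.
have : h < 1 by rewrite -(@ltr_pXn2r _ 2)// ?nnegrE ?ltW// h2 expr1n; lra.
move=> h1 he; have : (2 * h - 1) * e = 0 by lra.
move=> /eqP; rewrite mulf_eq0 => /orP[/eqP h3|/eqP//].
have hE : h = 2^-1 by lra.
by move: h2; rewrite hE; lra.
Qed.

End lipschitz_pairs.

(** * Sudakov-Fernique comparison for log-sum-exp *)

Section log_sum_exp.
Context {R : realType} (S : finType).
Implicit Types (D : pred S) (u v z p : S -> R).

Definition lse D u : R := ln (\sum_(i | D i) expR (u i)).

Lemma sum_expR_gt0 D i0 u : D i0 -> 0 < \sum_(i | D i) expR (u i).
Proof.
by move=> Di; rewrite (bigD1 i0)//= ltr_wpDr ?expR_gt0// sumr_ge0// => i _; exact: expR_ge0.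
Qed.

Lemma lse_le D i0 u v (M : R) : D i0 -> (forall i, D i -> u i <= v i + M) ->
  lse D u <= lse D v + M.
Proof.
move=> Di uv; rewrite /lse -(expRK M) -lnM ?posrE ?expR_gt0 ?(sum_expR_gt0 _ Di)//.
rewrite ler_ln ?posrE ?mulr_gt0 ?expR_gt0 ?(sum_expR_gt0 _ Di)//.
by rewrite mulr_suml; apply: ler_sum => i /uv; rewrite -expRD ler_expR.
Qed.

Lemma lse_ge D i u : D i -> u i <= lse D u.
Proof.
move=> Di; rewrite -[leLHS]expRK ler_ln ?posrE ?expR_gt0 ?(sum_expR_gt0 _ Di)//.
by rewrite (bigD1 i)//= lerDl sumr_ge0// => j _; exact: expR_ge0.
Qed.

Lemma lse_le_max D i0 u (M : R) : D i0 -> (forall i, D i -> u i <= M) ->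
  lse D u <= M + ln #|S|%:R.
Proof.
move=> Di uM; apply: (@le_trans _ _ (lse D (fun=> 0) + M)).
  by apply: (lse_le Di) => i Dj; rewrite add0r; exact: uM.
rewrite addrC lerD2l /lse ler_ln ?posrE ?(sum_expR_gt0 _ Di)//; last first.
  by rewrite ltr0n; apply/card_gt0P; exists i0.
under eq_bigr do rewrite expR0.
by rewrite sumr_const ler_nat max_card.
Qed.

Lemma lse_dist D i0 u v (M : R) : D i0 -> (forall i, D i -> `|u i - v i| <= M) ->
  `|lse D u - lse D v| <= M.
Proof.
move=> Di uv; rewrite ler_norml lerBrDl lerBlDl; apply/andP; split.
  rewrite addrC; apply: (lse_le Di) => i /uv.
  by rewrite distrC => /ler_normlP[_]; rewrite lerBlDl.
by rewrite lerBlDl; apply: (lse_le Di) => i /uv /ler_normlP[_]; rewrite lerBlDl.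
Qed.

(** The Gibbs weights of [u] on [D], extended by 0: an increment of [lse] is the logarithm of an
    exponential average under them. *)
Definition softmax D u i : R :=
  if D i then expR (u i) / \sum_(j | D j) expR (u j) else 0.

Lemma softmax_ge0 D i0 u i : D i0 -> 0 <= softmax D u i.
Proof.
move=> Di; rewrite /softmax; case: ifP => // _.
by rewrite divr_ge0 ?expR_ge0// ltW// (sum_expR_gt0 _ Di).
Qed.

Lemma softmax_sum1 D i0 u : D i0 -> \sum_i softmax D u i = 1.
Proof.
move=> Di; rewrite -big_mkcond /= -mulr_suml divff// gt_eqF//.
exact: (sum_expR_gt0 _ Di).
Qed.

Lemma lse_shift D i0 u z : D i0 ->
  lse D (fun i => u i + z i) = lse D u + ln (\sum_i softmax D u i * expR (z i)).
Proof.
move=> Di; rewrite /lse; have Z0 := sum_expR_gt0 u Di.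
have -> : \sum_i softmax D u i * expR (z i) =
    (\sum_(i | D i) expR (u i + z i)) / \sum_(i | D i) expR (u i).
  rewrite mulr_suml [RHS]big_mkcond; apply: eq_bigr => i _; rewrite /softmax.
  by case: ifP => _; rewrite ?mul0r// expRD mulrAC.
rewrite -lnM ?posrE//; last by rewrite divr_gt0// (sum_expR_gt0 _ Di).
by rewrite mulrC divfK// gt_eqF.
Qed.

End log_sum_exp.

Section log_expansion.
Context {R : realType} (S : finType).
Variable p : S -> R.
Hypothesis p0 : forall i, 0 <= p i.
Hypothesis p1 : \sum_i p i = 1.

Lemma jensen_sqr (w : S -> R) : (\sum_i p i * w i) ^+ 2 <= \sum_i p i * w i ^+ 2.
Proof.
set m := \sum_i p i * w i.
have : 0 <= \sum_i p i * (w i - m) ^+ 2.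
  by apply: sumr_ge0 => i _; rewrite mulr_ge0// sqr_ge0.
have -> : \sum_i p i * (w i - m) ^+ 2 = \sum_i p i * w i ^+ 2 - m ^+ 2.
  rewrite (eq_bigr (fun i => p i * w i ^+ 2 - 2 * m * (p i * w i) + m ^+ 2 * p i)).
    rewrite big_split sumrB/= -!mulr_sumr p1 -/m; ring.
  by move=> i _; ring.
by rewrite subr_ge0.
Qed.

Lemma expR_taylor1 (x : R) : 0 <= expR x - 1 - x <= x ^+ 2 * expR `|x|.
Proof.
apply/andP; split; first by rewrite subr_ge0 lerBrDl expR_ge1Dx.
have h : expR x - 1 <= x * expR x.
  have := expR_ge1Dx (- x); rewrite expRN => /(ler_wpM2r (expR_ge0 x)).
  by rewrite mulVf ?gt_eqF ?expR_gt0// mulrDl mul1r mulNr; lra.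
have [x0|x0] := leP 0 x.
  have := expR_gt0 x; have := expR_ge1Dx x; rewrite ger0_norm//; nra.
have := expR_ge1Dx x; rewrite ltr0_norm//.
have := expR_gt0 x; have : 1 <= expR (- x) by rewrite -expR0 ler_expR; lra.
have : 0 <= x ^+ 2 by exact: sqr_ge0.
move=> x2 e1 e0 e2.
have : (- x) * (1 - expR x) <= (- x) * (- x) by rewrite ler_wpM2l//; lra.
have : x ^+ 2 <= x ^+ 2 * expR (- x) by rewrite ler_peMr.
by rewrite expr2; lra.
Qed.

Lemma ln_sum_upper (z : S -> R) :
  ln (\sum_i p i * expR (z i)) <= \sum_i p i * (expR (z i) - 1).
Proof.
have s0 : 0 <= \sum_i p i * expR (z i).
  by apply: sumr_ge0 => i _; rewrite mulr_ge0// expR_ge0.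
have E : \sum_i p i * (expR (z i) - 1) = \sum_i p i * expR (z i) - 1.
  by under eq_bigr do rewrite mulrBr mulr1; rewrite sumrB p1.
have [h|h] := ltP 0 (\sum_i p i * expR (z i)).
  rewrite E -[X in ln X](subrKC 1); apply: le_ln1Dx; lra.
have [i pi0] : exists i, p i != 0.
  apply/existsP; apply: contraT; rewrite negb_exists => /forallP H.
  move: p1; rewrite big1 => [/eqP|i _]; first by rewrite eq_sym oner_eq0.
  by apply/eqP/negPn; exact: H.
have : 0 < \sum_i p i * expR (z i).
  rewrite (bigD1 i)//= ltr_wpDr//.
    by apply: sumr_ge0 => j _; rewrite mulr_ge0// expR_ge0.
  by rewrite mulr_gt0 ?expR_gt0// lt_neqAle eq_sym pi0 p0.
by rewrite ltNge h.
Qed.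

(** Since [z] has mean zero, y is also the mean of the nonnegative quantity expR z - 1 - z. Then ln
    (1 + y) >= y - y^2, and Jensen bounds y^2 by the mean of the squares. *)
Lemma ln_sum_lower (z : S -> R) : \sum_i p i * z i = 0 ->
  \sum_i p i * (expR (z i) - 1) - \sum_i p i * (expR (z i) - 1 - z i) ^+ 2 <=
  ln (\sum_i p i * expR (z i)).
Proof.
move=> z0; set y := \sum_i p i * (expR (z i) - 1).
have E : \sum_i p i * expR (z i) = 1 + y.
  by rewrite /y; under [in RHS]eq_bigr do rewrite mulrBr mulr1; rewrite sumrB p1 subrKC.
have yE : y = \sum_i p i * (expR (z i) - 1 - z i).
  by under [in RHS]eq_bigr do rewrite mulrBr; rewrite sumrB z0 subr0.
have y0 : 0 <= y.
  rewrite yE; apply: sumr_ge0 => i _; rewrite mulr_ge0//.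
  by have /andP[] := expR_taylor1 (z i).
have y1 : 0 < 1 + y by rewrite ltr_pwDl.
have h : y - y ^+ 2 <= ln (1 + y).
  have -> : 1 + y = (1 + (- (y / (1 + y))))^-1.
    by rewrite -[X in X - _](divff (lt0r_neq0 y1)) -mulrBl addrK mul1r invrK.
  have q1 : 0 < 1 + (- (y / (1 + y))) .
    by rewrite subr_gt0 ltr_pdivrMr// mul1r ltrDr.
  rewrite lnV ?posrE// lerNr; apply: (@le_trans _ _ (- (y / (1 + y)))).
    by apply: le_ln1Dx; rewrite ltrNr opprK ltr_pdivrMr// mul1r ltrDr.
  rewrite lerN2 ler_pdivlMr//; nra.
rewrite E; apply: le_trans h; rewrite lerD2l lerNl opprK yE.
exact: jensen_sqr.
Qed.

End log_expansion.

Lemma eq_ler_trans (R : numDomainType) (x y z : R) : x = y -> y <= z -> x <= z.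
Proof. by move=> ->. Qed.

Lemma telescope_le (R : realFieldType) (f : nat -> R) (c : R) (K : nat) :
  (forall j, (j < K)%N -> f j <= f j.+1 + c) -> f 0%N <= f K + K%:R * c.
Proof.
elim: K => [|K IH] h; first by rewrite mul0r addr0.
apply: (le_trans (IH (fun j jK => h j (ltnW jK)))).
by have := h K (ltnSn K); rewrite -natr1; lra.
Qed.

Section sudakov_fernique.
Context {R : realType} (S : finType) (D : pred S) (i0 : S).
Hypothesis Di0 : D i0.
Local Notation MR := (measurableTypeR R).
Local Notation gauss n := (@gaussian R n).

Definition lin n (a : S -> n.-tuple MR) (x : n.-tuple MR) (i : S) : R :=
  dot (a i) x.

(** A crude Lipschitz constant common to all the linear forms; the added 1 keeps it positive. *)
Definition lipc n (a : S -> n.-tuple MR) : R :=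
  \sum_i Num.sqrt (dot (a i) (a i)) + 1.

Lemma lipc_gt0 n (a : S -> n.-tuple MR) : 0 < lipc a.
Proof. by rewrite ltr_wpDl// sumr_ge0. Qed.

Lemma lin_dist n (a : S -> n.-tuple MR) x y i :
  `|lin a x i - lin a y i| <= lipc a * l2dist x y.
Proof.
apply: lipfun_dot; rewrite /lipc (bigD1 i)//= -addrA lerDl.
by rewrite addr_ge0// sumr_ge0.
Qed.

Lemma measurable_dot n (v : n.-tuple MR) : measurable_fun [set: n.-tuple MR] (dot v).
Proof.
rewrite /dot; apply: measurable_sum => i.
by apply: measurable_funM => //; exact: measurable_tnth.
Qed.

Lemma lipfun_lse n (a : S -> n.-tuple MR) (u : S -> R) (r : R) :
  lipfun (`|r| * lipc a) (fun x => lse D (fun i => u i + r * lin a x i)).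
Proof.
move=> x y; apply: (lse_dist Di0) => i _.
rewrite opprD addrACA subrr add0r -mulrBr normrM -mulrA.
by rewrite ler_wpM2l// lin_dist.
Qed.

Lemma lipfun2_lse n m (a : S -> n.-tuple MR) (b : S -> m.-tuple MR) (u : S -> R)
    (r q : R) :
  lipfun2 (`|r| * lipc a + `|q| * lipc b)
    (fun z => lse D (fun i => u i + r * lin a z.1 i + q * lin b z.2 i)).
Proof.
have la := lipc_gt0 a; have lb := lipc_gt0 b.
split.
- apply: measurableT_comp => //.
  under eq_fun do rewrite big_mkcond/=.
  apply: measurable_sum => i; case: (D i) => //.
  apply: measurableT_comp => //; apply: measurable_funD.
    apply: measurable_funD => //; apply: measurable_funM => //.
    exact: (measurableT_comp (measurable_dot _)).
  by apply: measurable_funM => //; exact: (measurableT_comp (measurable_dot _)).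
- move=> y x x' /=; apply: (lse_dist Di0) => i _.
  rewrite [X in `|X|](_ : _ = r * (lin a x i - lin a x' i)); last by ring.
  rewrite normrM mulrDl -!mulrA; apply: ler_wpDr.
    by rewrite !mulr_ge0 ?l2dist_ge0// ltW.
  by rewrite ler_wpM2l// lin_dist.
- move=> x y y' /=; apply: (lse_dist Di0) => i _.
  rewrite [X in `|X|](_ : _ = q * (lin b y i - lin b y' i)); last by ring.
  rewrite normrM mulrDl -!mulrA; apply: ler_wpDl.
    by rewrite !mulr_ge0 ?l2dist_ge0// ltW.
  by rewrite ler_wpM2l// lin_dist.
Qed.

Definition wavg n (p : S -> R) (a : S -> n.-tuple MR) : n.-tuple MR :=
  [tuple \sum_i p i * tnth (a i) k | k < n].

Lemma dot_wavg n (p : S -> R) (a : S -> n.-tuple MR) x :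
  dot (wavg p a) x = \sum_i p i * dot (a i) x.
Proof.
rewrite /dot; under [RHS]eq_bigr do rewrite mulr_sumr.
rewrite exchange_big; apply: eq_bigr => k _ /=; rewrite tnth_mktuple mulr_suml.
by apply: eq_bigr => i _; rewrite mulrA.
Qed.

(** A bound on the squared distance of any point to any barycentre. It does not involve the weights,
    which makes the error in [lse_increment] uniform in [u]. *)
Definition spread n (a : S -> n.-tuple MR) : R :=
  \sum_i \sum_j sqdist (a i) (a j).

Section weights.
Variable p : S -> R.
Hypothesis p0 : forall i, 0 <= p i.
Hypothesis p1 : \sum_i p i = 1.

Lemma p_le1 i : p i <= 1.
Proof. by rewrite -p1 (bigD1 i)//= lerDl sumr_ge0. Qed.

(** A variance is half the mean squared distance of two independent samples. In this form only
    mutual distances occur, and these are what the comparison hypothesis controls. *)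
Lemma sum_sqdist_wavg n (a : S -> n.-tuple MR) :
  \sum_i p i * sqdist (a i) (wavg p a) =
  2^-1 * \sum_i \sum_j p i * p j * sqdist (a i) (a j).
Proof.
set A := \sum_i p i * dot (a i) (a i).
set B := dot (wavg p a) (wavg p a).
have BE : B = \sum_i p i * dot (a i) (wavg p a) by rewrite /B dot_wavg.
have -> : \sum_i p i * sqdist (a i) (wavg p a) = A - B.
  rewrite (eq_bigr (fun i => p i * dot (a i) (a i) -
      2 * (p i * dot (a i) (wavg p a)) + B * p i)).
    by rewrite big_split sumrB/= -!mulr_sumr p1 -BE -/A; ring.
  by move=> i _; rewrite sqdistE -/B; ring.
have -> : \sum_i \sum_j p i * p j * sqdist (a i) (a j) = 2 * (A - B).
  rewrite (eq_bigr (fun i => p i * dot (a i) (a i) -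
      2 * (p i * dot (a i) (wavg p a)) + A * p i)).
    by rewrite big_split sumrB/= -!mulr_sumr p1 -BE -/A; ring.
  move=> i _.
  rewrite (eq_bigr (fun j => (p i * dot (a i) (a i)) * p j -
      (2 * p i) * (p j * dot (a j) (a i)) + p i * (p j * dot (a j) (a j)))).
    rewrite big_split sumrB/= -!mulr_sumr p1 -/A -dot_wavg dotC; ring.
  by move=> j _; rewrite sqdistE (dotC (a i) (a j)); ring.
by rewrite mulKf.
Qed.

Lemma sqdist_wavg_le n (a : S -> n.-tuple MR) i :
  sqdist (a i) (wavg p a) <= spread a.
Proof.
apply: (@le_trans _ _ (\sum_j p j * sqdist (a i) (a j))).
  have : 0 <= \sum_j p j * sqdist (a j) (wavg p a).
    by apply: sumr_ge0 => j _; rewrite mulr_ge0// sqdist_ge0.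
  set B := dot (wavg p a) (wavg p a).
  have BE : B = \sum_i p i * dot (a i) (wavg p a) by rewrite /B dot_wavg.
  rewrite (eq_bigr (fun i => p i * dot (a i) (a i) -
      2 * (p i * dot (a i) (wavg p a)) + B * p i)); last first.
    by move=> j _; rewrite sqdistE -/B; ring.
  rewrite big_split sumrB/= -!mulr_sumr p1 -BE => h.
  rewrite (eq_bigr (fun j => dot (a i) (a i) * p j -
      2 * (p j * dot (a j) (a i)) + p j * dot (a j) (a j))); last first.
    by move=> j _; rewrite sqdistE (dotC (a i) (a j)); ring.
  rewrite big_split sumrB/= -!mulr_sumr p1 -dot_wavg sqdistE -/B (dotC _ (a i)).
  lra.
apply: (@le_trans _ _ (\sum_j sqdist (a i) (a j))).
  by apply: ler_sum => j _; rewrite ler_piMl ?sqdist_ge0// p_le1.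
rewrite /spread [leRHS](bigD1 i)//= lerDl.
by apply: sumr_ge0 => j _; apply: sumr_ge0 => k _; exact: sqdist_ge0.
Qed.

Variables (n : nat) (a : S -> n.-tuple MR).

Let c (i : S) : n.-tuple MR := lcomb 1 (- 1) (a i) (wavg p a).
Let d (i : S) : R := sqdist (a i) (wavg p a).

Let dot_c i x : dot (c i) x = dot (a i) x - dot (wavg p a) x.
Proof. by rewrite dotC dot_lcombr !(dotC x); ring. Qed.

Let dot_cc i : dot (c i) (c i) = d i.
Proof. by rewrite dot_c !dot_lcombr /d sqdistE (dotC (wavg p a) (a i)); ring. Qed.

Let scale (s : R) (v : n.-tuple MR) : n.-tuple MR := lcomb s 0 v v.

Let dot_scale s v x : dot (scale s v) x = s * dot v x.
Proof. by rewrite dotC dot_lcombr (dotC x); ring. Qed.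

Let mgf s i : intg (gauss n) (fun x => expR (s * dot (c i) x)) /\
  \int[gauss n]_x expR (s * dot (c i) x) = expR (s ^+ 2 * d i / 2).
Proof.
have [h1 h2] := intg_expR_dot (scale s (c i)).
rewrite (_ : (fun x => _) = fun x => expR (dot (scale s (c i)) x)); last first.
  by apply/funext => x; rewrite dot_scale.
split => //; rewrite h2 dot_scale dotC dot_scale dot_cc; congr expR; ring.
Qed.

(** Subtracting the barycentre centres the exponents under [p], as the lower bound on the logarithm
    requires; the linear term that comes out has Gaussian mean zero. *)
Let ln_center s x :
  ln (\sum_i p i * expR (s * dot (a i) x)) =
  s * dot (wavg p a) x + ln (\sum_i p i * expR (s * dot (c i) x)).
Proof.
have E : \sum_i p i * expR (s * dot (a i) x) =
    expR (s * dot (wavg p a) x) * \sum_i p i * expR (s * dot (c i) x).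
  rewrite mulr_sumr; apply: eq_bigr => i _; rewrite mulrCA -expRD dot_c.
  by congr (_ * expR _); ring.
rewrite E lnM ?expRK// ?posrE ?expR_gt0//.
have s0 : 0 <= \sum_i p i * expR (s * dot (c i) x).
  by apply: sumr_ge0 => i _; rewrite mulr_ge0// expR_ge0.
rewrite lt_neqAle s0 andbT; apply/eqP => z.
have : \sum_i p i = 0.
  apply: big1 => i _; apply/eqP.
  move/esym/eqP: z; rewrite psumr_eq0.
    by move=> /allP/(_ i (mem_index_enum i)); rewrite mulf_eq0 (gt_eqF (expR_gt0 _)) orbF.
  by move=> j _; rewrite mulr_ge0// expR_ge0.
by rewrite p1 => /eqP; rewrite oner_eq0.
Qed.

Let intg_mean s : intg (gauss n) (fun x => s * dot (wavg p a) x) /\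
  \int[gauss n]_x (s * dot (wavg p a) x) = 0.
Proof.
have [h1 h2] := Rint_dot (wavg p a).
by split; [exact: intgZ|rewrite RintZ// h2 mulr0].
Qed.

Let intg_Y s : intg (gauss n) (fun x => \sum_i p i * (expR (s * dot (c i) x) - 1)).
Proof.
apply: intg_sum => i _; apply: intgZ; apply: intgB; last exact: intg_cst.
by case: (mgf s i).
Qed.

Let Rint_Y s : \int[gauss n]_x (\sum_i p i * (expR (s * dot (c i) x) - 1)) =
  \sum_i p i * (expR (s ^+ 2 * d i / 2) - 1).
Proof.
have i1 i : intg (gauss n) (fun x => expR (s * dot (c i) x) - 1).
  by apply: intgB; [case: (mgf s i)|exact: intg_cst].
rewrite Rint_sum; last by move=> i; apply: intgZ.
apply: eq_bigr => i _; rewrite RintZ// RintB; last 2 first.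
- by case: (mgf s i).
- exact: intg_cst.
by rewrite Rintegral_prob_cst; case: (mgf s i) => _ ->.
Qed.

Hypothesis intg_ln : forall s,
  intg (gauss n) (fun x => ln (\sum_i p i * expR (s * dot (a i) x))).

Let V := spread a.

Let d_ge0 i : 0 <= d i. Proof. exact: sqdist_ge0. Qed.
Let d_leV i : d i <= V. Proof. exact: sqdist_wavg_le. Qed.

Let V0 : 0 <= V.
Proof. by do 2 apply: sumr_ge0 => ? _; exact: sqdist_ge0. Qed.

(** The logarithm lies below its tangent at 1, and the centred exponentials have means exp(s^2 d_i /
    2). The term linear in s^2 is the weighted sum of squared distances; the remainder is of order
    s^4 with a constant free of [p]. *)
Lemma Rint_ln_upper (s : R) : 0 <= s <= 1 ->
  \int[gauss n]_x ln (\sum_i p i * expR (s * dot (a i) x)) <=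
  s ^+ 2 / 4 * (\sum_i \sum_j p i * p j * sqdist (a i) (a j)) +
  s ^+ 4 * (V ^+ 2 * expR V).
Proof.
move=> /andP[s0 s1].
have [m1 m2] := intg_mean s.
apply: (@le_trans _ _ (\sum_i p i * (expR (s ^+ 2 * d i / 2) - 1))).
  apply: (@le_trans _ _ (\int[gauss n]_x (s * dot (wavg p a) x +
      \sum_i p i * (expR (s * dot (c i) x) - 1)))); last first.
    by rewrite RintD// m2 add0r Rint_Y.
  apply: Rint_le => //; first exact: intgD.
  by move=> x; rewrite ln_center lerD2l; exact: ln_sum_upper.
apply: (@le_trans _ _ (\sum_i (s ^+ 2 / 2 * (p i * d i) +
    s ^+ 4 * (V ^+ 2 * expR V) * p i))); last first.
  rewrite big_split/= -!mulr_sumr p1 mulr1 sum_sqdist_wavg.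
  by rewrite le_eqVlt; apply/orP; left; apply/eqP; field.
apply: ler_sum => i _.
have w0 : 0 <= s ^+ 2 * d i / 2 by rewrite divr_ge0// mulr_ge0// sqr_ge0.
have s21 : s ^+ 2 <= 1 by rewrite expr_le1.
have dV := d_leV i; have d0 := d_ge0 i.
have wV : s ^+ 2 * d i / 2 <= V.
  have : s ^+ 2 * d i <= 1 * V by rewrite ler_pM// sqr_ge0.
  by lra.
have /andP[_] := expR_taylor1 (s ^+ 2 * d i / 2); rewrite ger0_norm// => h.
have h2 : (s ^+ 2 * d i / 2) ^+ 2 * expR (s ^+ 2 * d i / 2) <=
    s ^+ 4 * (V ^+ 2 * expR V).
  rewrite mulrA; apply: ler_pM; rewrite ?sqr_ge0 ?expR_ge0 ?ler_expR//.
  rewrite (_ : s ^+ 4 * V ^+ 2 = (s ^+ 2 * V) ^+ 2); last by ring.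
  have : s ^+ 2 * d i <= s ^+ 2 * V by rewrite ler_wpM2l ?sqr_ge0.
  by move=> h3; rewrite lerXn2r ?nnegrE// ?mulr_ge0 ?sqr_ge0//; lra.
have -> : s ^+ 2 / 2 * (p i * d i) + s ^+ 4 * (V ^+ 2 * expR V) * p i =
  p i * (s ^+ 2 * d i / 2 + s ^+ 4 * (V ^+ 2 * expR V)) by ring.
by rewrite ler_wpM2l//; lra.
Qed.

Let pow4_le (t : R) : t ^+ 4 * expR (2 * `|t|) <= 256 * (expR (3 * t) + expR (- 3 * t)).
Proof.
have H (u : R) : 0 <= u -> u ^+ 4 * expR (2 * u) <= 256 * expR (3 * u).
  move=> u0; have h := expR_ge1Dx (u / 4).
  have u4 : 0 <= u / 4 by rewrite divr_ge0.
  have -> : expR (3 * u) = expR (u / 4) ^+ 4 * expR (2 * u).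
    by rewrite -expRM_natl -expRD; congr expR; field.
  rewrite mulrA ler_wpM2r ?expR_ge0//.
  have : (u / 4) ^+ 4 <= expR (u / 4) ^+ 4.
    by rewrite lerXn2r ?nnegrE ?expR_ge0//; lra.
  by rewrite exprMn exprVn ler_pdivrMr//; lra.
have := expR_gt0 (3 * t); have := expR_gt0 (- 3 * t).
have [t0|t0] := leP 0 t; first by rewrite ger0_norm//; have := H t t0; lra.
rewrite ltr0_norm//; have := H (- t); rewrite oppr_ge0 (ltW t0) => /(_ isT).
have -> : (- t) ^+ 4 = t ^+ 4 by ring.
by have -> : 3 * - t = - 3 * t; [ring|lra].
Qed.

Lemma Rint_ln_lower (s : R) : 0 <= s <= 1 ->
  s ^+ 2 / 4 * (\sum_i \sum_j p i * p j * sqdist (a i) (a j)) -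
  s ^+ 4 * (512 * expR (5 * V)) <=
  \int[gauss n]_x ln (\sum_i p i * expR (s * dot (a i) x)).
Proof.
move=> /andP[s0 s1].
have [m1 m2] := intg_mean s.
(* [Q] dominates the quadratic loss of [ln_sum_lower]: with t the centred linear form and s <= 1,
   (exp(s t) - 1 - s t)^2 <= s^4 t^4 exp(2 |t|), and [pow4_le] trades the fourth power for exp(3 t)
   + exp(-3 t). Their means are exp(9 d_i / 2) <= exp(5 V). *)
pose Q x := \sum_i p i * (s ^+ 4 * 256 * (expR (3 * dot (c i) x) + expR (- 3 * dot (c i) x))).
have iq i : intg (gauss n) (fun x => expR (3 * dot (c i) x) + expR (- 3 * dot (c i) x)).
  by apply: intgD; [case: (mgf 3 i)|case: (mgf (- 3) i)].
have iQ : intg (gauss n) Q by apply: intg_sum => i _; do 2 apply: intgZ.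
have QE : \int[gauss n]_x Q x <= s ^+ 4 * (512 * expR (5 * V)).
  rewrite /Q Rint_sum; last by move=> i; do 2 apply: intgZ.
  apply: (@le_trans _ _ (\sum_i s ^+ 4 * (512 * expR (5 * V)) * p i)); last first.
    by rewrite -mulr_sumr p1 mulr1.
  apply: ler_sum => i _; rewrite RintZ; last exact: intgZ.
  rewrite RintZ// [leRHS]mulrC ler_wpM2l// -mulrA ler_wpM2l ?exprn_ge0//.
  rewrite RintD; [|by case: (mgf 3 i)|by case: (mgf (- 3) i)].
  case: (mgf 3 i) => _ ->; case: (mgf (- 3) i) => _ ->.
  have dV := d_leV i; have d0 := d_ge0 i.
  have : expR (3 ^+ 2 * d i / 2) <= expR (5 * V) by rewrite ler_expR; lra.
  by rewrite sqrrN; lra.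
apply: (@le_trans _ _ (\int[gauss n]_x
    (s * dot (wavg p a) x +
     (\sum_i p i * (expR (s * dot (c i) x) - 1) - Q x)))).
  rewrite RintD//; last exact: intgB.
  rewrite m2 add0r RintB// Rint_Y; apply: lerB => //.
  rewrite (_ : s ^+ 2 / 4 * _ = \sum_i s ^+ 2 / 2 * (p i * d i)); last first.
    by rewrite -mulr_sumr sum_sqdist_wavg; field.
  apply: ler_sum => i _.
  have : s ^+ 2 * d i / 2 <= expR (s ^+ 2 * d i / 2) - 1.
    by rewrite lerBrDl expR_ge1Dx.
  by move=> /(ler_wpM2l (p0 i)); lra.
apply: Rint_le => //.
  by apply: intgD => //; exact: intgB.
move=> x; rewrite ln_center lerD2l.
apply: le_trans (ln_sum_lower p0 p1 _); last first.
  under eq_bigr do rewrite mulrCA.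
  rewrite -mulr_sumr; under eq_bigr do rewrite dot_c mulrBr.
  by rewrite sumrB -mulr_suml p1 mul1r -dot_wavg subrr mulr0.
rewrite lerD2l lerN2; apply: ler_sum => i _; rewrite ler_wpM2l//.
set t := dot (c i) x.
have /andP[h0 h1] := expR_taylor1 (s * t).
apply: (@le_trans _ _ (((s * t) ^+ 2 * expR `|s * t|) ^+ 2)).
  by rewrite lerXn2r ?nnegrE// mulr_ge0 ?sqr_ge0 ?expR_ge0.
set e := expR _; have -> : ((s * t) ^+ 2 * e) ^+ 2 = s ^+ 4 * (t ^+ 4 * e ^+ 2) by ring.
rewrite -[leRHS]mulrA ler_wpM2l ?exprn_ge0//; apply: (le_trans _ (pow4_le t)).
rewrite ler_wpM2l//; first by rewrite (_ : t ^+ 4 = (t ^+ 2) ^+ 2) ?sqr_ge0// -exprM.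
by rewrite /e -expRM_natl ler_expR ler_wpM2l// normrM ger0_norm// ler_piMl.
Qed.

End weights.

Lemma intg_lse_shift n (a : S -> n.-tuple MR) (u : S -> R) s :
  intg (gauss n) (fun x => lse D (fun i => u i + s * lin a x i)).
Proof.
have h := lipfun_lse a u s.
have L0 : 0 < (`|s| + 1) * lipc a by rewrite mulr_gt0 ?lipc_gt0// ltr_wpDl.
apply: (lip_intg L0); apply: lipfun_le h.
by rewrite ler_wpM2r ?lerDl// ltW// lipc_gt0.
Qed.

Section comparison.
Variables (n m : nat) (a : S -> n.-tuple MR) (b : S -> m.-tuple MR).
Hypothesis ab : forall i j, sqdist (a i) (a j) <= sqdist (b i) (b j).

(* The two processes are exchanged through increments of size [s]; to second
   order the increments are compared by [ab], the error being of order [s ^ 4]. *)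
Lemma lse_increment : exists C : R, forall (u : S -> R) (s : R),
  0 <= s <= 1 ->
  \int[gauss n]_x lse D (fun i => u i + s * lin a x i) <=
  \int[gauss m]_y lse D (fun i => u i + s * lin b y i) + s ^+ 4 * C.
Proof.
exists (spread a ^+ 2 * expR (spread a) + 512 * expR (5 * spread b)).
move=> u s s01; set p := softmax D u.
have p0 i : 0 <= p i := softmax_ge0 u i Di0.
have p1 : \sum_i p i = 1 := softmax_sum1 u Di0.
have iln k (v : S -> k.-tuple MR) t :
    intg (gauss k) (fun x => ln (\sum_i p i * expR (t * dot (v i) x))).
  rewrite (_ : (fun x => _) =
      fun x => lse D (fun i => u i + t * lin v x i) - lse D u).
    by apply: intgB; [exact: intg_lse_shift|exact: intg_cst].
  apply/funext => x; rewrite (@lse_shift _ _ _ i0)//.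
  by rewrite addrC addKr.
have E k (v : S -> k.-tuple MR) :
    \int[gauss k]_x lse D (fun i => u i + s * lin v x i) =
    lse D u + \int[gauss k]_x ln (\sum_i p i * expR (s * dot (v i) x)).
  under eq_Rintegral do rewrite (@lse_shift _ _ _ i0)//.
  by rewrite (RintD (intg_cst _ _) (iln _ _ _)) Rintegral_prob_cst.
rewrite !E -addrA lerD2l.
apply: (le_trans (Rint_ln_upper p0 p1 (iln _ a) s01)).
have := Rint_ln_lower p0 p1 (iln _ b) s01.
have : \sum_i \sum_j p i * p j * sqdist (a i) (a j) <=
    \sum_i \sum_j p i * p j * sqdist (b i) (b j).
  by apply: ler_sum => i _; apply: ler_sum => j _; rewrite ler_wpM2l ?mulr_ge0.
move=> /(@ler_wpM2l _ (s ^+ 2 / 4) (divr_ge0 (sqr_ge0 s) _)) => /(_ ltac:(by [])).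
by rewrite mulrDr; lra.
Qed.

Let G (u : S -> R) (r q : R) x y :=
  lse D (fun i => u i + r * lin a x i + q * lin b y i).

Variable C : R.
Hypothesis incr : forall (u : S -> R) (s : R), 0 <= s <= 1 ->
  \int[gauss n]_x lse D (fun i => u i + s * lin a x i) <=
  \int[gauss m]_y lse D (fun i => u i + s * lin b y i) + s ^+ 4 * C.

(** Rotation invariance splits the first field, of size [r], into independent parts of sizes [r']
    and [s], and the second, of size [q'], into parts of sizes [q] and [s]. Conditionally on
    everything but the parts of size [s], this is the comparison of increments. *)
Lemma lse_exchange_step (u : S -> R) (r q r' q' s : R) :
  0 < r -> 0 < q' -> 0 < s <= 1 -> r ^+ 2 = r' ^+ 2 + s ^+ 2 ->
  q' ^+ 2 = q ^+ 2 + s ^+ 2 ->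
  \int[gauss n]_x \int[gauss m]_y G u r q x y <=
  \int[gauss n]_x \int[gauss m]_y G u r' q' x y + s ^+ 4 * C.
Proof.
move=> r0 q0 /andP[s0 s1] rE qE; have [la lb] := (lipc_gt0 a, lipc_gt0 b).
have s01 : 0 <= s <= 1 by rewrite ltW.
have wgt0 (t1 t2 : R) k1 k2 (v : S -> k1.-tuple MR) (w : S -> k2.-tuple MR) :
    0 < t2 -> 0 < `|t1| * lipc v + `|t2| * lipc w.
  move=> t20; apply: ltr_wpDl; first by apply: mulr_ge0 => //; exact/ltW/lipc_gt0.
  by rewrite mulr_gt0 ?lipc_gt0// normr_gt0 gt_eqF.
have M1 : 0 < `|r| * lipc a + `|q| * lipc b by rewrite addrC wgt0.
have L1 := lipfun_Rint M1 (lipfun2_lse a b u r q).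
have L2 := lipfun_Rint (wgt0 r' q' _ _ a b q0) (lipfun2_lse a b u r' q').
have rs2 : (r' / r) ^+ 2 + (s / r) ^+ 2 = 1.
  by rewrite !exprMn exprVn -mulrDl -rE divff// expf_neq0// gt_eqF.
have sr0 : 0 < s / r by rewrite divr_gt0.
apply: (eq_ler_trans (esym (Rint_lcomb M1 L1 sr0 rs2))).
have qs2 : (q / q') ^+ 2 + (s / q') ^+ 2 = 1.
  by rewrite !exprMn exprVn -mulrDl -qE divff// expf_neq0// gt_eqF.
have sq0 : 0 < s / q' by rewrite divr_gt0.
have M3 : 0 < (`|r' / r| + `|s / r|) * (`|r| * lipc a + `|q| * lipc b).
  by rewrite mulr_gt0// ltr_wpDl// normr_gt0 gt_eqF.
have L3 := lipfun_Rint M3 (lipfun2_lcomb (r' / r) (s / r) M1 L1).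
rewrite -[X in _ <= _ + X](Rintegral_prob_cst (gauss n)) -RintD; last 2 first.
- exact: (lip_intg (wgt0 r' q' _ _ a b q0) L2).
- exact: intg_cst.
apply: Rint_le.
- exact: (lip_intg M3 L3).
- by apply: intgD; [exact: (lip_intg (wgt0 r' q' _ _ a b q0) L2)|exact: intg_cst].
move=> x /=.
pose u' i := u i + r' * lin a x i.
have E1 x2 y : lse D (fun i => u i + r * lin a (lcomb (r' / r) (s / r) x x2) i +
    q * lin b y i) = lse D (fun i => u' i + s * lin a x2 i + q * lin b y i).
  congr (lse D _); apply/funext => i; rewrite /u' /lin dot_lcombr.
  by field; rewrite gt_eqF.
under eq_Rintegral do under eq_Rintegral do rewrite E1.
have Ms : 0 < `|s| * lipc a + `|q| * lipc b by rewrite addrC wgt0.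
rewrite (Rint_exchange Ms (lipfun2_lse a b u' s q)) /=.
have Lq' := @lipfun_lse m b u' q'.
have Mq : 0 < `|q'| * lipc b by rewrite mulr_gt0// normr_gt0 gt_eqF.
rewrite -(Rint_lcomb Mq Lq' sq0 qs2).
have L4 := lipfun_Rint (wgt0 q s _ _ b a s0) (lipfun2_lse b a u' q s).
have L5 := lipfun_Rint (wgt0 q s _ _ b b s0) (lipfun2_lse b b u' q s).
have E2 y y2 : lse D (fun i => u' i + q' * lin b (lcomb (q / q') (s / q') y y2) i) =
    lse D (fun i => u' i + q * lin b y i + s * lin b y2 i).
  congr (lse D _); apply/funext => i; rewrite /lin dot_lcombr.
  by field; rewrite gt_eqF.
under [in leRHS]eq_Rintegral do under eq_Rintegral do rewrite E2.
rewrite -[X in _ <= _ + X](Rintegral_prob_cst (gauss m)) -RintD; last 2 first.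
- exact: (lip_intg (wgt0 q s _ _ b b s0) L5).
- exact: intg_cst.
have E3 y x2 : lse D (fun i => u' i + s * lin a x2 i + q * lin b y i) =
    lse D (fun i => u' i + q * lin b y i + s * lin a x2 i).
  by congr (lse D _); apply/funext => i; rewrite addrAC.
apply: (eq_ler_trans (eq_Rintegral _
  (fun y _ => eq_Rintegral _ (fun x2 _ => E3 y x2)))).
apply: Rint_le.
- exact: (lip_intg (wgt0 q s _ _ b a s0) L4).
- by apply: intgD; [exact: (lip_intg (wgt0 q s _ _ b b s0) L5)|exact: intg_cst].
by move=> y; exact: incr.
Qed.

(** Discrete Gaussian interpolation: [K] steps carry the weights of the two fields from (1, 0) to
    (0, 1) along sqrt(1 - j/K) and sqrt(j/K). Each step exchanges variance 1/K at a cost C / K^2,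
    and the total error C / K vanishes as K grows. *)
Lemma sudakov_fernique_C :
  \int[gauss n]_x lse D (lin a x) <= \int[gauss m]_y lse D (lin b y).
Proof.
pose u (i : S) : R := 0.
suff H (K : nat) : (0 < K)%N ->
    \int[gauss n]_x lse D (lin a x) <= \int[gauss m]_y lse D (lin b y) + C / K%:R.
  apply/ler_addgt0Pr => e e0.
  pose K := (Num.truncn (C / e)).+1.
  apply: (le_trans (H K isT)); rewrite lerD2l ler_pdivrMr ?ltr0n//.
  rewrite mulrC -ler_pdivrMr//; apply: ltW; exact: truncnS_gt.
move=> K0; have K0' : 0 < K%:R :> R by rewrite ltr0n.
pose al j : R := Num.sqrt ((K - j)%:R / K%:R).
pose be j : R := Num.sqrt (j%:R / K%:R).
set s := Num.sqrt (K%:R^-1 : R).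
have s0 : 0 < s by rewrite sqrtr_gt0 invr_gt0.
have s2 : s ^+ 2 = K%:R^-1 by rewrite sqr_sqrtr// invr_ge0 ltW.
have s01 : 0 < s <= 1.
  rewrite s0/= -(@ler_pXn2r _ 2)// ?nnegrE ?(ltW s0)// s2 expr1n.
  by rewrite invf_le1// ler1n.
have al2 i : al i ^+ 2 = (K - i)%:R / K%:R by rewrite sqr_sqrtr// divr_ge0.
have be2 i : be i ^+ 2 = i%:R / K%:R by rewrite sqr_sqrtr// divr_ge0.
have step j : (j < K)%N ->
    \int[gauss n]_x \int[gauss m]_y G u (al j) (be j) x y <=
    \int[gauss n]_x \int[gauss m]_y G u (al j.+1) (be j.+1) x y + s ^+ 4 * C.
  move=> jK; apply: lse_exchange_step => //.
  - by rewrite sqrtr_gt0 divr_gt0// ltr0n subn_gt0.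
  - by rewrite sqrtr_gt0 divr_gt0// ltr0n.
  - rewrite !al2 s2 subnS; have : (0 < K - j)%N by rewrite subn_gt0.
    by case: (K - j)%N => // k _; rewrite -natr1 mulrDl mul1r.
  - by rewrite !be2 s2 -natr1 mulrDl mul1r.
have := telescope_le step.
have -> : K%:R * (s ^+ 4 * C) = C / K%:R.
  rewrite (_ : s ^+ 4 = (s ^+ 2) ^+ 2); last by rewrite -exprM.
  by rewrite s2; field; rewrite gt_eqF.
have -> : al 0%N = 1 by rewrite /al subn0 divff ?sqrtr1// gt_eqF.
have -> : be K = 1 by rewrite /be divff ?sqrtr1// gt_eqF.
have -> : al K = 0 by rewrite /al subnn mul0r sqrtr0.
have -> : be 0%N = 0 by rewrite /be mul0r sqrtr0.
have E1 x y : G u 1 0 x y = lse D (lin a x).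
  by congr (lse D _); apply/funext => i; rewrite /u; ring.
have E2 x y : G u 0 1 x y = lse D (lin b y).
  by congr (lse D _); apply/funext => i; rewrite /u; ring.
have F1 : \int[gauss n]_x lse D (lin a x) = \int[gauss n]_x \int[gauss m]_y G u 1 0 x y.
  apply: eq_Rintegral => x _; rewrite -[LHS](Rintegral_prob_cst (gauss m)).
  by apply: eq_Rintegral => y _; rewrite E1.
have F2 : \int[gauss n]_x \int[gauss m]_y G u 0 1 x y = \int[gauss m]_y lse D (lin b y).
  rewrite -[RHS](Rintegral_prob_cst (gauss n)).
  by apply: eq_Rintegral => x _; apply: eq_Rintegral => y _; rewrite E2.
move=> h; apply: (eq_ler_trans F1); apply: (le_trans h).
by rewrite lerD2r; exact: (eq_ler_trans F2).
Qed.

End comparison.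

Lemma sudakov_fernique n m (a : S -> n.-tuple MR) (b : S -> m.-tuple MR) :
  (forall i j, sqdist (a i) (a j) <= sqdist (b i) (b j)) ->
  \int[gauss n]_x lse D (lin a x) <= \int[gauss m]_y lse D (lin b y).
Proof.
by move=> /lse_increment[C incr]; exact: (sudakov_fernique_C incr).
Qed.

End sudakov_fernique.

(** * Gaussian distribution function *)

Section normal_distribution_function.
Context {R : realType}.
Local Notation MR := (measurableTypeR R).
Local Notation leb := (@lebesgue_measure R).
Local Notation N01 := (normal_prob (0 : R) 1).
Local Notation phi := (normal_pdf (0 : R) 1).
Local Notation gauss n := (@gaussian R n).

Lemma integral_lebesgueN (f : MR -> \bar R) : measurable_fun [set: MR] f ->
  (forall x, 0 <= f x)%E -> (\int[leb]_x f (- x)%R = \int[leb]_x f x)%E.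
Proof.
move=> mf f0.
have mN : measurable_fun [set: MR] (-%R : MR -> MR) by exact: oppr_measurable.
pose mu : {measure set MR -> \bar R} :=
  measure_function_pushforward__canonical__measure_function_Measure leb mN.
transitivity (\int[mu]_x f x)%E; last first.
  by apply: eq_measure_integral => A mA _; exact: lebesgue_measureN.
by rewrite /mu /= ge0_integral_pushforward.
Qed.

Lemma normal_pdf01N (x : R) : phi (- x) = phi x.
Proof. by rewrite !normal_pdf01E sqrrN. Qed.

Lemma integral_N01N (f : MR -> \bar R) : measurable_fun [set: MR] f ->
  (forall x, 0 <= f x)%E -> (\int[N01]_x f (- x)%R = \int[N01]_x f x)%E.
Proof.
move=> mf f0.
have mN : measurable_fun [set: MR] (fun x => f (- x)).
  by apply: measurableT_comp => //; exact: oppr_measurable.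
have mp : measurable_fun [set: MR] (fun x => (phi x)%:E).
  by apply/measurable_EFinP; exact: measurable_normal_pdf.
rewrite !integral_N01// -[RHS]integral_lebesgueN.
- by apply: eq_integral => x _; rewrite normal_pdf01N.
- exact: emeasurable_funM.
- by move=> x; rewrite mule_ge0// lee_fin normal_pdf_ge0.
Qed.

Lemma N01_chernoff (v r : R) :
  (N01 [set x | (r <= v * x)%R] <= (expR (v ^+ 2 / 2 - r))%:E)%E.
Proof.
have me : measurable_fun [set: MR] (fun x : MR => expR (v * x - v ^+ 2 / 2)).
  by apply: measurableT_comp => //; exact: measurable_funB.
have E : (\int[N01]_x (expR (v * x - v ^+ 2 / 2))%:E = 1)%E.
  have := @N01_translation R (cst 1%E) v (measurable_cst _) (fun _ => lee01).
  rewrite integral_cst//= probability_setT mule1 => ->.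
  by apply: eq_integral => x _; rewrite mul1e.
pose c := expR (v ^+ 2 / 2 - r).
apply: (@le_trans _ _ (\int[N01]_x (c * expR (v * x - v ^+ 2 / 2))%:E)%E).
  apply: prob_markov.
  - by apply: measurable_bool_set; exact: measurable_fun_ler.
  - exact: measurable_funM.
  - by move=> x; rewrite mulr_ge0 ?expR_ge0.
  - by move=> x /= h; rewrite -expRD -expR0 ler_expR; lra.
under eq_integral do rewrite EFinM.
rewrite ge0_integralZl//; last 2 first.
- exact/measurable_EFinP.
- by rewrite lee_fin expR_ge0.
by rewrite E mule1.
Qed.

Lemma PhiE (x : R) : (Phi x)%:E = N01 [set` `]-oo, x]%R].
Proof. by rewrite /Phi fineK// fin_num_measure. Qed.

Lemma Phi_le (x y : R) : x <= y -> Phi x <= Phi y.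
Proof.
move=> xy; rewrite -lee_fin !PhiE; apply: le_measure; rewrite ?inE//.
by apply: subset_itvl; rewrite bnd_simp.
Qed.

Lemma Phi_lipschitz (x y : R) : x <= y ->
  Phi y - Phi x <= normal_peak 1 * (y - x).
Proof.
move=> xy; rewrite -lee_fin EFinB !PhiE.
have -> : [set` `]-oo, y]%R] = [set` `]-oo, x]%R] `|` [set` `]x, y]%R] :> set R.
  by rewrite -itv_bndbnd_setU// bnd_simp.
rewrite measureU//; last first.
  apply/seteqP; split => z //=; rewrite !in_itv/= => -[zx /andP[xz _]].
  by move: (lt_le_trans xz zx); rewrite ltxx.
rewrite addeAC subee ?fin_num_measure// add0e.
apply: (@le_trans _ _ (\int[leb]_(z in [set` `]x, y]%R]) (normal_peak 1)%:E)%E).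
  apply: ge0_le_integral => //.
  - by move=> z _; rewrite lee_fin normal_pdf_ge0.
  - by apply/measurable_EFinP/measurable_funTS; exact: measurable_normal_pdf.
  - by move=> z _; rewrite lee_fin normal_pdf_ub ?oner_eq0.
rewrite integral_cst//= lebesgue_measure_itv/= lte_fin.
case: ifPn => [_|]; first by rewrite -EFinD -EFinM.
rewrite -leNgt => yx; have -> : y = x by apply/eqP; rewrite eq_le xy yx.
by rewrite subrr mulr0 mule0.
Qed.

Lemma Phi_continuous : continuous (@Phi R).
Proof.
have p0 : 0 < normal_peak (1 : R) by rewrite normal_peak_gt0// oner_eq0.
have L (x y : R) : `|Phi x - Phi y| <= normal_peak 1 * `|x - y|.
  have [xy|xy] := leP x y.
    rewrite distrC ger0_norm ?subr_ge0 ?Phi_le// distrC ger0_norm ?subr_ge0//.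
    exact: Phi_lipschitz.
  rewrite ger0_norm ?subr_ge0 ?Phi_le ?(ltW xy)// ger0_norm ?subr_ge0 ?(ltW xy)//.
  exact: Phi_lipschitz (ltW xy).
move=> x; apply/cvgrPdist_lt => e e0; near=> y.
apply: (le_lt_trans (L x y)); rewrite -ltr_pdivlMl//.
near: y; apply: cvgr_dist_lt; last by rewrite mulr_gt0// invr_gt0.
exact: cvg_id.
Unshelve. all: by end_near. Qed.

Lemma Phi_surj (p : R) : 0 < p -> p < 1 -> exists x : R, Phi x = p.
Proof.
move=> p0 p1.
(* At these two points the Chernoff bounds of parameters -1 and 1 equal [p] and 1 - p exactly. *)
pose r1 := 2^-1 - ln p; pose r2 := 2^-1 - ln (1 - p).
have h1 : Phi (- r1) <= p.
  rewrite -lee_fin PhiE; have := N01_chernoff (- 1) r1.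
  rewrite sqrrN expr1n mul1r /r1 subKr lnK ?posrE//; apply: le_trans.
  apply: le_measure; rewrite ?inE//.
    by apply: measurable_bool_set; exact: measurable_fun_ler.
  by move=> x /=; rewrite in_itv/= mulN1r lerNr.
have h2 : p <= Phi r2.
  rewrite -lee_fin PhiE.
  have -> : [set` `]-oo, r2]%R] = ~` [set` `]r2, +oo[%R] :> set R by rewrite setCitvr.
  rewrite probability_setC// leeBrDr ?fin_num_measure//.
  rewrite -leeBrDl// -EFinB.
  have := N01_chernoff 1 r2.
  rewrite expr1n mul1r /r2 subKr lnK ?posrE ?subr_gt0//; apply: le_trans.
  apply: le_measure; rewrite ?inE//.
    by apply: measurable_bool_set; exact: measurable_fun_ler.
  by move=> x /=; rewrite in_itv/= mul1r andbT => /ltW.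
have [r12|r12] := leP (- r1) r2.
  have [|x _ xp] := IVT (v := p) r12 (continuous_subspaceT Phi_continuous).
    rewrite min_l ?max_r ?h1 ?h2//; exact: le_trans h1 h2.
  by exists x.
(* If the two points come in the wrong order, monotonicity squeezes: p <= Phi r2 <= Phi (- r1) <=
   p. *)
exists r2; apply/eqP; rewrite eq_le h2 andbT.
by apply: le_trans h1; exact/Phi_le/ltW.
Qed.

Lemma Phi_invK (p : R) : 0 < p -> p < 1 -> Phi (Phi_inv p) = p.
Proof.
move=> p0 p1; apply: pinvK; apply/mem_set => /=.
by have [x xp] := Phi_surj p0 p1; exists x.
Qed.

Lemma N01_ge (x : R) : (N01 [set` `[x, +oo[%R] = (1 - Phi x)%:E)%E.
Proof.
rewrite EFinB PhiE -probability_setC// setCitvl /normal_prob.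
by rewrite -integral_itv_obnd_cbnd//; apply/measurable_EFinP/measurable_funTS;
  exact: measurable_normal_pdf.
Qed.

Lemma Phi0 : Phi (0 : R) = 2^-1.
Proof.
have : (Phi (0 : R))%:E = (1 - Phi (0 : R))%:E.
  rewrite -N01_ge PhiE.
  have mi A : measurable A -> (\int[N01]_x (\1_A x)%:E = N01 A)%E.
    by move=> mA; rewrite integral_indic// setIT.
  rewrite -!mi// -[LHS]integral_N01N//; last first.
    by apply/measurable_EFinP; exact: measurable_indic.
  apply: eq_integral => x _; rewrite !indicE; congr ((nat_of_bool _)%:R%:E).
  by apply/idP/idP; rewrite !inE/= !in_itv/= ?andbT oppr_le0.
by move=> [h]; lra.
Qed.

Lemma Phi_inv_ge0 (q : R) : 0 < q -> q < 1 -> 0 <= Phi_inv ((1 + q) / 2).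
Proof.
move=> q0 q1; rewrite leNgt; apply/negP => /ltW /Phi_le.
by rewrite Phi_invK ?Phi0; lra.
Qed.

(** -phi is a primitive of x phi(x) and vanishes at infinity, where phi is dominated by a multiple
    of exp(-x). *)
Lemma integral_tail_id (t : R) : 0 <= t ->
  (\int[leb]_(x in [set` `[t, +oo[%R]) (x * phi x)%:E = (phi t)%:E)%E.
Proof.
move=> t0.
have phiE : phi = fun x => (Num.sqrt (2 * pi))^-1 * expR (- (x ^+ 2 / 2)).
  by apply/funext => x; rewrite normal_pdf01E.
have dphi (x : R) : is_derive x 1 (fun x => - phi x) (x * phi x).
  rewrite phiE; apply: is_derive_eq.
  have scE (a b : R) : a *: (b : R^o) = a * b by [].
  by set c := (Num.sqrt _)^-1; rewrite !scaler0 add0r !scE; field.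
have cphi : continuous phi by apply: continuous_normal_pdf; rewrite oner_eq0.
rewrite (@ge0_continuous_FTC2y _ _ (fun x => - phi x) t 0).
- by rewrite sub0e EFinN oppeK.
- by move=> x tx; rewrite mulr_ge0 ?normal_pdf_ge0// (le_trans t0).
- apply: continuous_subspaceT => x; apply: cvgM; first exact: cvg_id.
  exact: cphi.
- rewrite -[X in _ --> X]oppr0; apply: cvgN.
  have c0 : 0 <= (Num.sqrt (2 * pi))^-1 :> R by rewrite invr_ge0.
  apply: (@squeeze_cvgr _ _ _ _ (cst 0) (fun x => expR 2^-1 * (Num.sqrt (2 * pi))^-1 * expR (- x))).
  + near=> x; rewrite normal_pdf_ge0/= normal_pdf01E -mulrA mulrCA.
    rewrite ler_wpM2l// -expRD ler_expR.
    by have := sqr_ge0 (x - 1); lra.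
  + exact: cvg_cst.
  + rewrite -[X in _ --> X](mulr0 (expR 2^-1 * (Num.sqrt (2 * pi))^-1)).
    by apply: cvgM; [exact: cvg_cst|exact: cvgr_expR].
- by move=> x _; have [] := dphi x.
- by apply: cvg_at_right_filter; apply: cvgN; exact: cphi.
- by move=> x _; rewrite derive1E; have [_ ->] := dphi x.
Unshelve. all: by end_near. Qed.

(** On the tail, x phi(x) has integral phi(t); removing t times the tail mass leaves the mean excess
    over t. It evaluates the Lagrangian bound of [spin_linear_le]. *)
Lemma integral_tail_excess (t : R) : 0 <= t ->
  (\int[N01]_x (Num.max (x - t) 0)%:E + (t * (1 - Phi t))%:E = (phi t)%:E)%E.
Proof.
move=> t0.
have mmax : measurable_fun [set: MR] (fun x : MR => Num.max (x - t) 0).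
  by apply: measurable_maxr => //; exact: measurable_funB.
have max0 (x : R) : (0 <= (Num.max (x - t) 0)%:E)%E by rewrite lee_fin le_max lexx orbT.
have mphi (D : set MR) : measurable_fun D phi.
  by apply: measurable_funTS; exact: measurable_normal_pdf.
rewrite -integral_tail_id// EFinM -N01_ge integral_N01//; last exact/measurable_EFinP.
rewrite /normal_prob -ge0_integralZl//; last 2 first.
- exact/measurable_EFinP.
- by move=> x _; rewrite lee_fin normal_pdf_ge0.
rewrite [X in (X + _)%E](_ : _ = \int[leb]_(x in [set` `[t, +oo[%R])
    ((x - t) * phi x)%:E)%E; last first.
  rewrite [RHS]integral_mkcond; apply: eq_integral => x _; rewrite patchE.
  have [tx|tx] := leP t x.
    by rewrite mem_set/= ?in_itv/= ?tx// max_l ?subr_ge0.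
  rewrite memNset/= ?in_itv/= ?andbT ?leNgt ?tx//.
  by rewrite max_r ?mul0e// subr_le0 ltW.
rewrite -ge0_integralD//.
- by apply: eq_integral => x _; rewrite -EFinM -EFinD; congr EFin; ring.
- move=> x /=; rewrite in_itv/= andbT => tx.
  by rewrite lee_fin mulr_ge0 ?subr_ge0 ?normal_pdf_ge0.
- apply/measurable_EFinP; apply: measurable_funM => //.
  exact: measurable_funB.
- by move=> x _; rewrite mule_ge0// lee_fin normal_pdf_ge0.
- by apply: measurable_funeM; exact/measurable_EFinP.
Qed.

Lemma gaussian_marginal n (i : 'I_n) (f : MR -> \bar R) :
  measurable_fun [set: MR] f -> (forall x, 0 <= f x)%E ->
  (\int[gauss n]_x f (tnth x i) = \int[N01]_x f x)%E.
Proof.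
move=> mf f0; elim: n i => [[]//|n IH] i.
have mt m (j : 'I_m) : measurable_fun [set: m.-tuple MR] (fun x => f (tnth x j)).
  by apply: measurableT_comp => //; exact: measurable_tnth.
rewrite (integral_gaussianS (mt _ i))//.
have [j ->|->] := unliftP ord0 i.
  under eq_integral => a _ do under eq_integral do rewrite tnthS.
  under eq_integral do rewrite IH.
  by rewrite integral_cst//= probability_setT mule1.
apply: eq_integral => a _; under eq_integral do rewrite tnth0.
by rewrite integral_cst//= probability_setT mule1.
Qed.

End normal_distribution_function.

(** * The mixed p-spin Hamiltonian *)

Lemma sum_tuple_prod (R : comNzRingType) (I : finType) (m : nat) (f : I -> R) :
  \sum_(t : m.-tuple I) \prod_(j < m) f (tnth t j) = (\sum_i f i) ^+ m.
Proof.
rewrite -[in RHS](card_ord m) -prodr_const bigA_distr_bigA /=.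
rewrite (reindex (@tuple_of_finfun I m)) /=; last first.
  exists finfun_of_tuple => t _; [exact: tuple_of_finfunK|exact: finfun_of_tupleK].
by apply: eq_bigr => g _; apply: eq_bigr => j _; rewrite tnth_map tnth_ord_tuple.
Qed.

Lemma exprB_le (R : realFieldType) (x y : R) (k : nat) : `|x| <= 1 -> `|y| <= 1 ->
  y <= x -> x ^+ k - y ^+ k <= k%:R * (x - y).
Proof.
move=> x1 y1 yx; rewrite subrXX mulrC ler_wpM2r ?subr_ge0//.
rewrite -[k in leRHS]card_ord -sumr_const; apply: ler_sum => i _.
apply: (le_trans (ler_norm _)); rewrite normrM !normrX.
by rewrite mulr_ile1 ?exprn_ge0 ?exprn_ile1.
Qed.

Section mixture.
Context {R : realType}.
Variables (P : nat) (gamma : nat -> R).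
Local Notation xi := (xi P gamma).

Lemma horner_xi x : xi.[x] = \sum_(k < P.-1) gamma k.+2 ^+ 2 * x ^+ k.+2.
Proof.
rewrite /Defs.xi horner_sum -(big_mkord xpredT (fun k => gamma k.+2 ^+ 2 * x ^+ k.+2)).
case: P => [|p]; first by rewrite !big_geq.
by rewrite !big_add1; apply: eq_bigr => k _; rewrite hornerZ hornerXn.
Qed.

Lemma horner_deriv_xi1 : xi^`().[1] = \sum_(k < P.-1) gamma k.+2 ^+ 2 * k.+2%:R.
Proof.
rewrite /Defs.xi raddf_sum horner_sum -(big_mkord xpredT (fun k => gamma k.+2 ^+ 2 * k.+2%:R)).
case: P => [|p]; first by rewrite !big_geq.
rewrite !big_add1; apply: eq_bigr => k _.
by rewrite /= derivZ derivXn hornerZ hornerMn hornerXn expr1n.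
Qed.

Lemma xi_lipschitz x y : `|x| <= 1 -> `|y| <= 1 -> y <= x ->
  xi.[x] - xi.[y] <= xi^`().[1] * (x - y).
Proof.
move=> x1 y1 yx; rewrite !horner_xi horner_deriv_xi1 -sumrB mulr_suml.
apply: ler_sum => k _; rewrite -mulrBr -[leRHS]mulrA ler_wpM2l ?sqr_ge0//.
exact: exprB_le.
Qed.

Lemma xi_abs x : xi.[x] <= xi.[`|x|].
Proof.
rewrite !horner_xi; apply: ler_sum => k _; rewrite ler_wpM2l ?sqr_ge0//.
by rewrite -normrX ler_norm.
Qed.

Lemma xi_le x y : 0 <= x -> x <= y -> xi.[x] <= xi.[y].
Proof.
move=> x0 xy; rewrite !horner_xi; apply: ler_sum => k _.
by rewrite ler_wpM2l ?sqr_ge0// lerXn2r ?nnegrE// (le_trans x0).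
Qed.

Lemma xi_ge0 x : 0 <= x -> 0 <= xi.[x].
Proof.
by move=> x0; rewrite horner_xi sumr_ge0// => k _; rewrite mulr_ge0 ?sqr_ge0 ?exprn_ge0.
Qed.

Lemma xi1_le_deriv : xi.[1] <= xi^`().[1].
Proof.
rewrite horner_xi horner_deriv_xi1; apply: ler_sum => k _.
by rewrite expr1n ler_wpM2l ?sqr_ge0// ler1n.
Qed.

Lemma deriv_xi1_ge0 : 0 <= xi^`().[1].
Proof. by apply: le_trans xi1_le_deriv; rewrite xi_ge0. Qed.

Lemma xi_lt1 q : 
  (exists2 k, (2 <= k <= P)%N & gamma k != 0) -> 0 <= q -> q < 1 -> xi.[q] < xi.[1].
Proof.
move=> [k /andP[k2 kP] gk] q0 q1.
have kE : (k.-2.+2 = k)%N by move: k2; case: k {kP gk} => [|[|k]].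
have kP' : (k.-2 < P.-1)%N by move: k2 kP; case: k {kE gk} => [|[|k]]; case: (P).
rewrite !horner_xi -subr_gt0 -sumrB (bigD1 (Ordinal kP'))//= kE.
rewrite ltr_pwDl//.
  rewrite -mulrBr expr1n mulr_gt0//; first by rewrite exprn_even_gt0.
  by rewrite subr_gt0 exprn_ilt1//; move: k2; case: k {kP gk kE kP'}.
apply: sumr_ge0 => i _; rewrite -mulrBr mulr_ge0 ?sqr_ge0// expr1n subr_ge0.
by rewrite exprn_ile1// ltW.
Qed.

Lemma xi1_gt0 : (exists2 k, (2 <= k <= P)%N & gamma k != 0) -> 0 < xi.[1].
Proof.
by move=> h; apply: le_lt_trans (xi_lt1 h (lexx 0) ltr01); exact: xi_ge0.
Qed.

Section size.
Variable N : nat.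
Local Notation config := (config N).
Local Notation MR := (measurableTypeR R).

Definition overlap (s t : config) : R :=
  (\sum_i spin s i * spin t i) / N%:R.

Lemma spin_sqr (s : config) i : spin s i ^+ 2 = 1 :> R.
Proof. by rewrite /spin sqrr_sign. Qed.

Lemma overlap_self (s : config) : (0 < N)%N -> overlap s s = 1.
Proof.
move=> N0; rewrite /overlap.
under eq_bigr do rewrite -expr2 spin_sqr.
by rewrite sumr_const card_ord divff// pnatr_eq0 -lt0n.
Qed.

Lemma normr_overlap (s t : config) : `|overlap s t| <= 1.
Proof.
have [N0|N0] := posnP N.
  by rewrite /overlap (_ : N%:R = 0 :> R) ?invr0 ?mulr0 ?normr0// N0.
rewrite /overlap normrM normfV [`|N%:R|]ger0_norm// ler_pdivrMr ?ltr0n// mul1r.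
apply: (le_trans (ler_norm_sum _ _ _)).
rewrite -[N in leRHS]card_ord -sumr_const; apply: ler_sum => i _.
by rewrite normrM /spin !normrX normrN1 !expr1n mulr1.
Qed.

Definition hvec (s : config) : (disorder_dim P N).-tuple MR :=
  [tuple (let c := enum_val e in
     gamma (tag c).+2 / N%:R `^ ((tag c).+1%:R / 2) *
     \prod_(j < (tag c).+2) spin s (tnth (tagged c) j)) | e < disorder_dim P N].

Let sum_coupling (F : coupling P N -> R) :
  \sum_(e < disorder_dim P N) F (enum_val e) =
  \sum_(k < P.-1) \sum_(i : k.+2.-tuple 'I_N)
    F (Tagged (fun k : 'I_P.-1 => k.+2.-tuple 'I_N) i).
Proof.
rewrite (sig_big_dep xpredT (fun _ => xpredT)
  (fun k i => F (Tagged (fun k : 'I_P.-1 => k.+2.-tuple 'I_N) i))) /=.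
rewrite [RHS](reindex (fun e : 'I_(disorder_dim P N) => enum_val e : coupling P N)) /=.
  by apply: eq_bigr => e _; congr F; case: (enum_val e).
by apply: onW_bij; exact: enum_val_bij.
Qed.

Lemma hamiltonianE (G : disorder P N) s : hamiltonian gamma G s = dot (hvec s) G.
Proof.
rewrite /hamiltonian /dot.
pose F (c : coupling P N) := gamma (tag c).+2 / N%:R `^ ((tag c).+1%:R / 2) *
     \prod_(j < (tag c).+2) spin s (tnth (tagged c) j) * tnth G (enum_rank c).
rewrite [RHS](eq_bigr (fun e => F (enum_val e))); last first.
  by move=> e _; rewrite tnth_mktuple /F enum_valK.
rewrite sum_coupling; apply: eq_bigr => k _; rewrite mulr_sumr.
by apply: eq_bigr => i _; rewrite /F /coef /=; ring.
Qed.

(** In degree k the sum over index tuples factors into the k-th power of the scalar product N R of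
    the two spin vectors, and the normalisation N^(k - 1) of the variance leaves N R^k. *)
Lemma dot_hvec s t : (0 < N)%N -> dot (hvec s) (hvec t) = N%:R * xi.[overlap s t].
Proof.
move=> N0; have N0' : N%:R != 0 :> R by rewrite pnatr_eq0 -lt0n.
rewrite /dot.
pose F (c : coupling P N) := (gamma (tag c).+2 / N%:R `^ ((tag c).+1%:R / 2)) ^+ 2 *
     \prod_(j < (tag c).+2) (spin s (tnth (tagged c) j) * spin t (tnth (tagged c) j)).
rewrite (eq_bigr (fun e => F (enum_val e))); last first.
  by move=> e _; rewrite !tnth_mktuple /F big_split/=; ring.
rewrite sum_coupling horner_xi mulr_sumr; apply: eq_bigr => k _.
rewrite /F /= -mulr_sumr (sum_tuple_prod _ (fun i => spin s i * spin t i)).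
rewrite exprMn exprVn.
have -> : (N%:R `^ (k.+1%:R / 2)) ^+ 2 = N%:R ^+ k.+1 :> R.
  by rewrite -powR_mulrn ?powR_ge0// -powRrM divfK ?pnatr_eq0// powR_mulrn.
rewrite /overlap exprMn exprVn [N%:R ^+ k.+2]exprS.
set A := _ ^+ k.+2; have B0 : N%:R ^+ k.+1 != 0 :> R by rewrite expf_neq0.
by move: B0; set B := N%:R ^+ k.+1 => B0; field; rewrite N0' B0.
Qed.

Lemma dot_hvec_self s : (0 < N)%N -> dot (hvec s) (hvec s) = N%:R * xi.[1].
Proof. by move=> N0; rewrite dot_hvec// overlap_self. Qed.

End size.
End mixture.

Lemma measurable_fin_exists d (T : measurableType d) (I : finType) (A : I -> set T) :
  (forall i, measurable (A i)) -> measurable [set x | exists i, A i x].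
Proof.
move=> mA; rewrite (_ : mkset _ = \bigcup_(i in [set: I]) A i).
  by apply: fin_bigcup_measurable => //; exact: finite_finset.
by apply/seteqP; split=> x /= [i]; [exists i|move=> _; exists i].
Qed.

Section gaussian_law.
Context {R : realType}.
Local Notation MR := (measurableTypeR R).
Local Notation gauss n := (@gaussian R n).

Lemma gaussian_lcomb n (h : n.-tuple MR -> \bar R) (r s : R) :
  measurable_fun [set: n.-tuple MR] h -> (forall x, 0 <= h x)%E ->
  0 < s -> r ^+ 2 + s ^+ 2 = 1 ->
  (\int[gauss n]_x \int[gauss n]_y h (lcomb r s x y) = \int[gauss n]_x h x)%E.
Proof.
move=> mh h0 s0 rs.
have mh1 : measurable_fun setT (fun z : n.-tuple MR * n.-tuple MR => h z.1).
  exact: measurableT_comp.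
apply: (etrans (gaussian_reflection mh1 (fun z => h0 _) s0 rs)).
by apply: eq_integral => x _; rewrite /= integral_cst//= probability_setT mule1.
Qed.

Lemma dot_lcombl n (v x y : n.-tuple MR) a b :
  dot (lcomb a b x y) v = a * dot x v + b * dot y v.
Proof. by rewrite dotC dot_lcombr !(dotC v). Qed.

Lemma sqdist_scale n (b : R) (v w : n.-tuple MR) :
  sqdist (lcomb b 0 v v) (lcomb b 0 w w) = b ^+ 2 * sqdist v w.
Proof.
rewrite /sqdist mulr_sumr; apply: eq_bigr => i _; rewrite !tnth_lcomb; ring.
Qed.

Lemma lin_scale n (b : R) (v x : n.-tuple MR) : dot (lcomb b 0 v v) x = b * dot v x.
Proof. by rewrite dot_lcombl mul0r addr0. Qed.

Lemma Rint_tail_excess n (i : 'I_n) (e t : R) : 0 <= t -> (e == 1) || (e == -1) ->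
  intg (gauss n) (fun x => Num.max (e * tnth x i - t) 0) /\
  \int[gauss n]_x Num.max (e * tnth x i - t) 0 = normal_pdf 0 1 t - t * (1 - Phi t).
Proof.
move=> t0 e1.
have mmax a : measurable_fun [set: MR] (fun x : MR => Num.max (a * x - t) 0).
  by apply: measurable_maxr => //; apply: measurable_funB => //; exact: measurable_funM.
have max0 (x : R) : (0 <= (Num.max x 0)%:E)%E by rewrite lee_fin le_max lexx orbT.
have E : (\int[gauss n]_x (Num.max (e * tnth x i - t) 0)%:E =
    (normal_pdf 0 1 t - t * (1 - Phi t))%:E)%E.
  rewrite (gaussian_marginal i (f := fun x => (Num.max (e * x - t) 0)%:E))//; last first.
    by apply/measurable_EFinP; exact: mmax.
  rewrite EFinB -integral_tail_excess// addeK//.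
  have /orP[/eqP ->|/eqP ->] := e1.
    by apply: eq_integral => x _; rewrite mul1r.
  rewrite -[RHS]integral_N01N//; last first.
    apply/measurable_EFinP; rewrite (_ : (fun x => _) =
      fun x : MR => Num.max (1 * x - t) 0); first exact: mmax.
    by apply/funext => x; rewrite mul1r.
  by apply: eq_integral => x _; rewrite mulN1r.
have ie : intg (gauss n) (fun x => Num.max (e * tnth x i - t) 0).
  apply: intg_ge0 => //; last by rewrite E ltry.
    by apply: (measurableT_comp (mmax e)); exact: measurable_tnth.
  by move=> x; rewrite le_max lexx orbT.
by split => //; rewrite /Rintegral E.
Qed.

End gaussian_law.

Section planted.
Context {R : realType}.
Variables (P : nat) (gamma : nat -> R).
Hypothesis gamma_neq0 : exists2 k, (2 <= k <= P)%N & gamma k != 0.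
Local Notation xi := (xi P gamma).
Variable N : nat.
Hypothesis N0 : (0 < N)%N.
Local Notation config := (config N).
Local Notation MR := (measurableTypeR R).
Local Notation M := (disorder_dim P N).
Local Notation gauss n := (@gaussian R n).
Local Notation hvec := (hvec P gamma).
Local Notation d1 := (xi^`().[1]).
Local Notation H := (hamiltonian gamma).
Implicit Types (s t : config) (G : @disorder R P N).

Let NR : 0 < N%:R :> R. Proof. by rewrite ltr0n. Qed.

Lemma measurable_hamiltonian s : measurable_fun [set: M.-tuple MR] (fun G => H G s).
Proof.
rewrite (_ : (fun G => _) = dot (hvec s)); first exact: measurable_dot.
by apply/funext => G; rewrite hamiltonianE.
Qed.

Definition reach (D : pred config) (l : R) : set (M.-tuple MR) :=
  [set G | exists t, D t /\ (l <= H G t)%R].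

Lemma measurable_reach D l : measurable (reach D l).
Proof.
apply: measurable_fin_exists => t; apply: measurableI.
  exact: (measurable_bool_set (measurable_cst (D t))).
apply: measurable_bool_set; apply: measurable_fun_ler => //.
exact: measurable_hamiltonian.
Qed.

Lemma sqdist_hvec s t : sqdist (hvec s) (hvec t) =
  2 * N%:R * (xi.[1] - xi.[overlap s t]).
Proof. by rewrite sqdistE !dot_hvec// !overlap_self//; ring. Qed.

Lemma hamiltonian_lip (b : R) s (G G' : @disorder R P N) : 0 <= b ->
  `|b * H G s - b * H G' s| <= b * Num.sqrt (N%:R * xi.[1]) * l2dist G G'.
Proof.
move=> b0; rewrite -mulrBr normrM ger0_norm// -mulrA ler_wpM2l// !hamiltonianE.
by apply: lipfun_dot; rewrite dot_hvec_self.
Qed.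

Let gvec (b : R) t : N.-tuple MR := [tuple b * spin t i | i < N].

Let sqdist_gvec b s t : sqdist (gvec b s) (gvec b t) =
  b ^+ 2 * (2 * N%:R * (1 - overlap s t)).
Proof.
rewrite /sqdist.
have -> : 2 * N%:R * (1 - overlap s t) = 2 * \sum_i (1 - spin s i * spin t i) :> R.
  rewrite sumrB sumr_const card_ord /overlap; field; rewrite gt_eqF//.
rewrite !mulr_sumr; apply: eq_bigr => i _; rewrite !tnth_mktuple.
have -> : (b * spin s i - b * spin t i) ^+ 2 =
  b ^+ 2 * (spin s i ^+ 2 + spin t i ^+ 2 - 2 * (spin s i * spin t i)) by ring.
by rewrite !spin_sqr; ring.
Qed.

Section near.
Variables (s : config) (q dl tau : R).
Hypothesis q0 : 0 < q.
Hypothesis q1 : q < 1.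
Hypothesis dl0 : 0 < dl.
Hypothesis tau0 : 0 <= tau.
Hypothesis tauE : Phi tau = (1 + q) / 2.
Variable D : pred config.
Hypothesis DE : forall t, D t = (q - dl <= overlap s t).

Let Ds : D s.
Proof. rewrite DE overlap_self//; move: q1 dl0; lra. Qed.

Let h (x : N.-tuple MR) i : R := Num.max (- spin s i * tnth x i - tau) 0.

(** Lagrangian relaxation: passing from [s] to [t] uses weights w_i = 1 - s_i t_i in [0, 2] of total
    at most N (1 - q + dl). With y_i = -s_i x_i and multiplier [tau], each w_i y_i is at most 2 (y_i
    - tau)_+ + w_i tau. *)
Let spin_linear_le t (x : N.-tuple MR) : D t ->
  dot (gvec 1 t) x <= dot (gvec 1 s) x + 2 * \sum_i h x i + N%:R * (1 - q + dl) * tau.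
Proof.
move=> Dt.
pose w i : R := 1 - spin s i * spin t i.
have w0 i : 0 <= w i <= 2.
  have : `|spin s i * spin t i : R| <= 1.
    by rewrite normrM /spin !normrX normrN1 !expr1n mulr1.
  by rewrite ler_norml /w => /andP[? ?]; apply/andP; split; lra.
have -> : dot (gvec 1 t) x = dot (gvec 1 s) x + \sum_i w i * (- spin s i * tnth x i).
  rewrite /dot -big_split; apply: eq_bigr => i _; rewrite !tnth_mktuple /w.
  have ss : spin s i * spin s i = 1 :> R by exact: spin_sqr.
  change (1 * spin t i * tnth x i =
    1 * spin s i * tnth x i + (1 - spin s i * spin t i) * (- spin s i * tnth x i)).
  rewrite -[in LHS]ss; ring.
rewrite -addrA lerD2l.
have wE : \sum_i w i <= N%:R * (1 - q + dl).
  rewrite /w sumrB sumr_const card_ord.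
  have -> : \sum_i spin s i * spin t i = N%:R * overlap s t :> R.
    by rewrite /overlap mulrC divfK// gt_eqF.
  move: Dt; rewrite DE => Dt.
  by rewrite -[X in X - _]mulr1 -mulrBr ler_wpM2l//; lra.
apply: (@le_trans _ _ (\sum_i (2 * h x i + w i * tau))).
  apply: ler_sum => i _; have /andP[wi0 wi2] := w0 i.
  have h1 : - spin s i * tnth x i <= h x i + tau.
    by rewrite -lerBlDr le_max lexx.
  have h0 : 0 <= h x i by rewrite le_max lexx orbT.
  apply: (le_trans (ler_wpM2l wi0 h1)); rewrite mulrDr lerD2r.
  by rewrite ler_wpM2r.
by rewrite big_split/= -mulr_sumr -mulr_suml lerD2l ler_wpM2r.
Qed.

Variable b : R.
Hypothesis b0 : 0 < b.

Let L := b * Num.sqrt (N%:R * xi.[1]).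
Let L0 : 0 < L.
Proof. by rewrite mulr_gt0// sqrtr_gt0 mulr_gt0// xi1_gt0. Qed.

Let F (G : M.-tuple MR) : R := lse D (fun t => b * H G t).

Let FL : lipfun L F.
Proof. by move=> G G'; apply: (lse_dist Ds) => t _; exact/hamiltonian_lip/ltW. Qed.

Let c := Num.sqrt d1.

(** The comparison of the two fields reduces to xi(1) - xi(R) <= xi'(1) (1 - R). The multiplier
    [tau] is the quantile with 1 - Phi(tau) = (1 - q)/2: the term tau (1 - q) of the constraint then
    cancels against the tail mass in the mean excess, and 2 phi(tau) remains, up to the slack dl
    tau. N ln 2 is the price of passing from log-sum-exp to the maximum. *)
Lemma Rint_lse_hamiltonian :
  \int[gauss M]_G F G <=
  b * (N%:R * (c * (2 * normal_pdf 0 1 tau + dl * tau))) + N%:R * ln 2.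
Proof.
pose a t := lcomb b 0 (hvec t) (hvec t).
pose g t := gvec (b * c) t.
have EF : \int[gauss M]_G F G = \int[gauss M]_G lse D (lin a G).
  apply: eq_Rintegral => G _; congr (lse D _); apply/funext => t.
  by rewrite /lin lin_scale hamiltonianE.
rewrite {}EF; apply: (le_trans (sudakov_fernique Ds (b := g) _)).
  move=> t t'; rewrite sqdist_scale sqdist_hvec sqdist_gvec exprMn.
  rewrite (sqr_sqrtr (deriv_xi1_ge0 P gamma)).
  rewrite -[leRHS]mulrA; apply: (ler_wpM2l (sqr_ge0 b)).
  rewrite [leRHS]mulrCA; apply: ler_wpM2l; first by rewrite mulr_ge0.
  have R1 : `|overlap t t' : R| <= 1 by exact: normr_overlap.
  have R11 : `|1 : R| <= 1 by rewrite normr1.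
  have R2 := le_trans (ler_norm _) R1.
  exact: (xi_lipschitz P gamma R11 R1 R2).
pose S (x : N.-tuple MR) : R := dot (gvec 1 s) x + 2 * \sum_i h x i +
  N%:R * (1 - q + dl) * tau.
have hE i : intg (gauss N) (fun x => h x i) /\
    \int[gauss N]_x h x i = normal_pdf 0 1 tau - tau * (1 - Phi tau).
  apply: Rint_tail_excess => //; rewrite /spin; case: (s i) => /=.
    by rewrite expr1 opprK eqxx.
  by rewrite expr0 eqxx orbT.
have [v1 v2] := Rint_dot (gvec 1 s).
have ih : intg (gauss N) (fun x => \sum_i h x i).
  by apply: intg_sum => i _; case: (hE i).
have ih2 : intg (gauss N) (fun x => 2 * \sum_i h x i) by exact: intgZ.
have ih3 : intg (gauss N) (fun x => dot (gvec 1 s) x + 2 * \sum_i h x i) by exact: intgD.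
have iS : intg (gauss N) S by apply: intgD => //; exact: intg_cst.
have SE : \int[gauss N]_x S x = N%:R * (2 * normal_pdf 0 1 tau + dl * tau).
  rewrite (RintD ih3 (intg_cst _ _)) (RintD v1 ih2) v2 add0r (RintZ _ ih).
  rewrite (Rint_sum _ _ (fun i => (hE i).1)).
  rewrite (eq_bigr (fun=> normal_pdf 0 1 tau - tau * (1 - Phi tau))); last first.
    by move=> i _; case: (hE i).
  rewrite sumr_const card_ord Rintegral_prob_cst.
  by rewrite tauE -mulr_natl; field.
have bc0 : 0 <= b * c by rewrite mulr_ge0 ?sqrtr_ge0// ltW.
have -> : b * (N%:R * (c * (2 * normal_pdf 0 1 tau + dl * tau))) + N%:R * ln 2 =
    \int[gauss N]_x (b * c * S x + N%:R * ln 2).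
  rewrite RintD; [|exact: intgZ|exact: intg_cst].
  by rewrite RintZ// SE Rintegral_prob_cst; ring.
apply: Rint_le.
- have := intg_lse_shift Ds g (fun=> 0) 1.
  rewrite (_ : (fun x => _) = fun x => lse D (lin g x))//.
  by apply/funext => x; congr (lse D _); apply/funext => t; rewrite add0r mul1r.
- by apply: intgD; [exact: intgZ|exact: intg_cst].
move=> x.
have -> : N%:R * ln 2 = ln (#|config|%:R) :> R.
  by rewrite card_ffun card_bool card_ord natrX lnXn// mulr_natl.
apply: (lse_le_max Ds) => t Dt; rewrite /lin.
have -> : dot (g t) x = b * c * dot (gvec 1 t) x.
  rewrite /dot mulr_sumr; apply: eq_bigr => i _; rewrite !tnth_mktuple; ring.
by rewrite ler_wpM2l// spin_linear_le.
Qed.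

(** [b] is an auxiliary inverse temperature: log-sum-exp dominates [b] times the maximum, and after
    division by [b] its entropy costs only ln 2 / b per site. The Lipschitz constant scales with [b]
    too, so the rate does not depend on it. *)
Lemma near_max_tail (eta : R) : 0 < eta ->
  (gauss M (reach D (N%:R * (c * (2 * normal_pdf 0 1 tau + dl * tau) + ln 2 / b + eta))) <=
   (expR (- (N%:R * (eta ^+ 2 / (4 * xi.[1])))))%:E)%E.
Proof.
move=> e0; have r0 : 0 < b * (N%:R * eta) by rewrite !mulr_gt0.
have := lip_tail L0 FL r0.
have -> : (b * (N%:R * eta)) ^+ 2 / (4 * L ^+ 2) = N%:R * (eta ^+ 2 / (4 * xi.[1])).
  have x0 := xi1_gt0 gamma_neq0.
  rewrite /L !exprMn sqr_sqrtr; last by rewrite mulr_ge0// ltW.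
  by field; rewrite !gt_eqF.
apply: le_trans; apply: le_measure; rewrite ?inE.
- exact: measurable_reach.
- apply: measurable_bool_set; apply: measurable_fun_ler => //.
  exact: lipfun_measurable FL.
move=> G /= [t [Dt Ht]]; apply: (le_trans (lerD Rint_lse_hamiltonian (lexx _))).
apply: le_trans (lse_ge _ Dt).
apply: (le_trans _ (ler_wpM2l (ltW b0) Ht)).
by rewrite le_eqVlt; apply/orP; left; apply/eqP; field; rewrite gt_eqF.
Qed.

End near.
End planted.

(** * Correlated disorders *)

Lemma integral_prob_indic d (T : measurableType d) (R : realType) (mu : probability T R)
  (A : set T) : measurable A -> (\int[mu]_x (\1_A x)%:E = mu A)%E.
Proof. by move=> mA; rewrite integral_indic// setIT. Qed.

Lemma prob_half_le d (T : measurableType d) (R : realType) (mu : probability T R)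
  (f : T -> \bar R) : measurable_fun [set: T] f -> (forall x, 0 <= f x)%E ->
  (mu [set x | ((2^-1)%:E <= f x)%E] <= 2%:E * \int[mu]_x f x)%E.
Proof.
move=> mf f0.
have mA : measurable [set x | ((2^-1)%:E <= f x)%E].
  by apply: measurable_bool_set; exact: measurable_fun_lee.
rewrite -(integral_prob_indic mu mA) -ge0_integralZl//.
apply: ge0_le_integral => //.
- by apply/measurable_EFinP; exact: measurable_indic.
- by apply: measurable_funeM.
move=> x _; rewrite indicE; have [/set_mem/= fx|_] := boolP (x \in _).
  have -> : true%:R = 2 * 2^-1 :> R by rewrite divff.
  by rewrite EFinM lee_wpmul2l.
by rewrite mule_ge0.
Qed.

Section witness.
Context {R : realType}.
Local Notation MR := (measurableTypeR R).
Local Notation gauss n := (@gaussian R n).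
Variable n : nat.

Definition noised (r : R) (x y : n.-tuple MR) : n.-tuple MR :=
  lcomb r (Num.sqrt (1 - r ^+ 2)) x y.

Lemma measurable_noised r d (T : measurableType d) (f g : T -> n.-tuple MR) :
  measurable_fun [set: T] f -> measurable_fun [set: T] g ->
  measurable_fun [set: T] (fun x => noised r (f x) (g x)).
Proof. exact: measurable_lcomb. Qed.

Lemma noised1 (x y : n.-tuple MR) : noised 1 x y = x.
Proof.
apply: eq_from_tnth => i.
by rewrite tnth_lcomb expr1n subrr sqrtr0 mul0r addr0 mul1r.
Qed.

Lemma gaussian_noised (h : n.-tuple MR -> \bar R) (r : R) :
  measurable_fun [set: n.-tuple MR] h -> (forall x, 0 <= h x)%E -> 0 <= r <= 1 ->
  (\int[gauss n]_x \int[gauss n]_y h (noised r x y) = \int[gauss n]_x h x)%E.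
Proof.
move=> mh h0 /andP[r0 r1].
(* Correlation 1, the first rung, is apart: the rotation needs a positive weight on the noise. *)
have [->|r1'] := eqVneq r 1.
  apply: eq_integral => x _.
  transitivity (\int[gauss n]_y cst (h x) y)%E; last first.
    by rewrite integral_cst//= probability_setT mule1.
  by apply: eq_integral => y _; rewrite noised1.
have r21 : 0 < 1 - r ^+ 2 by rewrite subr_gt0 expr_lt1// lt_neqAle r1'.
apply: gaussian_lcomb => //; first by rewrite sqrtr_gt0.
by rewrite sqr_sqrtr ?ltW//; ring.
Qed.

Definition noised_prob (r : R) (A : set (n.-tuple MR)) (x : n.-tuple MR) : \bar R :=
  gauss n [set y | A (noised r x y)].

Lemma measurable_noised_preimage r x (A : set (n.-tuple MR)) : measurable A ->
  measurable [set y | A (noised r x y)].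
Proof.
move=> mA; have mN : measurable_fun [set: n.-tuple MR] (noised r x) by exact: measurable_noised.
by rewrite -[X in measurable X]setTI; exact: mN.
Qed.

Section measurable_event.
Variable A : set (n.-tuple MR).
Hypothesis mA : measurable A.

Lemma noised_probE r x :
  noised_prob r A x = (\int[gauss n]_y (\1_A (noised r x y))%:E)%E.
Proof.
rewrite /noised_prob -integral_prob_indic; last exact: measurable_noised_preimage.
by apply: eq_integral => y _; rewrite !indicE; congr (_%:R%:E); apply/idP/idP; rewrite !inE.
Qed.

Lemma measurable_noised_prob r : measurable_fun [set: n.-tuple MR] (noised_prob r A).
Proof.
rewrite (_ : noised_prob r A =
    fun x => (\int[gauss n]_y (\1_A (noised r x y))%:E)%E); last first.
  by apply/funext => x; exact: noised_probE.
apply: (@measurable_integral_snd _ _ _ _ _ _ (fun z => (\1_A (noised r z.1 z.2))%:E)) => //.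
have mI : measurable_fun [set: n.-tuple MR] (\1_A : _ -> R) by exact: measurable_indic.
have mN : measurable_fun [set: n.-tuple MR * n.-tuple MR] (fun z => noised r z.1 z.2).
  exact: measurable_noised.
apply/measurable_EFinP; exact: (measurableT_comp mI mN).
Qed.

Lemma noised_prob_ge0 r x : (0 <= noised_prob r A x)%E.
Proof. exact: measure_ge0. Qed.

Lemma integral_noised_prob r : 0 <= r <= 1 ->
  (\int[gauss n]_x noised_prob r A x = gauss n A)%E.
Proof.
move=> r01; rewrite -integral_prob_indic//.
have m1 : measurable_fun [set: n.-tuple MR] (fun x => (\1_A x)%:E : \bar R).
  by apply/measurable_EFinP; exact: measurable_indic.
rewrite -(gaussian_noised m1 _ r01)//.
by apply: eq_integral => x _; exact: noised_probE.
Qed.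

Lemma noised_prob_half_le r : 0 <= r <= 1 ->
  (gauss n [set x | (2^-1)%:E <= noised_prob r A x] <= 2%:E * gauss n A)%E.
Proof.
move=> r01; rewrite -(integral_noised_prob r01).
by apply: prob_half_le; [exact: measurable_noised_prob|exact: noised_prob_ge0].
Qed.

End measurable_event.

Lemma le_noised_prob r (A B : set (n.-tuple MR)) x x' : measurable A -> measurable B ->
  (forall y, A (noised r x y) -> B (noised r x' y)) ->
  (noised_prob r A x <= noised_prob r B x')%E.
Proof.
move=> mA mB AB; apply: le_measure; rewrite ?inE; [exact: measurable_noised_preimage..|].
by move=> y; exact: AB.
Qed.

End witness.

Section planted_witness.
Context {R : realType}.
Variables (P : nat) (gamma : nat -> R).
Variable N : nat.
Local Notation config := (config N).
Local Notation MR := (measurableTypeR R).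
Local Notation M := (disorder_dim P N).
Local Notation gauss n := (@gaussian R n).
Local Notation hvec := (hvec P gamma).
Implicit Types (t : config) (G : @disorder R P N).

(** The shift by [v] raises the energy of t in the noised disorder by r times [dot (hvec t) v], at
    most l - l', so a point that reaches l with the shift reaches l' without it. The unshifted
    noised disorder has the law of the disorder, and Markov at level 1/2 gives the factor 2. *)
Lemma planted_reach (D : pred config) (l l' r : R) (v : M.-tuple MR) : 0 <= r <= 1 ->
  (forall t, D t -> r * dot (hvec t) v <= l - l') ->
  (gauss M [set G | (2^-1)%:E <= noised_prob r (reach gamma D l) (lcomb 1 1 G v)] <=
   2%:E * gauss M (reach gamma D l'))%E.
Proof.
move=> r01 Dv; apply: le_trans (noised_prob_half_le (measurable_reach gamma D l') r01).
have le G : (noised_prob r (reach gamma D l) (lcomb 1 1 G v) <=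
    noised_prob r (reach gamma D l') G)%E.
  apply: le_noised_prob; [exact: measurable_reach..|].
  move=> G' [t [Dt lt]]; exists t; split=> //; have := Dv t Dt.
  move: lt; rewrite !hamiltonianE !dot_lcombr; lra.
apply: le_measure; rewrite ?inE; last by move=> G /= /le_trans; apply.
  apply: measurable_bool_set; apply: measurable_fun_lee => //.
  apply: measurableT_comp (measurable_noised_prob (measurable_reach gamma D l) r) _.
  by apply: measurable_lcomb.
apply: measurable_bool_set; apply: measurable_fun_lee => //.
exact: (measurable_noised_prob (measurable_reach gamma D l') r).
Qed.

End planted_witness.

(** * Transfer from the planted model *)

Section log_partition.
Context {R : realType}.
Variables (P : nat) (gamma : nat -> R).
Hypothesis gamma_neq0 : exists2 k, (2 <= k <= P)%N & gamma k != 0.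
Local Notation xi := (xi P gamma).
Local Notation MR := (measurableTypeR R).
Local Notation gauss n := (@gaussian R n).

Section size.
Variable N : nat.
Hypothesis N0 : (0 < N)%N.
Local Notation config := (config N).
Local Notation M := (disorder_dim P N).
Local Notation hvec := (hvec P gamma).
Local Notation H := (hamiltonian gamma).
Local Notation Z := (partition_function gamma).
Implicit Types (s t : config) (G : @disorder R P N).

Let lnZ (b : R) (G : M.-tuple MR) : R := ln (Z b G).

Let s0 : config := [ffun=> true].

Lemma partition_function_gt0 b G : 0 < Z b G.
Proof. exact: (@sum_expR_gt0 _ _ predT s0). Qed.

Lemma log_partition_lip b : 0 <= b -> lipfun (b * Num.sqrt (N%:R * xi.[1])) (lnZ b).
Proof.
move=> b0 G G'; apply: (@lse_dist _ _ predT s0) => // t _.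
exact: hamiltonian_lip.
Qed.

Lemma log_partition_lip_gt0 b : 0 < b -> 0 < b * Num.sqrt (N%:R * xi.[1]).
Proof. by move=> b0; rewrite mulr_gt0// sqrtr_gt0 mulr_gt0 ?ltr0n// xi1_gt0. Qed.

Lemma intg_log_partition b : 0 < b -> intg (gauss M) (lnZ b).
Proof.
move=> b0; exact: (lip_intg (log_partition_lip_gt0 b0) (log_partition_lip (ltW b0))).
Qed.

Lemma free_energyE b : 0 < b ->
  free_energy P gamma N b = (N%:R^-1 * \int[gauss M]_G lnZ b G)%:E.
Proof.
by move=> b0; rewrite /free_energy unlock EFinM EFin_Rintegral//; exact: intg_log_partition.
Qed.

Let scale_hvec b s : M.-tuple MR := lcomb b 0 (hvec s) (hvec s).

Let scale_hvec_self b s : dot (scale_hvec b s) (scale_hvec b s) = b ^+ 2 * (N%:R * xi.[1]).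
Proof. by rewrite /scale_hvec lin_scale dotC lin_scale dot_hvec_self//; ring. Qed.

(* Jensen's inequality in the increment: [b1 H] is [b H] plus an independent
   copy of [s H] with [b ^ 2 + s ^ 2 = b1 ^ 2]. *)
Lemma log_partition_le b b1 : 0 < b -> b < b1 ->
  \int[gauss M]_G lnZ b1 G <=
  \int[gauss M]_G lnZ b G + (b1 ^+ 2 - b ^+ 2) * N%:R * xi.[1] / 2.
Proof.
move=> b0 bb1; have b10 : 0 < b1 by apply: lt_trans bb1.
pose r := b / b1; pose s := Num.sqrt (1 - r ^+ 2).
have r1 : r < 1 by rewrite ltr_pdivrMr// mul1r.
have r0 : 0 < r by rewrite divr_gt0.
have r2 : 0 < 1 - r ^+ 2 by rewrite subr_gt0 expr_lt1// ltW.
have ss : s ^+ 2 = 1 - r ^+ 2 by rewrite sqr_sqrtr// ltW.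
have sp : 0 < s by rewrite sqrtr_gt0.
have rs : r ^+ 2 + s ^+ 2 = 1 by rewrite ss; ring.
have L0 := log_partition_lip_gt0 b10; have lip1 := log_partition_lip (ltW b10).
apply: (eq_ler_trans (esym (Rint_lcomb L0 lip1 sp rs))).
have lip2 := lipfun2_lcomb r s L0 lip1.
have L20 : 0 < (`|r| + `|s|) * (b1 * Num.sqrt (N%:R * xi.[1])).
  by rewrite mulr_gt0// ltr_wpDl ?normr_gt0 ?gt_eqF.
pose K := (b1 ^+ 2 - b ^+ 2) * N%:R * xi.[1] / 2.
have -> : \int[gauss M]_G lnZ b G + (b1 ^+ 2 - b ^+ 2) * N%:R * xi.[1] / 2 =
    \int[gauss M]_G (lnZ b G + K).
  by rewrite (RintD (intg_log_partition b0) (intg_cst _ _)) Rintegral_prob_cst.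
apply: Rint_le.
- exact: (lip_intg L20 (lipfun_Rint L20 lip2)).
- by apply: intgD; [exact: intg_log_partition|exact: intg_cst].
move=> x.
pose v t := scale_hvec (b1 * s) t.
pose W (y : M.-tuple MR) : R := \sum_t expR (b * H x t) * expR (dot (v t) y).
have WE y : Z b1 (lcomb r s x y) = W y.
  apply: eq_bigr => t _; rewrite -expRD; congr expR.
  rewrite !hamiltonianE dot_lcombr /v lin_scale.
  by rewrite /r; field; rewrite gt_eqF.
have iW : intg (gauss M) W.
  by apply: intg_sum => t _; apply: intgZ; exact: (intg_expR_dot (v t)).1.
have EW : \int[gauss M]_y W y = Z b x * expR K.
  rewrite /W Rint_sum; last first.
    by move=> t; apply: intgZ; exact: (intg_expR_dot (v t)).1.
  rewrite /partition_function mulr_suml; apply: eq_bigr => t _.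
  rewrite (RintZ _ (intg_expR_dot (v t)).1) (intg_expR_dot (v t)).2; congr (_ * expR _).
  rewrite scale_hvec_self /K exprMn ss /r; field.
  by rewrite gt_eqF.
have a0 : 0 < Z b x * expR K by rewrite mulr_gt0 ?expR_gt0// partition_function_gt0.
set a := Z b x * expR K in EW a0.
have -> : lnZ b x + K = ln a by rewrite /a lnM ?posrE ?expR_gt0// ?expRK// partition_function_gt0.
(* Jensen by the tangent line: ln W <= ln a - 1 + W / a, whose right side has mean ln a because [a]
   is the mean of [W]. *)
have -> : ln a = \int[gauss M]_y (ln a - 1 + a^-1 * W y).
  rewrite (RintD (intg_cst _ _) (intgZ _ iW)) Rintegral_prob_cst (RintZ _ iW) EW.
  by rewrite mulVf ?gt_eqF//; ring.
apply: Rint_le.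
- by case: lip2 => _ _ f2; exact: (lip_intg L20 (f2 x)).
- by apply: intgD; [exact: intg_cst|exact: intgZ].
move=> y /=; rewrite /lnZ WE.
have W0 : 0 < W y by rewrite -WE partition_function_gt0.
have := le_ln1Dx (x := a^-1 * W y - 1).
have -> : 1 + (a^-1 * W y - 1) = a^-1 * W y by ring.
rewrite lnM ?posrE ?invr_gt0// lnV ?posrE//.
have aW : 0 < a^-1 * W y by rewrite mulr_gt0 ?invr_gt0.
by move=> /(_ ltac:(lra)); lra.
Qed.

Section transfer.
Variables (b x p : R) (E : @disorder R P N -> {set config}).
Hypothesis b0 : 0 < b.
Hypothesis x0 : 0 < x.
Hypothesis mE : forall s, measurable [set G : M.-tuple MR | s \in E G].
Hypothesis planted : forall s,
  (gauss M [set G | s \in E (lcomb 1 1 G (lcomb b 0 (hvec s) (hvec s)))] <= p%:E)%E.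
Let f : R := b ^+ 2 * xi.[1] / 2 + ln 2.
Hypothesis lower : N%:R * (f - x) <= \int[gauss M]_G lnZ b G.

Let m := \int[gauss M]_G lnZ b G.
Let A : set (M.-tuple MR) := [set G | lnZ b G <= m - N%:R * x].

Let mlnZ : measurable_fun [set: M.-tuple MR] (lnZ b).
Proof. exact: lipfun_measurable (log_partition_lip_gt0 b0) (log_partition_lip (ltW b0)). Qed.

Let mA : measurable A.
Proof. by apply: measurable_bool_set; exact: measurable_fun_ler. Qed.

Let PA : (gauss M A <= (expR (- (N%:R * (x ^+ 2 / (4 * (b ^+ 2 * xi.[1]))))))%:E)%E.
Proof.
have lipN : lipfun (b * Num.sqrt (N%:R * xi.[1])) (fun G => - lnZ b G).
  by move=> G G'; rewrite -opprD normrN; exact: (log_partition_lip (ltW b0)).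
have Nx : 0 < N%:R * x by rewrite mulr_gt0 ?ltr0n.
have := lip_tail (log_partition_lip_gt0 b0) lipN Nx.
have -> : \int[gauss M]_G (- lnZ b G) = - m.
  rewrite (_ : (fun G => - lnZ b G) = fun G => (-1) * lnZ b G).
    by rewrite (RintZ _ (intg_log_partition b0)) mulN1r.
  by apply/funext => G; rewrite mulN1r.
have -> : (N%:R * x) ^+ 2 / (4 * (b * Num.sqrt (N%:R * xi.[1])) ^+ 2) =
    N%:R * (x ^+ 2 / (4 * (b ^+ 2 * xi.[1]))).
  have x10 := xi1_gt0 gamma_neq0.
  rewrite !exprMn sqr_sqrtr; last by rewrite mulr_ge0// ltW.
  by field; rewrite !gt_eqF ?ltr0n.
by congr (gauss M _ <= _)%E; apply/seteqP; split => G; rewrite /A /=; lra.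
Qed.

Let wt s (G : M.-tuple MR) : R := (s \in E G)%:R * expR (b * H G s).

Let mmem s : measurable_fun [set: M.-tuple MR] (fun G => (s \in E G)%:R : R).
Proof.
rewrite (_ : (fun G => _) = \1_[set G : M.-tuple MR | s \in E G]).
  exact: measurable_indic.
by apply/funext => G; rewrite indicE; congr ((nat_of_bool _)%:R); apply/idP/idP; rewrite inE.
Qed.

Let mwt s : measurable_fun [set: M.-tuple MR] (wt s).
Proof.
apply: measurable_funM; first exact: mmem.
apply: measurableT_comp => //; apply: measurable_funM => //.
exact: measurable_hamiltonian.
Qed.

Let wt0 s G : 0 <= wt s G.
Proof. by rewrite mulr_ge0 ?expR_ge0. Qed.

(** Cameron-Martin: the factor exp(b H) moves the disorder to the one shifted by b v_s, at the price
    of its mean exp(N b^2 xi(1) / 2). *)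
Let int_wt s : (\int[gauss M]_G (wt s G)%:E <=
  (expR (N%:R * (b ^+ 2 * xi.[1] / 2)) * p)%:E)%E.
Proof.
pose v := scale_hvec b s; pose h (G : M.-tuple MR) : \bar R := ((s \in E G)%:R)%:E.
have mh : measurable_fun [set: M.-tuple MR] h by apply/measurable_EFinP; exact: mmem.
have h0 G : (0 <= h G)%E by rewrite lee_fin.
have tr := gaussian_translation v mh h0.
have -> : (\int[gauss M]_G (wt s G)%:E = \int[gauss M]_G
    ((expR (N%:R * (b ^+ 2 * xi.[1] / 2)))%:E *
     (h G * (expR (dot v G - dot v v / 2))%:E)))%E.
  apply: eq_integral => G _; rewrite /h /wt -!EFinM; congr (_%:E).
  rewrite mulrCA -expRD /v lin_scale scale_hvec_self hamiltonianE.
  by congr (_ * expR _); field.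
rewrite ge0_integralZl//; last 2 first.
- apply: emeasurable_funM => //; apply/measurable_EFinP.
  apply: measurableT_comp => //; apply: measurable_funB => //.
  exact: measurable_dot.
- by move=> G _; rewrite mule_ge0// lee_fin expR_ge0.
rewrite EFinM lee_wpmul2l ?lee_fin ?expR_ge0//.
rewrite -[X in (X <= _)%E]tr; apply: le_trans (planted s).
rewrite -integral_prob_indic; last first.
  have mT : measurable_fun [set: M.-tuple MR] (fun G => lcomb 1 1 G v).
    exact: measurable_lcomb.
  by rewrite -[X in measurable X]setTI; exact: mT (mE s).
rewrite le_eqVlt; apply/orP; left; apply/eqP.
apply: eq_integral => G _; rewrite /h indicE; congr ((nat_of_bool _)%:R%:E).
by apply/idP/idP; rewrite inE.
Qed.

(** Off the rare event [A], Z is at least exp(N (f - 2 x)): one x for the fluctuation of ln Z, one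
    for the distance of its mean from the annealed value. There the Gibbs mass is at most the
    unnormalised weight divided by this bound, and the 2^N planted terms add up to exp(N f) p. On
    [A] the Gibbs mass is at most 1. *)
Lemma gibbs_transfer :
  ('E_(gauss M)[fun G => gibbs gamma b G (E G)] <=
   (expR (- (N%:R * (x ^+ 2 / (4 * (b ^+ 2 * xi.[1]))))) + expR (N%:R * (2 * x)) * p)%:E)%E.
Proof.
pose w := N%:R * (f - 2 * x).
have gE G : gibbs gamma b G (E G) = \sum_s wt s G * expR (- lnZ b G).
  rewrite /gibbs big_mkcond; apply: eq_bigr => s _; rewrite /wt.
  rewrite expRN lnK ?posrE ?partition_function_gt0//.
  by case: (s \in E G); rewrite ?mul1r ?mul0r.
pose g G : R := \1_A G + expR (- w) * \sum_s wt s G.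
have gle G : gibbs gamma b G (E G) <= g G.
  rewrite gE /g indicE; have [GA|GA] := boolP (G \in A).
    apply: (@le_trans _ _ 1).
      rewrite -mulr_suml expRN lnK ?posrE ?partition_function_gt0//.
      rewrite ler_pdivrMr ?partition_function_gt0// mul1r; apply: ler_sum => s _.
      by rewrite /wt; case: (s \in E G); rewrite ?mul1r ?mul0r// expR_ge0.
    by rewrite lerDl mulr_ge0 ?expR_ge0// sumr_ge0.
  rewrite add0r -mulr_suml mulrC ler_wpM2r ?sumr_ge0// ler_expR lerN2.
  have : ~ A G by move=> /mem_set; exact/negP.
  rewrite /A /= => /negP; rewrite -ltNge => lt.
  apply: le_trans (ltW lt); apply: le_trans (lerB lower (lexx _)).
  by rewrite /w le_eqVlt; apply/orP; left; apply/eqP; ring.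
have mwts : measurable_fun [set: M.-tuple MR] (fun G => \sum_s wt s G).
  by apply: measurable_sum.
have mg : measurable_fun [set: M.-tuple MR] g.
  by apply: measurable_funD; [exact: measurable_indic|exact: measurable_funM].
have mgibbs : measurable_fun [set: M.-tuple MR] (fun G => gibbs gamma b G (E G)).
  rewrite (_ : (fun G => _) = fun G : M.-tuple MR => (\sum_s wt s G) * expR (- lnZ b G)).
    apply: measurable_funM => //; apply: measurableT_comp => //.
    exact: measurableT_comp.
  by apply/funext => G; rewrite gE mulr_suml.
rewrite unlock; apply: (@le_trans _ _ (\int[gauss M]_G (g G)%:E)%E).
  apply: ge0_le_integral => //.
  - move=> G _; rewrite lee_fin gE sumr_ge0// => s _.
    by rewrite mulr_ge0 ?expR_ge0.
  - exact/measurable_EFinP.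
  - exact/measurable_EFinP.
  - by move=> G _; rewrite lee_fin.
have -> : (\int[gauss M]_G (g G)%:E = gauss M A +
    (expR (- w))%:E * \sum_s \int[gauss M]_G (wt s G)%:E)%E.
  rewrite -integral_prob_indic// -ge0_integral_sum//; last 2 first.
  - by move=> s; apply/measurable_EFinP.
  - by move=> s G _; rewrite lee_fin.
  rewrite -ge0_integralZl//; last 2 first.
  - by apply: emeasurable_sum => s; apply/measurable_EFinP.
  - by move=> G _; apply: sume_ge0 => s _; rewrite lee_fin.
  rewrite -ge0_integralD//; last 3 first.
  - by apply/measurable_EFinP; exact: measurable_indic.
  - by move=> G _; rewrite mule_ge0// ?lee_fin ?expR_ge0// sume_ge0// => s _; rewrite lee_fin.
  - apply: measurable_funeM; apply: emeasurable_sum => s; exact/measurable_EFinP.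
  by apply: eq_integral => G _; rewrite /g EFinD EFinM sumEFin.
rewrite EFinD; apply: leeD; first exact: PA.
apply: (@le_trans _ _ ((expR (- w))%:E *
    \sum_(s : config) (expR (N%:R * (b ^+ 2 * xi.[1] / 2)) * p)%:E)%E).
  by apply: lee_wpmul2l; [rewrite lee_fin expR_ge0|apply: lee_sum].
rewrite sumEFin sumr_const card_ffun card_bool card_ord -EFinM lee_fin.
have -> : (expR (N%:R * (b ^+ 2 * xi.[1] / 2)) * p) *+ (2 ^ N) =
    expR (N%:R * ln 2 + N%:R * (b ^+ 2 * xi.[1] / 2)) * p.
  by rewrite expRD [expR (N%:R * ln 2)]expRM_natl lnK ?posrE// -natrX -[LHS]mulr_natl mulrA.
rewrite [leLHS]mulrA -expRD le_eqVlt; apply/orP; left; apply/eqP; congr (expR _ * p).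
by rewrite /w /f; ring.
Qed.

End transfer.
End size.

(** [beta_c] is a supremum, so some annealed b1 lies above [b], while [b] itself need not be known
    to be annealed. Between [b] and b1 the mean of ln Z grows by at most the annealed amount
    ([log_partition_le]), so the lower bound at b1 descends to [b]. *)
Lemma annealed_lower b x : 0 < b -> b < beta_c P gamma -> 0 < x ->
  \forall N \near \oo, N%:R * (b ^+ 2 * xi.[1] / 2 + ln 2 - x) <=
    \int[gauss (disorder_dim P N)]_G ln (partition_function gamma b G).
Proof.
move=> b0 bc x0.
(* Without a supremum, [sup] takes its default value 0, which contradicts 0 < b < beta_c. *)
have hs : has_sup [set b | annealed P gamma b].
  apply: contrapT => /sup_out bc0; move: bc; rewrite /beta_c bc0.
  by rewrite ltNge ltW.
have := sup_adherent (_ : 0 < beta_c P gamma - b) hs.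
rewrite subr_gt0 => /(_ bc) [b1 ann1]; rewrite -/(beta_c P gamma) opprB addrC subrK => bb1.
have b10 : 0 < b1 by exact: lt_trans bb1.
have cv : free_energy P gamma N b1 @[N --> \oo] --> (b1 ^+ 2 * xi.[1] / 2 + ln 2)%:E by [].
have nb : nbhs (b1 ^+ 2 * xi.[1] / 2 + ln 2)%:E
    [set y : \bar R | ((b1 ^+ 2 * xi.[1] / 2 + ln 2 - x)%:E < y)%E].
  by apply: open_nbhs_nbhs; split; [exact: open_ereal_gt_ereal|rewrite /= lte_fin ltrBlDr ltrDl].
near=> N.
have N0 : (0 < N)%N by near: N; exact: nbhs_infty_gt.
have NR : 0 < N%:R :> R by rewrite ltr0n.
have : ((b1 ^+ 2 * xi.[1] / 2 + ln 2 - x)%:E < free_energy P gamma N b1)%E.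
  by near: N; exact: cv nb.
rewrite free_energyE// lte_fin => /ltW h.
have := log_partition_le N0 b0 bb1.
have : N%:R * (b1 ^+ 2 * xi.[1] / 2 + ln 2 - x) <=
    \int[gauss (disorder_dim P N)]_G ln (partition_function gamma b1 G).
  by rewrite -ler_pdivlMl.
move: (\int[_]_G _) (\int[_]_G _) => u v; lra.
Unshelve. all: by end_near. Qed.

End log_partition.

(** * Noise stability of Lipschitz functions *)

Section noise_operator.
Context {R : realType}.
Local Notation MR := (measurableTypeR R).
Local Notation gauss n := (@gaussian R n).

Lemma lip_tail2 n (L : R) (F : n.-tuple MR -> R) (t : R) : 0 < L -> lipfun L F -> 0 < t ->
  (gauss n [set x | (t <= `|F x - \int[gauss n]_z F z|)%R] <=
   (2 * expR (- (t ^+ 2 / (4 * L ^+ 2))))%:E)%E.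
Proof.
move=> L0 FL t0; set m := \int[_]_z F z.
have FN : lipfun L (fun x => - F x).
  by move=> x y; rewrite -opprD normrN; exact: FL.
have mN : \int[gauss n]_x (- F x) = - m.
  rewrite (_ : (fun x => - F x) = fun x => (-1) * F x).
    by rewrite (RintZ _ (lip_intg L0 FL)) mulN1r.
  by apply/funext => x; rewrite mulN1r.
have t1 := lip_tail L0 FL t0; have t2 := lip_tail L0 FN t0.
rewrite mN in t2; rewrite -/m in t1.
have mF := lipfun_measurable L0 FL; have mFN := lipfun_measurable L0 FN.
have mU : measurable [set x | m + t <= F x].
  by apply: measurable_bool_set; exact: measurable_fun_ler.
have mV : measurable [set x | - m + t <= - F x].
  by apply: measurable_bool_set; exact: measurable_fun_ler.
have -> : 2 * expR (- (t ^+ 2 / (4 * L ^+ 2))) =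
    expR (- (t ^+ 2 / (4 * L ^+ 2))) + expR (- (t ^+ 2 / (4 * L ^+ 2))) by ring.
rewrite EFinD; apply: le_trans (leeD t1 t2).
apply: le_trans (measureU2 _ mU mV); apply: le_measure; rewrite ?inE.
- apply: measurable_bool_set; apply: measurable_fun_ler => //.
  by apply: measurableT_comp => //; exact: measurable_funB.
- exact: measurableU.
move=> x /=; rewrite ler_normr => /orP[h|h]; [left|right]; lra.
Qed.

(** Two concentrations with t / 2 each: of y -> f (x, y) around its mean for fixed x, and of that
    mean as a function of x, which is Lipschitz with the same constant. *)
Lemma lipfun2_tail n m (L : R) (f : n.-tuple MR * m.-tuple MR -> R) (t : R) :
  0 < L -> lipfun2 L f -> 0 < t ->
  (\int[gauss n]_x gauss m [set y |
      (t <= `|f (x, y) - \int[gauss n]_u \int[gauss m]_v f (u, v)|)%R] <=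
   (4 * expR (- (t ^+ 2 / (16 * L ^+ 2))))%:E)%E.
Proof.
move=> L0 fL t0; set c := \int[_]_u _.
pose psi x := \int[gauss m]_v f (x, v).
have psiL : lipfun L psi := lipfun_Rint L0 fL.
have [mf _ f2] := fL.
have t20 : 0 < t / 2 by rewrite divr_gt0.
pose e := 2 * expR (- ((t / 2) ^+ 2 / (4 * L ^+ 2))).
have e4 : 4 * expR (- (t ^+ 2 / (16 * L ^+ 2))) = e + e.
  rewrite /e; have -> : (t / 2) ^+ 2 / (4 * L ^+ 2) = t ^+ 2 / (16 * L ^+ 2).
    by field; rewrite gt_eqF.
  by ring.
pose A := [set x | t / 2 <= `|psi x - c|].
have mA : measurable A.
  apply: measurable_bool_set; apply: measurable_fun_ler => //.
  by apply: measurableT_comp => //; apply: measurable_funB => //; exact: lipfun_measurable psiL.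
have PA : (gauss n A <= e%:E)%E := lip_tail2 L0 psiL t20.
have mset x (r u : R) : measurable [set y | r <= `|f (x, y) - u|].
  apply: measurable_bool_set; apply: measurable_fun_ler => //.
  by apply: measurableT_comp => //; apply: measurable_funB => //; exact: lipfun_measurable (f2 x).
apply: (@le_trans _ _ (\int[gauss n]_x ((\1_A x)%:E + e%:E))%E).
  apply: ge0_le_integral => //.
  - pose B := [set z | t <= `|f z - c|].
    have mB : measurable B.
      apply: measurable_bool_set; apply: measurable_fun_ler => //.
      by apply: measurableT_comp => //; apply: measurable_funB.
    rewrite (_ : (fun x => _) = fun x => (\int[gauss m]_y (\1_B (x, y))%:E)%E).
      apply: (@measurable_integral_snd _ _ _ _ _ _ (fun z => (\1_B z)%:E)) => //.
      by apply/measurable_EFinP; exact: measurable_indic.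
    apply/funext => x; rewrite -(integral_prob_indic _ (mset x t c)).
    by apply: eq_integral => y _; rewrite !indicE.
  - apply: emeasurable_funD => //; apply/measurable_EFinP; exact: measurable_indic.
  move=> x _; rewrite indicE; have [xA|xA] := boolP (x \in A).
    apply: (@le_trans _ _ 1%E); first exact: probability_le1.
    by rewrite -EFinD lee_fin lerDl mulr_ge0 ?expR_ge0.
  rewrite add0e; apply: le_trans (lip_tail2 L0 (f2 x) t20).
  apply: le_measure; rewrite ?inE; [exact: mset..|].
  move=> y /= h; have : ~ A x by move=> /mem_set; exact/negP.
  rewrite /A /= => /negP; rewrite -ltNge => h2.
  have := ler_distD (psi x) (f (x, y)) c; rewrite -/(psi x); lra.
rewrite ge0_integralD//; last 2 first.
- by apply/measurable_EFinP; exact: measurable_indic.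
- by move=> x _; rewrite lee_fin mulr_ge0 ?expR_ge0.
rewrite integral_prob_indic// integral_cst//= probability_setT mule1 e4 EFinD.
by rewrite leeD2r.
Qed.

Section one_function.
Variables (n : nat) (L : R).
Hypothesis L0 : 0 < L.
Implicit Types (F : n.-tuple MR -> R) (r c u : R).

(** The Ornstein-Uhlenbeck semigroup in Mehler form, indexed by the correlation instead of the
    time. *)
Definition noise r F (x : n.-tuple MR) : R := \int[gauss n]_y F (noised r x y).

Let lipF2 r F : lipfun L F ->
  lipfun2 ((`|r| + `|Num.sqrt (1 - r ^+ 2)|) * L) (fun z => F (noised r z.1 z.2)).
Proof. by move=> FL; exact: lipfun2_lcomb. Qed.

Let intg_noised r F x : lipfun L F -> intg (gauss n) (fun y => F (noised r x y)).
Proof.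
move=> FL; apply: (lip_intg (L := L + (`|r| + `|Num.sqrt (1 - r ^+ 2)|) * L)).
  by rewrite ltr_wpDr// mulr_ge0// ltW.
have [_ _ f2] := lipF2 r FL; apply: lipfun_le (f2 x).
by rewrite lerDr ltW.
Qed.

Lemma noise_lip r F : 0 <= r <= 1 -> lipfun L F -> lipfun L (noise r F).
Proof.
move=> /andP[r0 r1] FL x x'; apply: Rint_dist; [exact: intg_noised..|].
move=> y; apply: (le_trans (FL _ _)); rewrite ler_wpM2l ?(ltW L0)//.
by rewrite l2dist_lcombl ger0_norm// -[leRHS]mul1r ler_wpM2r// l2dist_ge0.
Qed.

Lemma noise_bounded r F : lipfun L F -> (forall x, `|F x| <= 1) ->
  forall x, `|noise r F x| <= 1.
Proof.
move=> FL F1 x; rewrite -[noise r F x]subr0 -(Rintegral_prob_cst (gauss n) 0).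
apply: Rint_dist; [exact: intg_noised|exact: intg_cst|].
by move=> y; rewrite subr0.
Qed.

Lemma noise1 F : noise 1 F = F.
Proof.
apply/funext => x; rewrite -[RHS](Rintegral_prob_cst (gauss n)).
by apply: eq_Rintegral => y _; rewrite noised1.
Qed.

(** Given x, the two successive independent noises add up to a single Gaussian noise of variance 1 -
    (c u)^2. *)
Lemma noiseM c u F : 0 <= c < 1 -> 0 <= u <= 1 -> lipfun L F ->
  noise c (noise u F) = noise (c * u) F.
Proof.
move=> /andP[c0 c1] /andP[u0 u1] FL.
have [->|u1'] := eqVneq u 1; first by rewrite noise1 mulr1.
have u2 : 0 < 1 - u ^+ 2 by rewrite subr_gt0 expr_lt1// lt_neqAle u1'.
have c2 : 0 < 1 - c ^+ 2 by rewrite subr_gt0 expr_lt1.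
have cu1 : c * u < 1 by apply: le_lt_trans c1; rewrite ler_piMr.
have cu2 : 0 < 1 - (c * u) ^+ 2 by rewrite subr_gt0 expr_lt1// mulr_ge0.
apply/funext => x.
pose s := Num.sqrt (1 - (c * u) ^+ 2).
pose sc := Num.sqrt (1 - c ^+ 2); pose su := Num.sqrt (1 - u ^+ 2).
have ss : s ^+ 2 = 1 - (c * u) ^+ 2 by rewrite sqr_sqrtr// ltW.
have scs : sc ^+ 2 = 1 - c ^+ 2 by rewrite sqr_sqrtr// ltW.
have sus : su ^+ 2 = 1 - u ^+ 2 by rewrite sqr_sqrtr// ltW.
have s0 : 0 < s by rewrite sqrtr_gt0.
have su0 : 0 < su by rewrite sqrtr_gt0.
have sL : 0 < s * L by rewrite mulr_gt0.
have lipx : lipfun (s * L) (fun w => F (lcomb (c * u) s x w)).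
  move=> w w'; apply: (le_trans (FL _ _)); rewrite l2dist_lcombr (ger0_norm (ltW s0)).
  by rewrite mulrA [L * s]mulrC.
have st0 : 0 < su / s by rewrite divr_gt0.
have st1 : (u * sc / s) ^+ 2 + (su / s) ^+ 2 = 1.
  rewrite !exprMn !exprVn ss scs sus; field.
  by rewrite gt_eqF// -exprMn.
transitivity (\int[gauss n]_y \int[gauss n]_z
    F (lcomb (c * u) s x (lcomb (u * sc / s) (su / s) y z))); last first.
  exact: (Rint_lcomb sL lipx st0 st1).
apply: eq_Rintegral => y _; apply: eq_Rintegral => z _; congr F.
apply: eq_from_tnth => i; rewrite !tnth_lcomb -/sc -/su; field.
by rewrite gt_eqF.
Qed.

Lemma lip_mul_bounded F F' (x x' : n.-tuple MR) (C C' : R) :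
  `|F x| <= 1 -> `|F' x'| <= 1 ->
  `|F x - F x'| <= C -> `|F' x - F' x'| <= C' -> `|F x * F' x - F x' * F' x'| <= C + C'.
Proof.
move=> Fx F'x' FC F'C.
have -> : F x * F' x - F x' * F' x' = (F x - F x') * F' x' + F x * (F' x - F' x') by ring.
apply: (le_trans (ler_normD _ _)); rewrite !normrM; apply: lerD.
  by apply: le_trans FC; rewrite ler_piMr.
by apply: le_trans F'C; rewrite ler_piMl.
Qed.

Section bounded.
Variable F : n.-tuple MR -> R.
Hypothesis FL : lipfun L F.
Hypothesis F1 : forall x, `|F x| <= 1.

Definition autocorrelation r := \int[gauss n]_x (F x * noise r F x).

Let lip_sqr (b : n.-tuple MR -> R) : lipfun L b -> (forall x, `|b x| <= 1) ->
  lipfun (L + L) (fun x => b x ^+ 2).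
Proof.
move=> bL b1 x x'; rewrite mulrDl; exact: (@lip_mul_bounded b b).
Qed.

(** The noise operator at u^2 is the square of the one at u, and the latter is self-adjoint because
    the pair of [x] and its noised copy is exchangeable. *)
Lemma autocorrelation_sqr u : 0 <= u <= 1 ->
  autocorrelation (u ^+ 2) = \int[gauss n]_x (noise u F x ^+ 2).
Proof.
move=> /andP[u0 u1].
have [->|u1'] := eqVneq u 1.
  by rewrite expr1n /autocorrelation noise1; apply: eq_Rintegral => x _.
have u1l : u < 1 by rewrite lt_neqAle u1'.
have u01 : 0 <= u <= 1 by rewrite u0.
pose g := noise u F.
have gL : lipfun L g := noise_lip u01 FL.
have g1 : forall x, `|g x| <= 1 := noise_bounded u FL F1.
have s0 : 0 < Num.sqrt (1 - u ^+ 2) by rewrite sqrtr_gt0 subr_gt0 expr_lt1.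
have us : u ^+ 2 + Num.sqrt (1 - u ^+ 2) ^+ 2 = 1.
  by rewrite sqr_sqrtr; [ring|rewrite subr_ge0 expr_le1].
have inner (b b' : n.-tuple MR -> R) : lipfun L b' -> forall x,
    \int[gauss n]_y (b x * b' (noised u x y)) = b x * noise u b' x.
  by move=> b'L x; rewrite RintZ//; exact: intg_noised.
transitivity (\int[gauss n]_x \int[gauss n]_y (F x * g (noised u x y))).
  apply: eq_Rintegral => x _; rewrite inner// noiseM ?u0//.
transitivity (\int[gauss n]_x \int[gauss n]_y (F (noised u x y) * g x)); last first.
  apply: eq_Rintegral => x _.
  transitivity (\int[gauss n]_y (g x * F (noised u x y))).
    by apply: eq_Rintegral => y _; rewrite mulrC.
  by rewrite inner.
pose K := L + (`|u| + `|Num.sqrt (1 - u ^+ 2)|) * L.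
have K0 : 0 < K by rewrite ltr_wpDr// mulr_ge0// ltW.
have lipP (b b' : n.-tuple MR -> R) : lipfun L b -> lipfun L b' ->
    (forall x, `|b x| <= 1) -> (forall x, `|b' x| <= 1) ->
    lipfun2 K (fun z => b z.1 * b' (noised u z.1 z.2)).
  move=> bL b'L b1 b'1; have [mb f1 f2] := lipF2 u b'L; split.
  - apply: measurable_funM => //.
    by apply: (measurableT_comp (lipfun_measurable L0 bL)).
  - move=> y x x' /=; rewrite /K mulrDl.
    exact: (@lip_mul_bounded b (fun x => b' (noised u x y)) _ _ _ _
      (b1 x) (b'1 _) (bL x x') (f1 y x x')).
  - move=> x y y' /=; rewrite -mulrBr normrM.
    apply: (le_trans (ler_piMl (normr_ge0 _) (b1 x))).
    apply: (le_trans (f2 x y y')); rewrite ler_wpM2r ?l2dist_ge0//.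
    by rewrite lerDr ltW.
apply: (@Rint_reversible _ _ K K (fun z => F z.1 * g z.2)) => //.
  exact: lipP.
apply: lipfun2_ext (lipP _ _ gL FL g1 F1) => z /=.
by rewrite mulrC.
Qed.

Lemma autocorrelation1 : autocorrelation 1 = \int[gauss n]_x (F x ^+ 2).
Proof. by rewrite /autocorrelation noise1; apply: eq_Rintegral => x _. Qed.

(** The difference is the mean over x of the conditional variance of b at the noised point. As a
    function of the noise alone, b is Lipschitz with constant sqrt(1 - c^2) L, so [lip_variance]
    applies. *)
Lemma noise_sqr_drop (b : n.-tuple MR -> R) c : lipfun L b -> (forall x, `|b x| <= 1) ->
  0 < c < 1 ->
  \int[gauss n]_x (b x ^+ 2) - \int[gauss n]_x (noise c b x ^+ 2) <=
  8 * expR 1 * ((1 - c ^+ 2) * L ^+ 2).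
Proof.
move=> bL b1 /andP[c0 c1].
have c01 : 0 <= c <= 1 by rewrite (ltW c0) (ltW c1).
pose s := Num.sqrt (1 - c ^+ 2).
have s2 : 0 < 1 - c ^+ 2 by rewrite subr_gt0 expr_lt1// ltW.
have ss : s ^+ 2 = 1 - c ^+ 2 by rewrite sqr_sqrtr// ltW.
have s0 : 0 < s by rewrite sqrtr_gt0.
have cs : c ^+ 2 + s ^+ 2 = 1 by rewrite ss; ring.
have LL : 0 < L + L by rewrite addr_gt0.
have b2L := lip_sqr bL b1.
have nL := lip_sqr (noise_lip c01 bL) (noise_bounded c bL b1).
have sL : 0 < s * L by rewrite mulr_gt0.
rewrite -(Rint_lcomb LL b2L s0 cs).
have lp := lipfun2_lcomb c s LL b2L.
have L20 : 0 < (`|c| + `|s|) * (L + L).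
  by rewrite mulr_gt0// ltr_wpDl ?normr_gt0 ?gt_eqF.
have i1 : intg (gauss n) (fun x => \int[gauss n]_y (b (lcomb c s x y) ^+ 2)).
  exact: (lip_intg L20 (lipfun_Rint L20 lp)).
have i2 : intg (gauss n) (fun x => noise c b x ^+ 2) := lip_intg LL nL.
rewrite -(RintB i1 i2) -[leRHS](Rintegral_prob_cst (gauss n)).
apply: (Rint_le (intgB i1 i2) (intg_cst _ _)) => x.
have lipx : lipfun (s * L) (fun w => b (lcomb c s x w)).
  move=> w w'; apply: (le_trans (bL _ _)); rewrite l2dist_lcombr (ger0_norm (ltW s0)).
  by rewrite mulrA [L * s]mulrC.
by have [_] := lip_variance sL lipx; rewrite exprMn ss.
Qed.

Lemma autocorrelation_drop c j : 0 < c < 1 ->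
  autocorrelation ((c ^+ j) ^+ 2) - autocorrelation ((c ^+ j.+1) ^+ 2) <=
  8 * expR 1 * ((1 - c ^+ 2) * L ^+ 2).
Proof.
move=> /andP[c0 c1].
have cj k : 0 <= c ^+ k <= 1 by rewrite exprn_ge0 ?(ltW c0)//= exprn_ile1 ?(ltW c0) ?(ltW c1).
rewrite !autocorrelation_sqr// exprS -(noiseM _ (cj j) FL); last by rewrite (ltW c0).
apply: noise_sqr_drop; [exact: noise_lip|exact: noise_bounded|by rewrite c0].
Qed.

End bounded.
End one_function.
End noise_operator.

(** * Outputs of a Lipschitz algorithm *)

Section clip.
Context {R : realType}.

(** Applied to the coordinates of an output: it fixes the spins 1 and -1, keeps Lipschitz constants,
    and bounds the coordinates by 1, which makes products of coordinates Lipschitz even where the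
    output is not a configuration. *)
Definition clip (x : R) : R := Num.max (- 1) (Num.min 1 x).

Lemma clip_bounded x : `|clip x| <= 1.
Proof.
rewrite ler_norml /clip; have [h1|h1] := leP 1 x.
  by have [h2|h2] := leP (-1 : R) 1; apply/andP; split; lra.
by have [h2|h2] := leP (-1) x; apply/andP; split; lra.
Qed.

Lemma clip_id x : `|x| <= 1 -> clip x = x.
Proof.
rewrite ler_norml => /andP[h1 h2]; rewrite /clip; have [h3|h3] := leP 1 x.
  by have [h4|h4] := leP (-1 : R) 1; lra.
by have [h4|h4] := leP (-1) x; lra.
Qed.

Lemma clip_dist x y : `|clip x - clip y| <= `|x - y|.
Proof.
have H (u v : R) : u <= v -> 0 <= clip v - clip u <= v - u.
  move=> uv; rewrite /clip; have [h1|h1] := leP 1 v; have [h2|h2] := leP 1 u;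
    have [h3|h3] := leP (-1 : R) 1; try lra;
    have [h4|h4] := leP (-1) u; have [h5|h5] := leP (-1) v; apply/andP; split; lra.
have [xy|xy] := leP x y.
  by rewrite distrC (distrC x) !ger0_norm ?subr_ge0//; have /andP[] := H _ _ xy; lra.
by rewrite !ger0_norm ?subr_ge0// ?(ltW xy)//; have /andP[] := H _ _ (ltW xy); lra.
Qed.

End clip.

Section chain.
Context {R : realType}.

(* The first index at which [chi] drops to [q], or [K] if there is none. *)
Lemma chain_crossing (chi : nat -> R) (q e : R) (K : nat) : q <= chi 0%N -> 0 <= e ->
  (forall j, chi j - chi j.+1 <= e) ->
  exists2 j, (j <= K)%N & q - e <= chi j /\ (j == K) || (chi j <= q).
Proof.
move=> chi0 e0 drop.
have [j /andP[jK jq]|nj] := pickP (fun j : 'I_K.+1 => (j <= K)%N && (chi j <= q)); last first.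
  exists K; rewrite // eqxx; split=> //; have := nj ord_max.
  by rewrite /= leqnn /= => /negbT; rewrite -ltNge; lra.
have ex : exists j, chi j <= q by exists j.
case: (ex_minnP ex) => m mq mmin.
exists m; first exact: leq_trans (mmin _ jq) jK.
split; last by rewrite mq orbT.
case: m mq mmin => [|m] mq mmin; first lra.
have : q < chi m by rewrite ltNge; apply/negP => /mmin; rewrite ltnn.
by have := drop m; lra.
Qed.

End chain.

Section algorithm.
Context {R : realType}.
Variables (P : nat) (gamma : nat -> R).
Local Notation xi := (xi P gamma).
Variable N : nat.
Hypothesis N0 : (0 < N)%N.
Local Notation config := (config N).
Local Notation MR := (measurableTypeR R).
Local Notation M := (disorder_dim P N).
Local Notation gauss n := (@gaussian R n).
Local Notation H := (hamiltonian gamma).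
Implicit Types (s t : config) (G : @disorder R P N).

Definition window (last : bool) (q dl : R) s : pred config :=
  fun t => (q - dl <= overlap s t) && (last || (overlap s t <= q + dl)).

Definition atypical (q dl c : R) (K : nat) (b : R) G : {set config} :=
  [set s in superlevel gamma b G | [exists j : 'I_K.+1,
    ((2^-1)%:E <= noised_prob ((c ^+ j) ^+ 2)
      (reach gamma (window (j == K :> nat) q dl s) (b * xi.[1] * N%:R)) G)%E]]%SET.

Lemma measurable_superlevel b s : measurable [set G : M.-tuple MR | s \in superlevel gamma b G].
Proof.
rewrite (_ : mkset _ = [set G : M.-tuple MR | b * xi.[1] * N%:R <= H G s]).
  apply: measurable_bool_set; apply: measurable_fun_ler => //.
  exact: measurable_hamiltonian.
by apply/seteqP; split => G /=; rewrite inE.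
Qed.

Lemma measurable_atypical q dl c K b s :
  measurable [set G : M.-tuple MR | s \in atypical q dl c K b G].
Proof.
pose A (j : 'I_K.+1) := [set G : M.-tuple MR |
  ((2^-1)%:E <= noised_prob ((c ^+ j) ^+ 2)
      (reach gamma (window (j == K :> nat) q dl s) (b * xi.[1] * N%:R)) G)%E].
rewrite (_ : mkset _ = [set G : M.-tuple MR | s \in superlevel gamma b G] `&`
    [set G | exists j, A j G]); last first.
  apply/seteqP; split => G /=.
    by rewrite inE => /andP[h /existsP]; split.
  by move=> [h ?]; rewrite inE; apply/andP; split => //; exact/existsP.
apply: measurableI; first exact: measurable_superlevel.
apply: measurable_fin_exists => j.
apply: measurable_bool_set; apply: measurable_fun_lee => //.
exact: (measurable_noised_prob (measurable_reach gamma _ _) _).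
Qed.

Variables (L : R) (A : @disorder R P N -> N.-tuple R).
Hypothesis L0 : 0 < L.
Hypothesis AL : l2lipschitz L A.

Let a i (G : M.-tuple MR) : R := clip (tnth (A G) i).

Let NR : 0 < N%:R :> R. Proof. by rewrite ltr0n. Qed.

Let sum_sqr_lip (x y : M.-tuple MR) :
  \sum_i (tnth (A x) i - tnth (A y) i) ^+ 2 <= (L * l2dist x y) ^+ 2.
Proof.
have s0 : 0 <= \sum_i (tnth (A x) i - tnth (A y) i) ^+ 2.
  by apply: sumr_ge0 => i _; rewrite sqr_ge0.
rewrite -[leLHS](sqr_sqrtr s0) ler_pXn2r// ?nnegrE ?sqrtr_ge0//.
  exact: AL.
by rewrite mulr_ge0 ?l2dist_ge0// ltW.
Qed.

Let coord_lip i : lipfun L (fun G : M.-tuple MR => tnth (A G) i).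
Proof.
move=> x y; rewrite -(ler_pXn2r (n := 2))// ?nnegrE//; last first.
  by rewrite mulr_ge0 ?l2dist_ge0// ltW.
apply: le_trans (sum_sqr_lip x y); rewrite real_normK ?num_real//.
rewrite (bigD1 i)//= lerDl.
by apply: sumr_ge0 => j _; rewrite sqr_ge0.
Qed.

Let a_lip i : lipfun L (a i).
Proof. by move=> x y; apply: (le_trans (clip_dist _ _)); exact: coord_lip. Qed.

Let a_bounded i G : `|a i G| <= 1. Proof. exact: clip_bounded. Qed.

Lemma measurable_outputs_in (E : @disorder R P N -> {set config}) :
  (forall s, measurable [set G : M.-tuple MR | s \in E G]) -> measurable (outputs_in A E).
Proof.
move=> mE; rewrite (_ : outputs_in A E = [set G : M.-tuple MR | exists s,
    ([set G | s \in E G] `&` ~` [set G | exists i, tnth (A G) i != spin s i]) G]); last first.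
  apply/seteqP; split => G /=.
    move=> [s sE As]; exists s; split => // -[i].
    by rewrite As tnth_mktuple eqxx.
  move=> [s [sE ns]]; exists s => //; apply: eq_from_tnth => i.
  rewrite tnth_mktuple; apply/eqP; apply: contrapT => /negP h; apply: ns.
  by exists i.
apply: measurable_fin_exists => s; apply: measurableI => //.
apply: measurableC; apply: measurable_fin_exists => i.
have mi := lipfun_measurable L0 (coord_lip i).
apply: measurable_bool_set; apply: measurable_neg.
exact: measurable_fun_eqr.
Qed.

Let sum_dist_le (x y : M.-tuple MR) :
  \sum_i `|a i x - a i y| <= Num.sqrt N%:R * (L * l2dist x y).
Proof.
pose u : N.-tuple MR := [tuple `|a i x - a i y| | i < N].
pose o : N.-tuple MR := [tuple 1 | i < N].
have := normr_dot_le u o.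
have -> : dot u o = \sum_i `|a i x - a i y|.
  by apply: eq_bigr => i _; rewrite !tnth_mktuple mulr1.
have -> : dot o o = N%:R.
  rewrite /dot (eq_bigr (fun=> 1)); last by move=> i _; rewrite !tnth_mktuple mulr1.
  by rewrite sumr_const card_ord.
rewrite ger0_norm; last by apply: sumr_ge0.
move=> h; apply: (le_trans h); rewrite mulrC ler_wpM2l ?sqrtr_ge0//.
have r0 : 0 <= L * l2dist x y by rewrite mulr_ge0 ?l2dist_ge0// ltW.
rewrite -[leRHS](ger0_norm r0) -sqrtr_sqr ler_wsqrtr//.
apply: le_trans (sum_sqr_lip x y); apply: ler_sum => i _; rewrite tnth_mktuple -expr2.
by rewrite -[leRHS]real_normK ?num_real// ler_pXn2r ?nnegrE// clip_dist.
Qed.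

Let out r (z : M.-tuple MR * M.-tuple MR) : R :=
  (\sum_i a i z.1 * a i (noised r z.1 z.2)) / N%:R.

(** By Cauchy-Schwarz the output moves by at most sqrt(N) L d in the l1 norm. As all coordinates are
    bounded by 1, division by N leaves a Lipschitz constant of order 1 / sqrt(N), so deviations of
    the overlap are exponentially rare in N. *)
Let out_lip r : 0 <= r <= 1 -> lipfun2 (2 * L / Num.sqrt N%:R) (out r).
Proof.
move=> /andP[r0 r1].
have sN : 0 < Num.sqrt N%:R :> R by rewrite sqrtr_gt0.
have sN2 : Num.sqrt N%:R ^+ 2 = N%:R :> R by rewrite sqr_sqrtr// ltW.
have div_le (u d : R) : u <= Num.sqrt N%:R * (L * d) + Num.sqrt N%:R * (L * d) ->
    u / N%:R <= 2 * L / Num.sqrt N%:R * d.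
  move=> h; rewrite ler_pdivrMr//; apply: (le_trans h).
  rewrite le_eqVlt; apply/orP; left; apply/eqP; rewrite -[X in _ = _ * X]sN2; field.
  by rewrite gt_eqF.
have lip_x y x x' : `|out r (x, y) - out r (x', y)| <= 2 * L / Num.sqrt N%:R * l2dist x x'.
  rewrite /out /= -mulrBl normrM [`|_^-1|]ger0_norm ?invr_ge0 ?(ltW NR)// -sumrB.
  apply: div_le; apply: (le_trans (ler_norm_sum _ _ _)).
  apply: (@le_trans _ _ (\sum_i (`|a i x - a i x'| +
      `|a i (noised r x y) - a i (noised r x' y)|))).
    apply: ler_sum => i _.
    exact: (@lip_mul_bounded _ _ (a i) (fun x => a i (noised r x y))).
  rewrite big_split/=; apply: lerD; first exact: sum_dist_le.
  apply: (le_trans (sum_dist_le _ _)); rewrite ler_wpM2l ?(ltW sN)// ler_wpM2l ?(ltW L0)//.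
  by rewrite l2dist_lcombl ger0_norm// ler_piMl// l2dist_ge0.
have lip_y x y y' : `|out r (x, y) - out r (x, y')| <= 2 * L / Num.sqrt N%:R * l2dist y y'.
  rewrite /out /= -mulrBl normrM [`|_^-1|]ger0_norm ?invr_ge0 ?(ltW NR)// -sumrB.
  have d0 : 0 <= Num.sqrt N%:R * (L * l2dist y y').
    by rewrite !mulr_ge0 ?l2dist_ge0// ltW.
  apply: div_le; apply: (le_trans (ler_norm_sum _ _ _)).
  apply: (@le_trans _ _ (Num.sqrt N%:R * (L * l2dist y y'))); last by rewrite lerDl.
  apply: (@le_trans _ _ (\sum_i `|a i (noised r x y) - a i (noised r x y')|)).
    by apply: ler_sum => i _; rewrite -mulrBr normrM ler_piMl.
  apply: (le_trans (sum_dist_le _ _)); rewrite ler_wpM2l ?(ltW sN)// ler_wpM2l ?(ltW L0)//.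
  rewrite l2dist_lcombr ger0_norm ?sqrtr_ge0// ler_piMl ?l2dist_ge0//.
  rewrite -[leRHS]sqrtr1 ler_wsqrtr// lerBlDr lerDl sqr_ge0//.
split => //; apply: measurable_funM => //; apply: measurable_sum => i.
apply: measurable_funM.
  by apply: (measurableT_comp (lipfun_measurable L0 (a_lip i))).
apply: (measurableT_comp (lipfun_measurable L0 (a_lip i))).
exact: measurable_noised.
Qed.

Let chi r : R := (\sum_i autocorrelation (a i) r) / N%:R.

Let intg_lin r i x : intg (gauss M) (fun y => a i x * a i (noised r x y)).
Proof.
apply: intgZ; apply: (@intg_bounded _ _ _ _ _ 1); last by move=> y.
apply: (measurableT_comp (lipfun_measurable L0 (a_lip i))).
exact: measurable_noised.
Qed.

Let chiE r : 0 <= r <= 1 -> \int[gauss M]_x \int[gauss M]_y out r (x, y) = chi r.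
Proof.
move=> r01.
transitivity (\int[gauss M]_x (N%:R^-1 * \sum_i (a i x * noise r (a i) x))).
  apply: eq_Rintegral => x _.
  transitivity (\int[gauss M]_y (N%:R^-1 * \sum_i (a i x * a i (noised r x y)))).
    by apply: eq_Rintegral => y _; rewrite /out mulrC.
  rewrite RintZ; last by apply: intg_sum => i _; exact: intg_lin.
  rewrite Rint_sum; last by move=> i; exact: intg_lin.
  congr (_ * _); apply: eq_bigr => i _; rewrite RintZ//.
  apply: (@intg_bounded _ _ _ _ _ 1); last by move=> y.
  apply: (measurableT_comp (lipfun_measurable L0 (a_lip i))).
  exact: measurable_noised.
have ia i : intg (gauss M) (fun x => a i x * noise r (a i) x).
  apply: (@intg_bounded _ _ _ _ _ 1).
    apply: measurable_funM; first exact: lipfun_measurable (a_lip i).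
    exact: lipfun_measurable (noise_lip L0 r01 (a_lip i)).
  move=> x; rewrite normrM mulr_ile1//.
  exact: (noise_bounded L0).
rewrite RintZ; last by apply: intg_sum => i _.
by rewrite Rint_sum// mulrC.
Qed.

Let chi_drop c j : 0 < c < 1 ->
  chi ((c ^+ j) ^+ 2) - chi ((c ^+ j.+1) ^+ 2) <= 8 * expR 1 * ((1 - c ^+ 2) * L ^+ 2).
Proof.
move=> c01; rewrite /chi -mulrBl -sumrB ler_pdivrMr//.
apply: (@le_trans _ _ (\sum_(i < N) 8 * expR 1 * ((1 - c ^+ 2) * L ^+ 2))).
  by apply: ler_sum => i _; exact: (autocorrelation_drop L0 (a_lip i)).
by rewrite sumr_const card_ord mulr_natr.
Qed.

Let a_spins G s i : A G = spins s -> a i G = spin s i.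
Proof.
move=> As; rewrite /a As tnth_mktuple clip_id//.
by rewrite /spin normrX normrN1 expr1n.
Qed.

(** chi(1) is the mean squared length per site of the clipped output, which equals 1 whenever the
    output is a configuration. *)
Let chi1 b e : (gauss M (~` outputs_in A (superlevel gamma b)) <= e%:E)%E -> 1 - e <= chi 1.
Proof.
set B := outputs_in A _ => Be.
have mB : measurable B by apply: measurable_outputs_in => s; exact: measurable_superlevel.
pose F G : R := N%:R^-1 * \sum_i a i G ^+ 2.
have ma i : measurable_fun [set: M.-tuple MR] (a i) := lipfun_measurable L0 (a_lip i).
have i2 i : intg (gauss M) (fun G => a i G ^+ 2).
  apply: (@intg_bounded _ _ _ _ _ 1); first exact: measurable_funX.
  by move=> x; rewrite normrX exprn_ile1.
have F0 G : 0 <= F G.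
  by rewrite mulr_ge0 ?invr_ge0 ?(ltW NR)// sumr_ge0// => i _; rewrite sqr_ge0.
have iF : intg (gauss M) F by apply: intgZ; apply: intg_sum => i _.
have EF : \int[gauss M]_G F G = chi 1.
  rewrite RintZ; last by apply: intg_sum => i _.
  rewrite Rint_sum// /chi mulrC; congr (_ / _); apply: eq_bigr => i _.
  by rewrite autocorrelation1.
have BF : (gauss M B <= (chi 1)%:E)%E.
  rewrite -EF (EFin_Rintegral iF); apply: prob_markov => //.
    exact: intg_measurable iF.
  move=> G [s _ As]; rewrite /F (eq_bigr (fun=> 1)); last first.
    by move=> i _; rewrite (a_spins _ As) spin_sqr.
  by rewrite sumr_const card_ord mulVf// gt_eqF.
rewrite -lee_fin; apply: le_trans BF.
rewrite EFinB leeBlDr//; apply: (@le_trans _ _ (gauss M B + gauss M (~` B))%E).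
  rewrite -(probability_setT (gauss M)) -(setUv B).
  by apply: measureU2 => //; exact: measurableC.
by rewrite leeD2l.
Qed.

(** The proof covers all disorders by three events: the output is atypical, the output fails, or the
    second output fails or deviates with conditional probability at least 1/2. Markov doubles the
    last contribution, hence 1 + 2 = 3 failures, weakened to 4, and twice the deviation term 4
    [ex]. *)
Lemma lipschitz_algorithm_bound (q dl c b b' e : R) (K : nat) :
  0 < dl -> 0 < c < 1 -> 8 * expR 1 * ((1 - c ^+ 2) * L ^+ 2) <= dl / 4 -> q <= 1 - e ->
  (gauss M (~` outputs_in A (superlevel gamma b)) <= e%:E)%E ->
  ((1 - 8 * expR (- (dl ^+ 2 * N%:R / (256 * L ^+ 2))))%:E <=
    gauss M (outputs_in A (atypical q dl c K b')) +
    4%:E * gauss M (~` outputs_in A (superlevel gamma b')))%E.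
Proof.
move=> dl0 c01 step qe fail.
have /andP[c0 c1] := c01.
(* One rung lowers chi by at most dl / 4 and the overlap stays within dl / 2 of chi, which together
   fit in the window of half-width [dl]. *)
have [j jK [qchi jchi]] : exists2 j, (j <= K)%N &
    q - dl / 4 <= chi ((c ^+ j) ^+ 2) /\ (j == K) || (chi ((c ^+ j) ^+ 2) <= q).
  apply: (@chain_crossing _ (fun j => chi ((c ^+ j) ^+ 2))).
  - by rewrite !expr0 expr1n (le_trans qe)// (chi1 fail).
  - by rewrite divr_ge0// ltW.
  - by move=> j; apply: (le_trans _ step); exact: chi_drop.
set r := (c ^+ j) ^+ 2 in qchi jchi *.
have r01 : 0 <= r <= 1.
  by rewrite sqr_ge0/= exprn_ile1 ?exprn_ge0 ?exprn_ile1 ?(ltW c0) ?(ltW c1).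
set F := ~` outputs_in A (superlevel gamma b'); set B := outputs_in A _.
have mS : measurable (outputs_in A (superlevel gamma b')).
  by apply: measurable_outputs_in => s; exact: measurable_superlevel.
have mF : measurable F by exact: measurableC.
have mB : measurable B by apply: measurable_outputs_in => s; exact: measurable_atypical.
have sN : 0 < Num.sqrt N%:R :> R by rewrite sqrtr_gt0.
have K0 : 0 < 2 * L / Num.sqrt N%:R by rewrite divr_gt0// mulr_gt0.
have d20 : 0 < dl / 2 by rewrite divr_gt0.
have oL := out_lip r01; have [mo _ o2] := oL.
have tail := lipfun2_tail K0 oL d20; rewrite chiE// in tail.
pose dev G := gauss M [set y | dl / 2 <= `|out r (G, y) - chi r|].
have {}tail : (\int[gauss M]_G dev G <=
    (4 * expR (- (dl ^+ 2 * N%:R / (256 * L ^+ 2))))%:E)%E.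
  apply: (le_trans tail); rewrite lee_fin ler_wpM2l// ler_expR lerN2.
  rewrite le_eqVlt; apply/orP; left; apply/eqP.
  have sN2 : Num.sqrt N%:R ^+ 2 = N%:R :> R by rewrite sqr_sqrtr// ltW.
  rewrite -[X in _ * X / _]sN2; field; rewrite !gt_eqF//.
set ex := expR _ in tail *.
pose D := [set z | dl / 2 <= `|out r z - chi r|].
have mD : measurable D.
  apply: measurable_bool_set; apply: measurable_fun_ler => //.
  by apply: measurableT_comp => //; apply: measurable_funB.
have mDy G : measurable [set y | dl / 2 <= `|out r (G, y) - chi r|].
  apply: measurable_bool_set; apply: measurable_fun_ler => //.
  by apply: measurableT_comp => //; apply: measurable_funB => //; exact: lipfun_measurable (o2 G).
have mdev : measurable_fun [set: M.-tuple MR] dev.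
  rewrite (_ : dev = fun x => (\int[gauss M]_y (\1_D (x, y))%:E)%E).
    apply: (@measurable_integral_snd _ _ _ _ _ _ (fun z => (\1_D z)%:E)) => //.
    by apply/measurable_EFinP; exact: measurable_indic.
  apply/funext => x; rewrite /dev -(integral_prob_indic _ (mDy x)).
  by apply: eq_integral => y _; rewrite !indicE.
pose h G := (noised_prob r F G + dev G)%E.
have mh : measurable_fun [set: M.-tuple MR] h.
  by apply: emeasurable_funD => //; exact: measurable_noised_prob.
have h0 G : (0 <= h G)%E by rewrite adde_ge0 ?measure_ge0.
have Ph : (gauss M [set G | (2^-1)%:E <= h G] <= 2%:E * (gauss M F + (4 * ex)%:E))%E.
  apply: (le_trans (prob_half_le _ mh h0)); rewrite lee_wpmul2l// /h.
  rewrite ge0_integralD//; last exact: measurable_noised_prob.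
  by rewrite integral_noised_prob// leeD2l.
have mX : measurable [set G | (2^-1)%:E <= h G]%E.
  by apply: measurable_bool_set; exact: measurable_fun_lee.
(* When [A G] succeeds without being atypical, a witness on rung [j] has conditional probability
   below 1/2. The only other outcomes, a failure of the second output or a deviation of the overlap,
   then share at least 1/2. *)
have cover : [set: M.-tuple MR] `<=` (B `|` F) `|` [set G | (2^-1)%:E <= h G]%E.
  move=> G _; have [BG|nB] := pselect (B G); first by left; left.
  have [FG|nF] := pselect (F G); first by left; right.
  right; move: nF; rewrite /F => /contrapT[s sS As].
  have sE : s \notin atypical q dl c K b' G.
    by apply/negP => sE; apply: nB; exists s.
  pose W : set (M.-tuple MR) := reach gamma (window (j == K) q dl s) (b' * xi.[1] * N%:R).
  have mW : measurable W by exact: measurable_reach.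
  have lt : (noised_prob r W G < (2^-1)%:E)%E.
    rewrite ltNge; apply/negP => le; move/negP: sE; apply.
    rewrite inE sS /=; apply/existsP; exists (Ordinal (n := K.+1) jK).
    exact: le.
  have le1 : (1 <= noised_prob r W G + h G)%E.
    rewrite -(probability_setT (gauss M)) /h addeA.
    have m1 := measurable_noised_preimage r G mW.
    have m2 := measurable_noised_preimage r G mF.
    apply: le_trans (le_trans (measureU2 (gauss M) (measurableU _ _ m1 m2) (mDy G)) _); last first.
      by apply: leeD => //; exact: measureU2.
    apply: le_measure; rewrite ?inE//; first by apply: measurableU => //; exact: measurableU.
    move=> y _; have [Fy|/contrapT[t tS At]] := pselect (F (noised r G y)).
      by left; right.
    have [Dy|nD] := leP (dl / 2) `|out r (G, y) - chi r|; first by right.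
    left; left; exists t.
    have oE : out r (G, y) = overlap s t.
      rewrite /out /overlap; congr (_ / _); apply: eq_bigr => i _ /=.
      by rewrite (a_spins _ As) (a_spins _ At).
    move: nD; rewrite oE ltr_norml => /andP[lo hi].
    split; last by move: tS; rewrite inE.
    rewrite /window; apply/andP; split; first lra.
    by move/orP: jchi => [->//|jq]; apply/orP; right; lra.
  rewrite /= leNgt; apply/negP => lt2; have := lteD lt lt2.
  have -> : ((2^-1)%:E + (2^-1)%:E = 1 :> \bar R)%E by rewrite -EFinD; congr (_%:E); field.
  by rewrite ltNge le1.
have le1 : (1 <= gauss M B + gauss M F + 2%:E * (gauss M F + (4 * ex)%:E))%E.
  rewrite -(probability_setT (gauss M)); apply: (@le_trans _ _
    (gauss M ((B `|` F) `|` [set G | (2^-1)%:E <= h G]%E))).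
    by apply: le_measure; rewrite ?inE//; apply: measurableU => //; exact: measurableU.
  apply: le_trans (measureU2 (gauss M) (measurableU _ _ mB mF) mX) _.
  by apply: leeD => //; exact: measureU2.
have fB : gauss M B \is a fin_num by exact: fin_num_measure.
have fF : gauss M F \is a fin_num by exact: fin_num_measure.
have F0 : 0 <= fine (gauss M F) by exact: fine_ge0.
move: le1; rewrite -(fineK fB) -(fineK fF) -!(EFinD, EFinM) !lee_fin.
lra.
Qed.

End algorithm.

(** * The atypical set in the planted model *)

Section planted_bound.
Context {R : realType}.
Variables (P : nat) (gamma : nat -> R).
Hypothesis gamma_neq0 : exists2 k, (2 <= k <= P)%N & gamma k != 0.
Local Notation xi := (xi P gamma).
Local Notation d1 := (xi^`().[1]).
Variable N : nat.
Hypothesis N0 : (0 < N)%N.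
Local Notation config := (config N).
Local Notation MR := (measurableTypeR R).
Local Notation M := (disorder_dim P N).
Local Notation gauss n := (@gaussian R n).
Local Notation hvec := (hvec P gamma).
Implicit Types (s t : config) (G : @disorder R P N).

Variables (q dl c b b' tau bb eta : R) (K : nat).
Hypothesis q0 : 0 < q.
Hypothesis q1 : q < 1.
Hypothesis dl0 : 0 < dl.
Hypothesis c0 : 0 < c.
Hypothesis c1 : c < 1.
Hypothesis cK : (c ^+ K) ^+ 2 <= dl.
Hypothesis b0 : 0 <= b.
Hypothesis tau0 : 0 <= tau.
Hypothesis tauE : Phi tau = (1 + q) / 2.
Hypothesis bb0 : 0 < bb.
Hypothesis eta0 : 0 < eta.
Hypothesis margin : Num.sqrt d1 * (2 * normal_pdf 0 1 tau + dl * tau) + ln 2 / bb + eta +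
  b * (xi.[q] + dl * d1) <= b' * xi.[1].

Let rho_itv j : 0 <= (c ^+ j) ^+ 2 <= 1.
Proof. by rewrite sqr_ge0/= exprn_ile1 ?exprn_ge0 ?exprn_ile1 ?(ltW c0) ?(ltW c1). Qed.

(** Before the last rung |overlap| is at most q + dl and [xi] has slope at most xi'(1) there. On the
    last rung the overlap has no upper bound better than 1, but the correlation is at most [dl] and
    xi(1) <= xi'(1). *)
Lemma xi_window s t j : window (j == K) q dl s t ->
  (c ^+ j) ^+ 2 * xi.[overlap s t] <= xi.[q] + dl * d1.
Proof.
have R1 : `|overlap s t : R| <= 1 by exact: normr_overlap.
have /andP[rho0 rho1] := rho_itv j.
have x1 : 0 <= xi.[`|overlap s t|] by apply: xi_ge0.
have xq : 0 <= xi.[q] by rewrite xi_ge0// ltW.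
have dd : 0 <= dl * d1 by rewrite mulr_ge0 ?(ltW dl0)// deriv_xi1_ge0.
have le1 : (c ^+ j) ^+ 2 * xi.[overlap s t] <= (c ^+ j) ^+ 2 * xi.[`|overlap s t|].
  by rewrite ler_wpM2l// xi_abs.
move=> /andP[h1 /orP[/eqP jK|h2]]; apply: (le_trans le1).
  have : xi.[`|overlap s t|] <= d1.
    by apply: le_trans (xi1_le_deriv P gamma); rewrite xi_le.
  move=> h; apply: (@le_trans _ _ (dl * d1)); last by rewrite lerDr.
  by rewrite jK in rho0 *; apply: ler_pM.
apply: (@le_trans _ _ xi.[`|overlap s t|]); first by rewrite ler_piMl.
have [hq|hq] := leP `|overlap s t : R| q.
  by apply: (@le_trans _ _ xi.[q]); [rewrite xi_le|rewrite lerDl].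
have nR1 : `| `|overlap s t : R| | <= 1 by rewrite normr_id.
have nq1 : `|q| <= 1 by rewrite ger0_norm ltW.
have := xi_lipschitz P gamma nR1 nq1 (ltW hq).
have h3 : `|overlap s t : R| - q <= dl.
  rewrite lerBlDl ler_norml h2 andbT; apply: le_trans h1.
  by rewrite opprD lerD2r lerNl (le_trans _ (ltW q0))// oppr_le0 ltW.
have : d1 * (`|overlap s t| - q) <= d1 * dl by rewrite ler_wpM2l// deriv_xi1_ge0.
rewrite [d1 * dl]mulrC; move: xi.[`|overlap s t|] xi.[q] (d1 * _) (dl * d1) => *; lra.
Qed.

(** By [margin], once the planted gain is subtracted from the level, a witness on any rung must
    still exceed by eta N the bound on the expected maximum near [s]. A union bound over the K + 1
    rungs concludes. Here [b] is the Gibbs temperature, [b'] the level and [bb] the auxiliary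
    temperature of log-sum-exp. *)
Lemma planted_atypical s :
  (gauss M [set G | s \in atypical gamma q dl c K b' (lcomb 1 1 G (lcomb b 0 (hvec s) (hvec s)))] <=
   (2 * K.+1%:R * expR (- (N%:R * (eta ^+ 2 / (4 * xi.[1])))))%:E)%E.
Proof.
pose v : M.-tuple MR := lcomb b 0 (hvec s) (hvec s).
pose l := b' * xi.[1] * N%:R.
pose l' := N%:R * (Num.sqrt d1 * (2 * normal_pdf 0 1 tau + dl * tau) + ln 2 / bb + eta).
pose W j : set (M.-tuple MR) := reach gamma (window (j == K) q dl s) l.
pose A j : set (M.-tuple MR) :=
  [set G | ((2^-1)%:E <= noised_prob ((c ^+ j) ^+ 2) (W j) (lcomb 1 1 G v))%E].
have mT : measurable_fun [set: M.-tuple MR] (fun G => lcomb 1 1 G v).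
  exact: measurable_lcomb.
have mW j : measurable (W j) := measurable_reach _ _ _.
have mA j : measurable (A j).
  apply: measurable_bool_set; apply: measurable_fun_lee => //.
  exact: (measurableT_comp (measurable_noised_prob (mW j) _) mT).
have PA j : (gauss M (A j) <=
    (2 * expR (- (N%:R * (eta ^+ 2 / (4 * xi.[1])))))%:E)%E.
  have D t : window (j == K) q dl s t -> (c ^+ j) ^+ 2 * dot (hvec t) v <= l - l'.
    move=> /xi_window h; rewrite /v dotC lin_scale dot_hvec//.
    have : b * ((c ^+ j) ^+ 2 * xi.[overlap s t]) <= b * (xi.[q] + dl * d1).
      by rewrite ler_wpM2l.
    move=> h2; have := le_trans (lerD (lexx _) h2) margin.
    rewrite -lerBrDl => h3; have N1 : 0 <= N%:R :> R by [].
    have := ler_wpM2l N1 h3; rewrite /l /l' => h4.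
    apply: (le_trans _ (le_trans h4 _)); rewrite le_eqVlt; apply/orP; left; apply/eqP; ring.
  apply: (le_trans (planted_reach (rho_itv j) D)).
  rewrite EFinM lee_wpmul2l//.
  have := near_max_tail gamma_neq0 N0 q1 dl0 tau0 tauE
    (D := fun t => q - dl <= overlap s t) (fun=> erefl) bb0 eta0.
  apply: le_trans; apply: le_measure; rewrite ?inE; [exact: measurable_reach..|].
  by move=> G [t [/andP[h1 _] h2]]; exists t.
apply: (@le_trans _ _ (gauss M (\big[setU/set0]_(j < K.+1) A j))).
  apply: le_measure; rewrite ?inE.
  - rewrite -[X in measurable X]setTI.
    exact: (mT measurableT _ (measurable_atypical gamma q dl c K b' s)).
  - exact: bigsetU_measurable.
  move=> G /=; rewrite inE => /andP[_ /existsP[j jG]].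
  by rewrite -bigcup_mkord; exists j => //=.
apply: (le_trans (Boole_inequality _ (fun j _ => mA j))).
apply: (@le_trans _ _ (\sum_(j < K.+1) (2 * expR (- (N%:R * (eta ^+ 2 / (4 * xi.[1])))))%:E)%E).
  by apply: lee_sum => j _; exact: PA.
rewrite sumEFin sumr_const card_ord lee_fin -mulr_natr le_eqVlt; apply/orP; left; apply/eqP.
ring.
Qed.

End planted_bound.

(** * Choice of parameters and conclusion *)

Section parameters.
Context {R : realType}.
Variables (P : nat) (gamma : nat -> R).
Hypothesis gamma_neq0 : exists2 k, (2 <= k <= P)%N & gamma k != 0.
Local Notation xi := (xi P gamma).
Local Notation d1 := (xi^`().[1]).

Definition tau_of (q : R) : R := Phi_inv ((1 + q) / 2).

(** The single integer [n] measures all nondegeneracy at once: 1 / n bounds from below the slack of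
    [b] at [q] and the distance of [q] to 1, and n bounds the remaining quantities from above. A
    single integer can be chosen minimal. *)
Definition admissible (b : R) (n : nat) (q : R) : Prop :=
  [/\ (0 < n)%N, 0 < q < 1,
      2 * Num.sqrt d1 * normal_pdf 0 1 (tau_of q) + n%:R^-1 <= b * (xi.[1] - xi.[q]),
      n%:R^-1 <= 1 - q
    & [/\ tau_of q <= n%:R, b <= n%:R, d1 <= n%:R & Num.sqrt d1 <= n%:R]].

(** [n] is taken so large that the slack at [b] is at least 2 / n. Lowering [b] by the factor 1 -
    eps loses at most eps b xi(1) <= 1 / (8 n), so the same [q] and [n] remain admissible. *)
Lemma admissible_near b : beta_d P gamma < b -> 0 < b /\ exists n eps,
  [/\ 0 < eps <= 1 / 2, eps * b * xi.[1] <= (8 * n%:R)^-1 &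
    forall b', (1 - eps) * b <= b' -> b' <= b -> exists q, admissible b' n q].
Proof.
rewrite /beta_d => /inf_lt[].
  by exists (2 * Num.sqrt d1 * normal_pdf 0 1 (Phi_inv ((1 + 2^-1) / 2)) / (xi.[1] - xi.[2^-1])),
    2^-1 => //=; rewrite in_itv/=; apply/andP; split; lra.
move=> v [q /=]; rewrite in_itv/= => /andP[q0 q1] <-; rewrite -/(tau_of q) => fb.
have xiq : 0 < xi.[1] - xi.[q] by rewrite subr_gt0 (xi_lt1 gamma_neq0)// ltW.
have xq0 : 0 <= xi.[q] by rewrite xi_ge0// ltW.
have x10 := xi1_gt0 gamma_neq0.
have d0 := deriv_xi1_ge0 P gamma.
set f := 2 * _ * _ in fb.
have f0 : 0 <= f.
  by rewrite /f !mulr_ge0 ?sqrtr_ge0// ltW// normal_pdf01_gt0.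
have b0 : 0 < b by apply: le_lt_trans fb; rewrite divr_ge0// ltW.
split=> //; pose m := b * (xi.[1] - xi.[q]) - f.
have m0 : 0 < m by rewrite subr_gt0 -ltr_pdivrMr.
have t0 : 0 <= tau_of q by exact: Phi_inv_ge0.
have s0 : 0 <= Num.sqrt d1 by rewrite sqrtr_ge0.
have q10 : 0 < 1 - q by rewrite subr_gt0.
pose S := 2 / m + (1 - q)^-1 + tau_of q + b + d1 + Num.sqrt d1.
have m20 : 0 <= 2 / m by rewrite divr_ge0// ltW.
have q20 : 0 <= (1 - q)^-1 by rewrite invr_ge0 ltW.
pose n := (Num.truncn S).+1.
have Sn : S <= n%:R by rewrite ltW// truncnS_gt.
have n0 : 0 < n%:R :> R by rewrite ltr0n.
have [Sm Sq St Sb] : [/\ 2 / m <= n%:R, (1 - q)^-1 <= n%:R, tau_of q <= n%:R & b <= n%:R].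
  by split; apply: le_trans Sn; rewrite /S; move: (tau_of q) t0 (Num.sqrt _) s0 (_ / m) m20
    (_^-1) q20 => *; lra.
have [nd ns] : d1 <= n%:R /\ Num.sqrt d1 <= n%:R.
  by split; apply: le_trans Sn; rewrite /S; move: (tau_of q) t0 (Num.sqrt _) s0 (_ / m) m20
    (_^-1) q20 => *; lra.
have nm : 2 / n%:R <= m by rewrite ler_pdivrMr// mulrC -ler_pdivrMr.
have nq : n%:R^-1 <= 1 - q by rewrite -[leRHS]invrK lef_pV2 ?posrE ?invr_gt0.
pose u := (8 * n%:R)^-1 / (b * xi.[1]).
have bx : 0 < b * xi.[1] by rewrite mulr_gt0.
have u0 : 0 < u by rewrite divr_gt0// invr_gt0 mulr_gt0.
exists n, (Num.min (1 / 2) u).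
have e0 : 0 < Num.min (1 / 2) u by rewrite lt_min u0 andbT; lra.
have e1 : Num.min (1 / 2) u <= 1 / 2 by rewrite ge_min lexx.
have eb : Num.min (1 / 2) u * b * xi.[1] <= (8 * n%:R)^-1.
  by rewrite -mulrA -ler_pdivlMr// ge_min lexx orbT.
split=> //; first by rewrite e0.
move=> b' lo hi; exists q; split => //.
- by rewrite q0.
- rewrite -/f; set e := Num.min _ _ in lo e0 e1 eb *.
  have : ((1 - e) * b) * (xi.[1] - xi.[q]) <= b' * (xi.[1] - xi.[q]).
    by rewrite ler_wpM2r// ltW.
  apply: le_trans.
  have -> : (1 - e) * b * (xi.[1] - xi.[q]) = m + f - e * b * (xi.[1] - xi.[q]).
    by rewrite /m; ring.
  have : e * b * (xi.[1] - xi.[q]) <= e * b * xi.[1].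
    by rewrite ler_wpM2l ?mulr_ge0 ?(ltW e0) ?(ltW b0)// gerBl.
  have : (8 * n%:R)^-1 = n%:R^-1 / 8 :> R by rewrite invfM mulrC.
  have : 0 < n%:R^-1 :> R by rewrite invr_gt0.
  move: (e * b * (_ - _)) (e * b * _) eb nm => X Y; lra.
- by split => //; exact: le_trans Sb.
Qed.

(** The tolerance [dl] on overlaps: multiplied by two quantities that are at most n, it is at most 1
    / (16 n). *)
Definition gap (n : nat) : R := (16 * n%:R ^+ 3)^-1.

Lemma gap_gt0 n : (0 < n)%N -> 0 < gap n.
Proof. by move=> n0; rewrite invr_gt0 mulr_gt0// exprn_gt0// ltr0n. Qed.

Lemma gap_le n n' : (0 < n)%N -> (n <= n')%N -> gap n' <= gap n.
Proof.
move=> n0 nn'; have n0' := leq_trans n0 nn'.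
rewrite lef_pV2 ?posrE ?mulr_gt0 ?exprn_gt0 ?ltr0n// ler_wpM2l//.
by rewrite ler_pXn2r ?nnegrE// ler_nat.
Qed.

(** The slack 1 / n is spent thus: 1/16 and 2/16 on the tolerance [gap n] (twice because b <= 2 b'
    <= 2 n), 1/8 on planting at [b] while the level is set by [b'], 1/8 on the entropy at auxiliary
    inverse temperature 8 n, 1/2 on the fluctuation 1 / (2 n). This is 15/16 in all. *)
Lemma planted_margin b b' n q : 0 < b -> (1 - 1 / 2) * b <= b' ->
  (b - b') * xi.[1] <= (8 * n%:R)^-1 -> 0 <= b - b' -> admissible b' n q ->
  Num.sqrt d1 * (2 * normal_pdf 0 1 (tau_of q) + gap n * tau_of q) + ln 2 / (8 * n%:R)
    + (2 * n%:R)^-1 + b * (xi.[q] + gap n * d1) <= b' * xi.[1].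
Proof.
move=> b0 bb' small bb [n0 /andP[q0 q1] adm nq [nt nb nd ns]].
have nR : 0 < n%:R :> R by rewrite ltr0n.
have d0 := deriv_xi1_ge0 P gamma.
have g0 := ltW (gap_gt0 n0).
have gE : gap n * n%:R ^+ 2 = n%:R^-1 / 16.
  by rewrite /gap; field; rewrite gt_eqF.
have t0 : 0 <= tau_of q by exact: Phi_inv_ge0.
have h1 : gap n * (Num.sqrt d1 * tau_of q) <= n%:R^-1 / 16.
  by rewrite -gE ler_wpM2l// expr2; apply: ler_pM => //; rewrite sqrtr_ge0.
have h2 : gap n * (b * d1) <= 2 * (n%:R^-1 / 16).
  rewrite -gE [2 * _]mulrCA ler_wpM2l// expr2 mulrA; apply: ler_pM => //; first exact: ltW.
  by lra.
have h3 : (b - b') * xi.[q] <= n%:R^-1 / 8.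
  apply: (@le_trans _ _ ((b - b') * xi.[1])); last first.
    by apply: (le_trans small); rewrite invfM mulrC.
  by rewrite ler_wpM2l// ltW// (xi_lt1 gamma_neq0)// ltW.
have h4 : ln 2 / (8 * n%:R) <= n%:R^-1 / 8 :> R.
  rewrite invfM [_^-1 * _]mulrC mulrA ler_wpM2r ?invr_ge0// ler_piMl ?invr_ge0 ?(ltW nR)//.
  by have := @le_ln1Dx R 1; rewrite -[1 + 1]/2 => h; apply: h; lra.
have h5 : (2 * n%:R)^-1 = n%:R^-1 / 2 :> R by rewrite invfM mulrC.
have n1 : 0 < n%:R^-1 :> R by rewrite invr_gt0.
have -> : Num.sqrt d1 * (2 * normal_pdf 0 1 (tau_of q) + gap n * tau_of q) =
  2 * Num.sqrt d1 * normal_pdf 0 1 (tau_of q) + gap n * (Num.sqrt d1 * tau_of q) by ring.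
have -> : b * (xi.[q] + gap n * d1) = (b - b') * xi.[q] + b' * xi.[q] + gap n * (b * d1).
  by ring.
rewrite h5; move: adm; rewrite mulrBr.
move: (2 * Num.sqrt d1 * _) (gap n * (_ * tau_of q)) h1 (gap n * _) h2 ((b - b') * _) h3
  (ln 2 / _) h4 => f u h1 v h2 w h3 z h4; lra.
Qed.

(* [n] measures how far [b] is above the threshold and is chosen minimal, so
   that it stays bounded when [b] varies near a fixed value. *)
Definition parameters (b L : R) (p : nat * R * R * nat) : Prop :=
  let: (n, q, c, K) := p in
  [/\ admissible b n q, forall m q', admissible b m q' -> (n <= m)%N,
      0 < c < 1, 8 * expR 1 * ((1 - c ^+ 2) * L ^+ 2) <= gap n / 4
    & (c ^+ K) ^+ 2 <= gap n].

Lemma parameters_exist b L n q : 0 < L -> admissible b n q -> exists p, parameters b L p.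
Proof.
move=> L0 adm; have ex : exists n, `[< exists q, admissible b n q >].
  by exists n; apply/asboolP; exists q.
case: (ex_minnP ex) => m /asboolP[q' adm'] mmin.
have m0 : (0 < m)%N by case: adm'.
have g0 := gap_gt0 m0.
pose D := 32 * (expR 1 * L ^+ 2).
have D0 : 0 < D by rewrite mulr_gt0// mulr_gt0 ?expR_gt0// exprn_gt0.
(* The value of 1 - c^2: it is below 1, and 8 e s2 L^2 equals gap / 4 times D / (gap + D), hence is
   at most gap / 4. *)
pose s2 := gap m / (gap m + D).
have gD : 0 < gap m + D by rewrite addr_gt0.
have s0 : 0 < s2 by rewrite divr_gt0.
have s1 : s2 < 1 by rewrite ltr_pdivrMr// mul1r ltrDl.
pose c := Num.sqrt (1 - s2).
have s3 : 0 < 1 - s2 by rewrite subr_gt0.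
have c2 : c ^+ 2 = 1 - s2 by rewrite sqr_sqrtr// ltW.
have c0 : 0 < c by rewrite sqrtr_gt0.
have c1 : c < 1 by rewrite -(@ltr_pXn2r _ 2)// ?nnegrE ?(ltW c0)// c2 expr1n; lra.
have cn1 : `|c| < 1 by rewrite gtr0_norm.
have [K cK] : exists K, (c ^+ K) ^+ 2 <= gap m.
  have /cvgrPdist_le /(_ _ g0)[K _ /(_ K (leqnn K))] := cvg_expr cn1.
  rewrite sub0r normrN ger0_norm ?exprn_ge0 ?(ltW c0)// => h; exists K.
  apply: le_trans h; rewrite expr2 ler_piMl ?exprn_ge0 ?(ltW c0)//.
  by rewrite exprn_ile1 ?(ltW c0) ?(ltW c1).
exists (m, q', c, K); split => //.
- by move=> m' q'' h; apply: mmin; apply/asboolP; exists q''.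
- by rewrite c0.
rewrite c2 opprB addrC subrK.
have -> : 8 * expR 1 * (s2 * L ^+ 2) = gap m / 4 * (D / (gap m + D)).
  by rewrite /s2 /D; field; rewrite gt_eqF.
by rewrite ler_piMr ?divr_ge0 ?(ltW g0)// ler_pdivrMr// mul1r lerDr ltW.
Qed.

Lemma expR_decay (C a a0 : R) : a0 < a ->
  \forall N \near \oo, C * expR (- (N%:R * a)) <= expR (- (a0 * N%:R)).
Proof.
move=> a0a; near=> N.
have h : C <= N%:R * (a - a0).
  rewrite -ler_pdivrMr ?subr_gt0//; near: N; exact: nbhs_infty_ger.
have -> : - (a0 * N%:R) = N%:R * (a - a0) + - (N%:R * a) by ring.
rewrite expRD ler_wpM2r ?expR_ge0//; apply: (le_trans h).
by apply: le_trans (expR_ge1Dx _); rewrite lerDr.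
Unshelve. all: by end_near. Qed.

End parameters.

Theorem theorem1p2 (R : realType) (P : nat) (gamma : nat -> R)
    (P_ge2 : (2 <= P)%N)
    (gamma_neq0 : exists2 k, (2 <= k <= P)%N & gamma k != 0) :
  exists E : R -> R -> forall N, @disorder R P N -> {set config N},
  forall beta : R, beta_d P gamma < beta -> beta < beta_c P gamma ->
  exists eps : R, 0 < eps /\
  exists eps0 : R -> R, (forall B : R, 0 < B -> 0 < eps0 B) /\
  exists c0 c1 : R -> R, (forall L : R, 0 < L -> 0 < c0 L /\ 0 < c1 L) /\
  forall L B : R, 0 < L -> 0 < B ->
  forall beta' : R, (1 - eps) * beta <= beta' -> beta' <= beta ->
  \forall N \near \oo,
    [/\ forall G, E beta' L N G \subset superlevel gamma beta' G,
        forall s, measurable [set G | s \in E beta' L N G],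
        ('E_(gaussian (disorder_dim P N))[fun G => gibbs gamma beta G (E beta' L N G)]
           <= (expR (- (c0 L * N%:R)))%:E)%E
      & forall A : @disorder R P N -> N.-tuple R,
          l2lipschitz L A ->
          (forall G, l2norm (A G) <= Num.sqrt (B * N%:R)) ->
          (gaussian (disorder_dim P N) (~` outputs_in A (superlevel gamma beta))
             <= (eps0 B)%:E)%E ->
          ((1 - expR (- (c1 L * N%:R)))%:E <=
             gaussian (disorder_dim P N) (outputs_in A (E beta' L N)) +
             4%:E * gaussian (disorder_dim P N)
                      (~` outputs_in A (superlevel gamma beta')))%E].
Proof.
pose par b L := xget (0%N, 0, 0, 0%N) [set p | parameters P gamma b L p].
exists (fun b L N G => let: (n, q, c, K) := par b L in atypical gamma q (gap n) c K b G).
move=> b bd bc; have [b0 [n1 [eps [/andP[e0 e1] eb adm]]]] := admissible_near gamma_neq0 bd.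
exists eps; split=> //.
have n10 : (0 < n1)%N.
  by have [|//|q []] := adm b; rewrite // mulrBl mul1r gerBl mulr_ge0// ltW.
have n1R : 0 < n1%:R :> R by rewrite ltr0n.
(* Since q <= 1 - 1/n <= 1 - 1/n1, this failure probability ensures that chi(1) is at least [q],
   where the ladder starts. *)
exists (fun=> n1%:R^-1); split; first by move=> B _; rewrite invr_gt0.
have x10 := xi1_gt0 gamma_neq0.
(* A lower bound, uniform in [beta'], for the rate eta^2 / (4 xi(1)) of the planted estimate with
   eta = 1 / (2 n) and n <= n1. The transfer loses exp(2 x N), so x = r / 4 leaves the rate r /
   2. *)
pose r : R := (16 * n1%:R ^+ 2 * (xi P gamma).[1])^-1.
have r0 : 0 < r by rewrite invr_gt0 !mulr_gt0// exprn_gt0.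
pose x := r / 4.
have x0 : 0 < x by rewrite divr_gt0.
pose a := Num.min (x ^+ 2 / (4 * (b ^+ 2 * (xi P gamma).[1]))) (r / 2).
have a0 : 0 < a.
  by rewrite lt_min !divr_gt0 ?exprn_gt0// !mulr_gt0// exprn_gt0.
(* Halving the rates, here and by 512 in place of 256, absorbs the prefactors 1 + 2 (K + 1) and 8
   for large N. [K] depends on [beta'] but only affects how large N must be. *)
exists (fun=> a / 2), (fun L => gap n1 ^+ 2 / (512 * L ^+ 2)); split.
  move=> L L0; split; first by apply: divr_gt0.
  apply: divr_gt0; first by apply: exprn_gt0; exact: gap_gt0.
  by apply: mulr_gt0; [rewrite ltr0n|exact: exprn_gt0].
move=> L B L0 B0 b' lo hi; have [q1' /(parameters_exist L0)[p hp]] := adm b' lo hi.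
have := xgetPex (0%N, 0, 0, 0%N) (ex_intro _ p hp : exists p, [set p | parameters P gamma b' L p] p).
rewrite -/(par b' L) /=; case: (par b' L) => [[[n q] c] K] /= [].
move=> admn nmin c01 step cK.
(* The minimality of the chosen [n] is used here: n1 is admissible at every level in the range, so
   constants built from n1 serve all of them. *)
have nn1 : (n <= n1)%N by have [q2 /nmin] := adm b' lo hi.
have [n0 /andP[q0 q1] _ nq _] := admn.
have nR : 0 < n%:R :> R by rewrite ltr0n.
have g0 : 0 < gap n :> R by exact: gap_gt0.
have /andP[c0 c1] := c01.
have small : (b - b') * (xi P gamma).[1] <= (8 * n%:R)^-1.
  apply: (@le_trans _ _ (eps * b * (xi P gamma).[1])).
    by rewrite ler_wpM2r ?(ltW x10)//; move: lo; rewrite mulrBl mul1r; lra.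
  apply: (le_trans eb); rewrite lef_pV2 ?posrE ?mulr_gt0// ler_wpM2l// ler_nat//.
have half : (1 - 1 / 2) * b <= b'.
  by apply: le_trans lo; rewrite ler_wpM2r ?(ltW b0)//; lra.
have bb' : 0 <= b - b' by rewrite subr_ge0.
have margin := planted_margin gamma_neq0 b0 half small bb' admn.
have rn : r <= (2 * n%:R)^-1 ^+ 2 / (4 * (xi P gamma).[1]).
  have -> : (2 * n%:R)^-1 ^+ 2 / (4 * (xi P gamma).[1]) =
      (16 * n%:R ^+ 2 * (xi P gamma).[1])^-1.
    by field; rewrite !gt_eqF.
  rewrite lef_pV2 ?posrE ?mulr_gt0 ?exprn_gt0// ler_wpM2r ?(ltW x10)// ler_wpM2l//.
  by rewrite ler_pXn2r ?nnegrE// ler_nat.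
have gap_step : gap n1 ^+ 2 / (512 * L ^+ 2) < gap n ^+ 2 / (256 * L ^+ 2).
  have L2 : 0 < L ^+ 2 by rewrite exprn_gt0.
  have gg : gap n1 ^+ 2 <= gap n ^+ 2 :> R.
    by apply: lerXn2r; rewrite ?nnegrE ?(ltW (gap_gt0 _))//; exact: gap_le.
  have g2 : 0 < gap n ^+ 2 :> R by rewrite exprn_gt0.
  rewrite ltr_pdivrMr; last by apply: mulr_gt0; [rewrite ltr0n|].
  have -> : gap n ^+ 2 / (256 * L ^+ 2) * (512 * L ^+ 2) = 2 * gap n ^+ 2.
    by field; rewrite gt_eqF.
  by lra.
have aa : a / 2 < a by lra.
near=> N.
have N0 : (0 < N)%N by near: N; exact: nbhs_infty_gt.
have NR : 0 <= N%:R :> R by [].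
split.
- by move=> G; apply/fintype.subsetP => s; rewrite inE => /andP[].
- by move=> s; exact: measurable_atypical.
- have lower : N%:R * (b ^+ 2 * (xi P gamma).[1] / 2 + ln 2 - x) <=
      \int[gaussian (disorder_dim P N)]_G ln (partition_function gamma b G).
    by near: N; exact: annealed_lower.
  have eta0 : 0 < (2 * n%:R)^-1 :> R by rewrite invr_gt0 mulr_gt0.
  have bb0 : 0 < 8 * n%:R :> R by rewrite mulr_gt0.
  have t0 : 0 <= tau_of q by exact: Phi_inv_ge0.
  have tE : Phi (tau_of q) = (1 + q) / 2 by apply: Phi_invK; clear -q0 q1; lra.
  have pl := planted_atypical gamma_neq0 N0 q0 q1 g0 c0 c1 cK (ltW b0) t0 tE bb0 eta0 margin.
  have mE s := @measurable_atypical _ P gamma N q (gap n) c K b' s.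
  apply: (le_trans (gibbs_transfer gamma_neq0 N0 b0 x0 mE pl lower)).
  rewrite lee_fin.
  have dec : (1 + 2 * K.+1%:R) * expR (- (N%:R * a)) <= expR (- (a / 2 * N%:R)).
    by near: N; exact: expR_decay.
  apply: le_trans dec; rewrite [leRHS]mulrDl [1 * _]mul1r; apply: lerD.
    by rewrite ler_expR lerN2 ler_wpM2l// ge_min lexx.
  rewrite mulrCA ler_wpM2l ?mulr_ge0// -expRD ler_expR.
  have a2 : a <= r / 2 by rewrite ge_min lexx orbT.
  have := ler_wpM2l NR a2; have := ler_wpM2l NR rn; rewrite /x.
  have -> : N%:R * (2 * (r / 4)) = N%:R * r / 2 by field.
  have -> : N%:R * (r / 2) = N%:R * r / 2 by field.
  move: (N%:R * r) (N%:R * a) (N%:R * _) => *; lra.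
move=> A AL _ fail.
have q1n : q <= 1 - n1%:R^-1.
  have : n1%:R^-1 <= n%:R^-1 :> R by rewrite lef_pV2 ?posrE// ler_nat.
  by lra.
apply: le_trans (lipschitz_algorithm_bound N0 L0 AL b' K g0 c01 step q1n fail).
rewrite lee_fin lerD2l lerN2.
have -> : gap n ^+ 2 * N%:R / (256 * L ^+ 2) = N%:R * (gap n ^+ 2 / (256 * L ^+ 2)).
  by rewrite mulrAC mulrC.
by near: N; exact: expR_decay.
Unshelve. all: by end_near. Qed.
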